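(* Let $r\in(1,2]$ and let $(\mathbb{B},\|\cdot\|_{\mathbb{B}})$ be a (separable) $r$-smooth Banach space. Let $m\geq1$ be an integer, let $(\xi_i)_{i\geq1}$ be an i.i.d. sequence taking values in a measurable space $(S,\mathcal{S})$, and for each $\mathbf{i}\in\operatorname{Inc}^m$ let $h_{\mathbf{i}}\colon S^m\to\mathbb{B}$ be a measurable function which is degenerated with respect to $(\xi_i)_{i\geq1}$, that is, such that for each $\ell_0\in\{1,\dots,m\}$, $$\mathbb{E}\left[h_{\mathbf{i}}(\xi_{\{1,\dots,m\}})\mid\xi_{\{1,\dots,m\}\setminus\{\ell_0\}}\right]=0.$$ Then for each $p\in(1,r]$, each $q\geq p$ and each integer $N\geq m$, $$\mathbb{E}\left[\max_{m\leq n\leq N}\Big\|\sum_{\mathbf{i}\in\operatorname{Inc}_n^m}h_{\mathbf{i}}(\xi_{\mathbf{i}})\Big\|_{\mathbb{B}}^q\right]\leq K(m,p,q,\mathbb{B})\sum_{\mathbf{i}\in\operatorname{Inc}_N^m}\mathbb{E}\left[\|h_{\mathbf{i}}(\xi_{\{1,\dots,m\}})\|_{\mathbb{B}}^q\right]$$ $$+K(m,p,q,\mathbb{B})\sum_{\emptyset\subsetneq J\subsetneq\{1,\dots,m\}}\ \sum_{\mathbf{i}_J\in\mathbb{N}^{J,m}}\mathbb{E}\left[\Big(\sum_{\mathbf{i}_{J^c}:\,\mathbf{i}_J+\mathbf{i}_{J^c}\in\operatorname{Inc}_N^m}\mathbb{E}\left[\|h_{\mathbf{i}_J+\mathbf{i}_{J^c}}(\xi_{\{1,\dots,m\}})\|_{\mathbb{B}}^p\mid\xi_\ell,\ell\in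 J\right]\Big)^{q/p}\right]$$ $$+K(m,p,q,\mathbb{B})\Big(\sum_{\mathbf{i}\in\operatorname{Inc}_N^m}\mathbb{E}\left[\|h_{\mathbf{i}}(\xi_{\{1,\dots,m\}})\|_{\mathbb{B}}^p\right]\Big)^{q/p},$$ where $K(m,p,q,\mathbb{B})$ depends only on $m$, $p$, $q$ and $\mathbb{B}$.
   Context: A separable Banach space $(\mathbb{B},\|\cdot\|_{\mathbb{B}})$ is $r$-smooth, $1<r\leq 2$, if there exists an equivalent norm $\|\cdot\|'_{\mathbb{B}}$ on $\mathbb{B}$ such that $\sup_{t>0}\sup_{x,y\in\mathbb{B},\|x\|'_{\mathbb{B}}=\|y\|'_{\mathbb{B}}=1}\frac{\|x+ty\|'_{\mathbb{B}}+\|x-ty\|'_{\mathbb{B}}-2}{t^r}<\infty$. $S^m$ carries the product $\sigma$-algebra. $\operatorname{Inc}^m=\{\mathbf{i}=(i_1,\dots,i_m): 1\leq i_1<\dots<i_m\}$ and $\operatorname{Inc}^m_n=\{\mathbf{i}=(i_1,\dots,i_m):1\leq i_1<\dots<i_m\leq n\}$. For $\mathbf{i}=(i_1,\dots,i_m)$, $\xi_{\mathbf{i}}=(\xi_{i_1},\dots,\xi_{i_m})$; for a finite set $J$ of indices, $\xi_J=(\xi_j)_{j\in J}$, and conditioning on $\xi_\emptyset$ means taking the expectation. For a proper non-empty subset $J\subset\{1,\dots,m\}$, $\mathbb{N}^{J,m}=\{\sum_{j\in J}v_j\mathbf{e}_j: v_j\in\mathbb{N}\}\subset\mathbb{N}^m$,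 where $\mathbf{e}_j$ has coordinate $j$ equal to $1$ and the others $0$. $J^c=\{1,\dots,m\}\setminus J$, $\mathbf{i}_J$ denotes an element of $\mathbb{N}^{J,m}$ and $\mathbf{i}_{J^c}$ an element of $\mathbb{N}^{J^c,m}$. An empty sum is $0$. *)

(* Defs.v *)
From HB Require Import structures.
From mathcomp Require Import all_boot all_order all_algebra finmap.
From mathcomp Require Import all_classical all_reals all_analysis measurable_realfun.
Set Implicit Arguments.
Unset Strict Implicit.
Unset Printing Implicit Defensive.
Import Order.TTheory GRing.Theory Num.Theory.
Import numFieldNormedType.Exports.
Local Open Scope classical_set_scope.
Local Open Scope ring_scope.

Section Smoothness.
Context {R : realType} (B : normedModType R).

Definition separable := exists D : set B, countable D /\ dense D.

Definition is_norm (N : B -> R) :=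
  [/\ forall x y, N (x + y) <= N x + N y,
      forall a x, N (a *: x) = `|a| * N x
    & forall x, N x = 0 -> x = 0].

Definition equivalent_norm (N : B -> R) :=
  is_norm N /\
  exists c C : R, [/\ 0 < c, 0 < C & forall x, c * `|x| <= N x <= C * `|x|].

(* The two nested suprema are merged into one, over (t, x, y). *)
Definition smooth (r : R) := exists N : B -> R,
  equivalent_norm N /\
  (ereal_sup [set e | exists (t : R) (x y : B),
     [/\ 0 < t, N x = 1, N y = 1 &
      e = ((N (x + t *: y) + N (x - t *: y) - 2) / t `^ r)%:E]%R]
   < +oo)%E.

End Smoothness.

(* Measurability with respect to arbitrary systems of sets, so that it can be
   used for a sub-sigma-algebra of the one carried by the type. *)
Definition measurable_wrt T U (F : set_system T) (G : set_system U)
  (f : T -> U) := forall A, G A -> F (f @^-1` A).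

Definition borel_sets (B : topologicalType) : set_system B := <<s @open B >>.

Section BochnerIntegral.
Context {R : realType} (B : normedModType R).
Context d (T : measurableType d) (P : probability T R).

Definition simple_fun (s : T -> B) :=
  finite_set (range s) /\ forall y, measurable (s @^-1` [set y]).

Definition simple_integral (A : set T) (s : T -> B) : B :=
  \sum_(y \in range s) fine (P (A `&` s @^-1` [set y])) *: y.

Definition simple_approx (A : set T) (X : T -> B) (s : nat -> T -> B) :=
  (forall n, simple_fun (s n)) /\
  (fun n => \int[P]_(t in A) (`|X t - s n t|)%:E)%E @ \oo --> 0%E.

Definition bochner_integrable (X : T -> B) :=
  measurable_wrt measurable (@borel_sets B) X /\
  exists s, simple_approx setT X s.

(* Limit of the integrals of approximating simple functions; meaningful when X
   is Bochner integrable (and B complete), in which case the limit exists and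
   does not depend on the approximation. *)
Definition bochner_integral (A : set T) (X : T -> B) : B :=
  xget 0 [set v | exists s, simple_approx A X s /\
                  (fun n => simple_integral A (s n)) @ \oo --> v].

Definition is_bochner_cond_expectation (G : set_system T) (X Y : T -> B) :=
  [/\ bochner_integrable X, bochner_integrable Y,
      measurable_wrt G (@borel_sets B) Y &
      forall A, G A -> bochner_integral A Y = bochner_integral A X].

End BochnerIntegral.

Section CondExpectation.
Context {R : realType} d (T : measurableType d) (P : probability T R).

Definition is_cond_expectation (G : set_system T) (X Y : T -> \bar R) :=
  [/\ measurable_wrt G measurable Y, forall t, (0 <= Y t)%E &
      forall A, G A -> (\int[P]_(t in A) Y t = \int[P]_(t in A) X t)%E].

(* A version of the conditional expectation given the sub-sigma-algebra G of a
   nonnegative measurable X; it always exists, with values in [0, +oo]. *)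
Definition cond_expectation (G : set_system T) (X : T -> \bar R) : T -> \bar R :=
  xget (cst 0%E) [set Y | is_cond_expectation G X Y].

End CondExpectation.

Section IID.
Context {R : realType} d (T : measurableType d) d' (S : measurableType d').
Context (P : probability T R).

Definition mutually_independent (I : set nat) (xi : nat -> {RV P >-> S}) :=
  forall (F : {fset nat}) (A : nat -> set S),
    [set` F] `<=` I -> (forall i, measurable (A i)) ->
    (P (\bigcap_(i in [set` F]) xi i @^-1` A i) =
     \prod_(i <- F) P (xi i @^-1` A i))%E.

Definition identically_distributed (I : set nat) (xi : nat -> {RV P >-> S}) :=
  forall i j, I i -> I j -> forall A, measurable A ->
    distribution P (xi i) A = distribution P (xi j) A.

(* The sequence is xi_1, xi_2, ...: the variable xi 0 is never used. *)
Definition iid (xi : nat -> {RV P >-> S}) :=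
  mutually_independent [set i | (1 <= i)%N] xi /\
  identically_distributed [set i | (1 <= i)%N] xi.

End IID.

(* Multi-indices are finite functions 'I_m -> nat; coordinate number j + 1 of
   the 1-based mathematical notation is the one at j : 'I_m. *)
Definition multi_index (m : nat) := {ffun 'I_m -> nat}.

Definition Inc (m : nat) : set (multi_index m) :=
  [set i | (forall j, (1 <= i j)%N) /\
           (forall j k : 'I_m, (j < k)%N -> (i j < i k)%N)].

Definition Inc_le (m n : nat) : set (multi_index m) :=
  [set i | Inc i /\ forall j, (i j <= n)%N].

Lemma finite_Inc_le m n : finite_set (@Inc_le m n).
Proof.
apply: (@sub_finite_set _ _ ((fun f : {ffun 'I_m -> 'I_n.+1} =>
  [ffun j => (f j : nat)]) @` setT)); last exact/finite_image/finite_finset.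
move=> i [_ le_i_n]; exists [ffun j => inord (i j)] => //.
by apply/ffunP => j; rewrite !ffunE inordK // ltnS.
Qed.

Definition basis_index m (j : 'I_m) : multi_index m :=
  [ffun k => (k == j : nat)].

(* The set N^{J,m} of the indices i_J. Here 0 is a natural number; this is
   immaterial, since a multi-index of Inc m has no zero coordinate. *)
Definition indices_on m (J : {set 'I_m}) : set (multi_index m) :=
  [set i | exists v : 'I_m -> nat, i = \sum_(j in J) basis_index j *+ v j].

Section Degenerate.
Context {R : realType} d (T : measurableType d) d' (S : measurableType d').
Context (P : probability T R) (xi : nat -> {RV P >-> S}) (m : nat).

Definition xi_at (i : multi_index m) (t : T) : m.-tuple S :=
  [tuple xi (i j) t | j < m].

Definition xi_first (t : T) : m.-tuple S := [tuple xi j.+1 t | j < m].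

(* Trivial when J is empty, so that conditioning on it is taking the expectation. *)
Definition sigma_xi (J : {set 'I_m}) : set_system T :=
  <<s \bigcup_(j in [set` J]) preimage_set_system setT (xi j.+1) measurable >>.

Definition degenerated (B : normedModType R) (h : m.-tuple S -> B) :=
  forall l0 : 'I_m, is_bochner_cond_expectation P (sigma_xi (~: [set l0]))
    (fun t => h (xi_first t)) (fun=> 0).

End Degenerate.

(* Main.v *)
(* A smooth norm satisfies N(x + y)^p + N(x - y)^p <= 2 N(x)^p + C N(y)^p; raising this to a power s >= 1 and
   combining it with Doob's inequality gives Rosenthal's inequality for martingale differences D_k,
     E N(sum D_k)^(ps) <= K (sum_k E N(D_k)^(ps) + E (sum_k E[N(D_k)^p | F_(k-1)])^s).
   Sorting the sum over i_1 < ... < i_m by its largest index k = i_m, degeneracy makes D_k a martingale difference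
   which is itself a degenerate sum of order m - 1 once xi_k is frozen.  The first term is then bounded by induction on m.
   In the second one, the p-th powers of the norms of the D_k averaged over xi_k add up to the p-th power of one norm on
   the L^p space of families indexed by k, with the same two-point inequality, so the induction applies again in that space.
   Unfolding it, each index is either kept outside the power s = q/p or averaged inside it, which yields
   the sum over J; since the xi_k are i.i.d., the averaged terms can be moved to the variables xi_1, ..., xi_m.
   B being only assumed separable and smooth, centering is expressed through a countable norming family of
   functionals, which are derivatives of the norm. *)
Require Import Defs.
From HB Require Import structures.
From mathcomp Require Import all_boot all_order all_algebra finmap.
From mathcomp Require Import all_classical all_reals all_analysis measurable_realfun.
From mathcomp Require Import lra ring zify.
Set Implicit Arguments.
Unset Strict Implicit.
Unset Printing Implicit Defensive.
Import Order.TTheory GRing.Theory Num.Theory.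
Import numFieldNormedType.Exports.
Local Open Scope classical_set_scope.
Local Open Scope ring_scope.

(** * Scalar inequalities *)

(** The induction on m leaves the class of Banach spaces it starts from, so it is run over an
    abstract structure that remembers only what Rosenthal's inequality uses: a two-point inequality,
    a convexity inequality and a weighted Jensen inequality, all linear in the p-th power of the
    norm. Linearity is the point: sums over k and averages over xi_k preserve such inequalities at
    once, whereas a triangle inequality for p-th roots would call for Minkowski's inequality in each
    new space. No filtration appears either: on the space of sequences, E[. | F_(k-1)] of a function
    of the first k coordinates is the average over coordinate k, and a law invariant under redrawing
    a coordinate makes these averages self-adjoint. Absorbing a term into the left-hand side needs a
    finite moment; if some E|h_i|^q is infinite, the right-hand side of the theorem is infinite. The
    constant is fixed before r: only the two-point inequality of order p enters, and it follows from
    r-smoothness for any r >= p. *)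

Section PowerInequalities.
Context {R : realType}.
Implicit Types (a b c d e p q s t u v w x y z : R).

(** Young's inequality for the product [t * 1] with exponents [s] and [s / (s - 1)], multiplied by
    [s]. *)
Lemma bernoulli_powR s t : 1 <= s -> 0 <= t -> 1 + s * (t - 1) <= t `^ s.
Proof.
move=> s1 t0; have [->|s1'] := eqVneq s 1; first by rewrite powRr1//; lra.
have s_gt1 : 1 < s by rewrite lt_neqAle eq_sym s1'.
have := @conjugate_powR R t 1 s (s / (s - 1)) t0 ler01.
have s0 : 0 < s by lra.
have s10 : 0 < s - 1 by lra.
rewrite powR1 mulr1 => /(_ s0 (divr_gt0 s0 s10)).
have -> : s^-1 + (s / (s - 1))^-1 = 1 by field; apply/andP; split; lra.
move=> /(_ erefl); rewrite -[X in X <= _](mulfK (lt0r_neq0 s0)) ler_pdivrMr//.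
have -> : (t `^ s / s + 1 / (s / (s - 1))) * s = t `^ s + s - 1.
  by field; apply/andP; split; lra.
lra.
Qed.

Lemma powR_tangent s x y : 1 <= s -> 0 <= x -> 0 <= y ->
  y `^ s + s * y `^ (s - 1) * (x - y) <= x `^ s.
Proof.
move=> s1 x0 y0; have [->|yn0] := eqVneq y 0.
  rewrite powR0; last lra.
  (* The slope [0]^ (s - 1)[is 1 when]s = 1[, since]0 [^ 0 = 1], and 0 otherwise. *)
  have [->|sn1] := eqVneq s 1; first by rewrite subrr powRr0 powRr1//; lra.
  by rewrite powR0 ?mulr0 ?mul0r ?addr0 ?powR_ge0//; lra.
have yp : 0 < y by rewrite lt_neqAle eq_sym yn0.
have := bernoulli_powR s1 (divr_ge0 x0 y0).
rewrite -(ler_pM2r (powR_gt0 s yp)) -powRM ?divr_ge0// divfK//.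
apply: le_trans; rewrite le_eqVlt; apply/orP; left; apply/eqP.
rewrite -[y `^ s](@mulr_powRB1 _ y s)//; last lra.
by field.
Qed.

Lemma powR_lipschitz1 e b : 0 <= e -> 1 <= b -> exists2 K, 1 <= K &
  forall a, 0 <= a <= b -> `|a `^ e - 1| <= K * `|a - 1|.
Proof.
move=> e0 b1; exists (Num.max 1 (e * b `^ (e - 1))); first by rewrite le_max lexx.
set K := Num.max _ _ => a /andP[a0 ab].
have K1 : 1 <= K by rewrite le_max lexx.
have [e1|e1] := leP 1 e.
- have eK : e <= K.
    rewrite le_max; apply/orP; right.
    by rewrite ler_peMr//; have := @ler_powR R b b1 0 (e-1); rewrite powRr0; apply; lra.
  have [a1|a1] := leP 1 a.
  + rewrite ger0_norm; last first.
      by rewrite subr_ge0; have := @ge0_ler_powR R e e0 1 a; rewrite powR1 !nnegrE; apply.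
    rewrite [X in _ <= _ * X]ger0_norm ?subr_ge0//.
    have := powR_tangent e1 ler01 a0; rewrite powR1.
    have : e * a `^ (e - 1) * (a - 1) <= K * (a - 1).
      rewrite ler_wpM2r ?subr_ge0//; apply: le_trans (_ : e * b `^ (e - 1) <= _).
        by rewrite ler_wpM2l// ge0_ler_powR ?nnegrE//; lra.
      by rewrite le_max lexx orbT.
    lra.
  + rewrite ler0_norm; last first.
      by rewrite subr_le0; have := @ge0_ler_powR R e e0 a 1; rewrite powR1 !nnegrE; apply; lra.
    rewrite [X in _ <= _ * X]ler0_norm; last lra.
    have := bernoulli_powR e1 a0.
    have : e * - (a - 1) <= K * - (a - 1) by rewrite ler_wpM2r//; lra.
    lra.
- apply: (@le_trans _ _ `|a - 1|); last by rewrite ler_peMl.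
  have [->|an0] := eqVneq a 0.
    have [->|en0] := eqVneq e 0; first by rewrite powRr0 subrr normr0.
    by rewrite powR0.
  have ap : 0 < a by rewrite lt_neqAle eq_sym an0.
  have [a1|a1] := leP 1 a.
  + have : 1 <= a `^ e.
      by have := @ge0_ler_powR R e e0 1 a; rewrite powR1 !nnegrE; apply.
    by have := ler1_powR a1 (ltW e1) => ? ?; rewrite !ger0_norm; lra.
  + have : a `^ e <= 1.
      by have := @ge0_ler_powR R e e0 a 1; rewrite powR1 !nnegrE; apply; lra.
    have /ger1_powR : 0 < a <= 1 by lra.
    by move=> /(_ e (ltW e1)) ? ?; rewrite !ler0_norm; lra.
Qed.

Lemma powR_quadratic s b : 1 <= s -> 1 <= b -> exists2 K, 0 <= K &
  forall u, 0 <= u <= b -> u `^ s <= 1 + s * (u - 1) + K * (u - 1) ^+ 2.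
Proof.
move=> s1 b1; have s10 : 0 <= s - 1 by lra.
have [K K1 HK] := powR_lipschitz1 s10 b1.
exists (s * K); first by rewrite mulr_ge0; lra.
move=> u ub; have := HK _ ub => Ku; have /andP[u0 _] := ub.
have [->|un0] := eqVneq u 0.
  rewrite powR0; last lra.
  have : s * 1 <= s * K by rewrite ler_wpM2l//; lra.
  lra.
have := powR_tangent s1 ler01 u0; rewrite powR1 => ut.
suff : s * ((u `^ (s - 1) - 1) * (u - 1)) <= s * (K * (u - 1) ^+ 2) by lra.
rewrite ler_wpM2l//; first lra.
rewrite (le_trans (ler_norm _))// normrM.
by rewrite -(real_normK (num_real (u - 1))) expr2 mulrA ler_wpM2r.
Qed.

Lemma two_point_lift p e s C : 1 <= p <= 2 -> 1 <= e -> 1 <= s -> 0 <= C ->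
  exists2 K, 0 <= K & forall a b d, 0 <= a -> 0 <= b -> 0 <= d <= 1 ->
  `|a - 1| <= d -> `|b - 1| <= d ->
  a `^ e + b `^ e <= 2 + C * d `^ p ->
  (a `^ e) `^ s + (b `^ e) `^ s <= 2 + K * d `^ p.
Proof.
move=> p12 e1 s1 C0.
have e0 : 0 <= e by lra.
have [K2 K21 HK2] := @powR_lipschitz1 e 2 e0 (ltac:(lra)).
have b1 : 1 <= (2 : R) `^ e.
  by have := @ler_powR R 2 (ltac:(lra)) 0 e; rewrite powRr0; apply.
have [K1 K10 HK1] := powR_quadratic s1 b1.
exists (s * C + 2 * (K1 * K2 ^+ 2)).
  by rewrite addr_ge0 ?mulr_ge0//; try lra; rewrite exprn_ge0//; lra.
move=> a b d a0 b0 /andP[d0 d1] ad bd abd.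
have dp : d ^+ 2 <= d `^ p.
  have [->|dn0] := eqVneq d 0; first by rewrite expr0n/= powR_ge0.
  rewrite -powR_mulrn//; apply: ger_powR; [lra|].
  by case/andP: p12.
have H z : 0 <= z -> `|z - 1| <= d ->
    (z `^ e) `^ s <= 1 + s * (z `^ e - 1) + K1 * K2 ^+ 2 * d `^ p.
  move=> z0 zd; have z2 : z <= 2 by have := ler_norm (z - 1); lra.
  have ze : 0 <= z `^ e <= 2 `^ e by rewrite powR_ge0 ge0_ler_powR ?nnegrE.
  apply: le_trans (HK1 _ ze) _; rewrite lerD2l -mulrA ler_wpM2l//.
  apply: (@le_trans _ _ (K2 ^+ 2 * d ^+ 2)).
    2: by rewrite ler_wpM2l// exprn_ge0//; lra.
  rewrite -exprMn -(real_normK (num_real _)) lerXn2r ?nnegrE//.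
    by rewrite mulr_ge0//; lra.
  by rewrite (le_trans (HK2 _ _))// ?z0// ler_wpM2l//; lra.
have := H _ a0 ad; have := H _ b0 bd.
move=> h2 h1; apply: le_trans (lerD h1 h2) _; rewrite -subr_ge0.
rewrite [leRHS](_ : _ = s * (2 + C * d `^ p - (a `^ e + b `^ e))); last by ring.
by rewrite mulr_ge0 ?subr_ge0// (le_trans ler01).
Qed.

(* Rescaling by [w]: the two-point inequality passes from the exponent 1 to any exponent [s]. *)
Lemma two_point_powR p s C : 1 < p <= 2 -> 1 <= s -> 0 <= C ->
  exists2 K, 0 <= K & forall u v w d, 0 <= u -> 0 <= v -> 0 <= w -> 0 <= d ->
  u `^ p^-1 <= w `^ p^-1 + d `^ p^-1 ->
  v `^ p^-1 <= w `^ p^-1 + d `^ p^-1 ->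
  w `^ p^-1 <= u `^ p^-1 + d `^ p^-1 ->
  w `^ p^-1 <= v `^ p^-1 + d `^ p^-1 ->
  u + v <= 2 * w + C * d ->
  u `^ s + v `^ s <= 2 * w `^ s + K * (w `^ (s - 1) * d + d `^ s).
Proof.
move=> p12 s1 C0; have p0 : 0 < p by lra.
have s0 : 0 <= s by lra.
have pV : p^-1 * p = 1 by rewrite mulVf// lt0r_neq0.
have pV0 : 0 < p^-1 by rewrite invr_gt0.
have p12' : 1 <= p <= 2 by lra.
have p1 : 1 <= p by lra.
have [K K0 HK] := two_point_lift p12' p1 s1 C0.
pose K' := 2 * (2 `^ p) `^ s.
have K'0 : 0 <= K' by rewrite mulr_ge0 ?powR_ge0.
exists (K + K'); first by rewrite addr_ge0.
move=> u v w d u0 v0 w0 d0 uwd vwd wud wvd uv.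
have rootK z : 0 <= z -> (z `^ p^-1) `^ p = z by move=> z0; rewrite -powRrM pV powRr1.
have W0 : 0 <= w `^ (s - 1) * d by rewrite mulr_ge0 ?powR_ge0.
have [wd|dw] := leP w d.
- clear HK; have H z : 0 <= z -> z `^ p^-1 <= w `^ p^-1 + d `^ p^-1 ->
      z `^ s <= (2 `^ p) `^ s * d `^ s.
    move=> z0 zwd; rewrite -powRM ?powR_ge0// ge0_ler_powR ?nnegrE//.
    - by rewrite mulr_ge0 ?powR_ge0.
    - apply: (@le_trans _ _ ((2 * d `^ p^-1) `^ p)); last first.
        by rewrite powRM ?powR_ge0// rootK.
      rewrite -{1}(rootK z z0).
      rewrite (@ge0_ler_powR _ _ (ltW p0)) ?nnegrE ?powR_ge0 ?mulr_ge0 ?powR_ge0//.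
      rewrite (le_trans zwd)// mulr_natl mulr2n lerD2r.
      by rewrite ge0_ler_powR ?nnegrE// ltW.
  apply: (@le_trans _ _ (K' * d `^ s)).
    by apply: le_trans (lerD (H _ u0 uwd) (H _ v0 vwd)) _; rewrite /K' -mulrA mulr_natl mulr2n.
  have ? := powR_ge0 w s; have ? := powR_ge0 d s.
  have -> : 2 * w `^ s + (K + K') * (w `^ (s - 1) * d + d `^ s) =
    K' * d `^ s + (2 * w `^ s + K * (w `^ (s - 1) * d + d `^ s) +
    K' * (w `^ (s - 1) * d)) by ring.
  rewrite lerDl; apply: addr_ge0; last exact: mulr_ge0.
  apply: addr_ge0; apply: mulr_ge0 => //; exact: addr_ge0.
- have wp : 0 < w by exact: le_lt_trans dw.
  have wn0 : w != 0 by rewrite lt0r_neq0.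
  pose a := (u / w) `^ p^-1; pose b := (v / w) `^ p^-1; pose e := (d / w) `^ p^-1.
  have divw z : 0 <= z -> (z / w) `^ p^-1 = z `^ p^-1 / w `^ p^-1.
    move=> z0; rewrite powRM// ?invr_ge0//.
    by rewrite -powRN -[w^-1]powR_inv1// -powRrM mulN1r.
  have wr0 : 0 < w `^ p^-1 by rewrite powR_gt0.
  have close z : 0 <= z -> z `^ p^-1 <= w `^ p^-1 + d `^ p^-1 ->
      w `^ p^-1 <= z `^ p^-1 + d `^ p^-1 -> `|(z / w) `^ p^-1 - 1| <= e.
    move=> z0 h1 h2; rewrite /e !divw// -(divff (lt0r_neq0 wr0)) -mulrBl normrM.
    rewrite [X in _ * X]gtr0_norm ?invr_gt0// ler_pM2r ?invr_gt0//.
    by rewrite ler_norml lerBlDl h1 andbT lerNl opprB lerBlDl.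
  have e01 : 0 <= e <= 1.
    have e1 : 1 = 1 `^ p^-1 :> R by rewrite powR1.
    rewrite powR_ge0/= [leRHS]e1 (@ge0_ler_powR _ _ (ltW pV0)) ?nnegrE ?divr_ge0//.
    by rewrite ler_pdivrMr// mul1r ltW.
  have := HK a b e (powR_ge0 _ _) (powR_ge0 _ _) e01 (close _ u0 uwd wud)
    (close _ v0 vwd wvd).
  rewrite /a /b /e !rootK ?divr_ge0//.
  have -> : (u / w + v / w <= 2 + C * (d / w)) = (u + v <= 2 * w + C * d).
    rewrite -(ler_pM2r wp); congr (_ <= _); field => //.
  move=> /(_ uv); rewrite -(ler_pM2r (powR_gt0 s wp)) mulrDl -!powRM ?divr_ge0//.
  rewrite !divfK// => /le_trans; apply.
  rewrite mulrDl lerD2l.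
  have -> : K * (d / w) * w `^ s = K * (w `^ (s - 1) * d).
    by rewrite -[w `^ s](@mulr_powRB1 _ w s)//; [field|lra].
  rewrite ler_pM// ?lerDl ?powR_ge0//.
Qed.

(** The optimal weight is [t = b / (a + b)], where [a] and [b] are the p-th roots of [w] and [d]; a
    shift by [eps / 2] keeps them positive, so that [t] stays strictly between 0 and 1. *)
Lemma minkowski_of_convex p u w d : 1 < p -> 0 <= u -> 0 <= w -> 0 <= d ->
  (forall t, 0 < t < 1 -> u <= (1 - t) `^ (1 - p) * w + t `^ (1 - p) * d) ->
  u `^ p^-1 <= w `^ p^-1 + d `^ p^-1.
Proof.
move=> p1 u0 w0 d0 H; apply/ler_addgt0Pr => eps eps0.
have p0 : 0 < p by lra.
have pn0 : p != 0 by rewrite lt0r_neq0.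
pose a := w `^ p^-1 + eps / 2; pose b := d `^ p^-1 + eps / 2.
have ap : 0 < a by rewrite ltr_wpDl ?powR_ge0//; lra.
have bp : 0 < b by rewrite ltr_wpDl ?powR_ge0//; lra.
have rootK z : 0 <= z -> (z `^ p^-1) `^ p = z by move=> z0; rewrite -powRrM mulVf// powRr1.
have -> : w `^ p^-1 + d `^ p^-1 + eps = a + b by rewrite /a /b; field.
have powK z : 0 <= z -> (z `^ p) `^ p^-1 = z by move=> z0; rewrite -powRrM divff// powRr1.
rewrite -[leRHS]powK; last lra.
rewrite ge0_ler_powR ?nnegrE ?powR_ge0 ?invr_ge0//; first lra.
have ab0 : 0 < a + b by lra.
have abn0 : a + b != 0 by rewrite lt0r_neq0.
pose t := b / (a + b).
have t01 : 0 < t < 1 by rewrite divr_gt0//= ltr_pdivrMr// mul1r; lra.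
have L x : 0 <= x -> x <= (x `^ p^-1 + eps / 2) `^ p.
  move=> x0; rewrite -{1}(rootK x x0).
  have e20 : 0 <= eps / 2 by rewrite divr_ge0// ltW.
  apply: (@ge0_ler_powR _ _ (ltW p0)); rewrite ?nnegrE ?powR_ge0 ?lerDl//.
  by rewrite addr_ge0 ?powR_ge0.
have wa : w <= a `^ p := L w w0.
have db : d <= b `^ p := L d d0.
clearbody a b.
apply: le_trans (H t t01) _.
apply: (@le_trans _ _ ((1 - t) `^ (1 - p) * a `^ p + t `^ (1 - p) * b `^ p)).
  by rewrite lerD// ler_wpM2l ?powR_ge0.
have T z : 0 < z -> (z / (a + b)) `^ (1 - p) * z `^ p = z * (a + b) `^ (p - 1).
  move=> z0; have z00 := ltW z0.
  have -> : (z / (a + b)) `^ (1 - p) = z `^ (1 - p) * (a + b) `^ (p - 1).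
    rewrite powRM// ?invr_ge0 ?ltW//; congr (_ * _).
    by rewrite -powR_inv1 ?ltW// -powRrM; congr (_ `^ _); ring.
  rewrite mulrAC -powRD; last by rewrite (lt0r_neq0 z0) implybT.
  by rewrite subrK powRr1.
have -> : 1 - t = a / (a + b) by rewrite /t; field.
rewrite !T// -mulrDl mulr_powRB1//; lra.
Qed.

(** Convexity of the power at [a + b = (1 - t) * (a / (1 - t)) + t * (b / t)]. *)
Lemma convex_powRD p t a b : 1 <= p -> 0 < t < 1 -> 0 <= a -> 0 <= b ->
  (a + b) `^ p <= (1 - t) `^ (1 - p) * a `^ p + t `^ (1 - p) * b `^ p.
Proof.
move=> p1 /andP[t0 t1] a0 b0.
have u0 : 0 < 1 - t by lra.
pose y := a + b; have y0 : 0 <= y by rewrite addr_ge0.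
have T z r : 0 <= z -> 0 < r -> r * y `^ p + p * y `^ (p - 1) * (z - r * y)
    <= r `^ (1 - p) * z `^ p.
  move=> z0 r0; have rn0 : r != 0 by rewrite lt0r_neq0.
  have := powR_tangent p1 (divr_ge0 z0 (ltW r0)) y0.
  rewrite -(ler_pM2l r0) powRM// ?invr_ge0 ?(ltW r0)//.
  have -> : r * (z `^ p * (r^-1) `^ p) = r `^ (1 - p) * z `^ p.
    rewrite -[r^-1]powR_inv1 ?ltW// -powRrM mulN1r mulrCA [LHS]mulrC; congr (_ * _).
    by rewrite powRD ?rn0 ?implybT// powRr1// ltW.
  apply: le_trans; rewrite le_eqVlt; apply/orP; left; apply/eqP; field => //.
have := T _ _ a0 u0; have := T _ _ b0 t0.
rewrite -/y; set A := _ * a `^ p; set B := _ * b `^ p.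
set Y := y `^ p; set Z := p * _ => h1 h2.
have : Y + Z * (a + b - y) <= A + B by lra.
rewrite {1}/y; lra.
Qed.

(** The case [y <= eps * x] is paid by the first term, the other case by the second. *)
Lemma young_eps s eps x y : 1 <= s -> 0 < eps -> 0 <= x -> 0 <= y ->
  x `^ (s - 1) * y <= eps * x `^ s + eps `^ (1 - s) * y `^ s.
Proof.
move=> s1 e0 x0 y0; have s0 : 0 < s by lra.
have [yx|xy] := leP y (eps * x).
  apply: (@le_trans _ _ (eps * x `^ s)); last by rewrite lerDl mulr_ge0 ?powR_ge0.
  by rewrite -[x `^ s]mulr_powRB1// mulrA mulrC ler_wpM2r// powR_ge0.
apply: (@le_trans _ _ (eps `^ (1 - s) * y `^ s)).
  2: by rewrite lerDr mulr_ge0 ?powR_ge0 ?ltW.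
have -> : eps `^ (1 - s) = (eps^-1) `^ (s - 1).
  by rewrite -powR_inv1 ?ltW// -powRrM; congr (_ `^ _); ring.
rewrite -[y `^ s]mulr_powRB1// mulrCA mulrC ler_wpM2l// -powRM ?invr_ge0 ?(ltW e0)//.
have s10 : 0 <= s - 1 by rewrite subr_ge0.
rewrite ge0_ler_powR ?nnegrE ?mulr_ge0 ?invr_ge0 ?(ltW e0)//.
by rewrite mulrC ler_pdivlMr// mulrC ltW.
Qed.

Lemma powRD_le s a b : 0 <= s -> 0 <= a -> 0 <= b ->
  (a + b) `^ s <= 2 `^ s * (a `^ s + b `^ s).
Proof.
move=> s0 a0 b0; wlog ab : a b a0 b0 / a <= b.
  move=> H; have [|/ltW] := leP a b; first exact: H.
  by rewrite addrC [X in _ * X]addrC; exact: H.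
apply: (@le_trans _ _ ((2 * b) `^ s)).
  by rewrite ge0_ler_powR ?nnegrE//; lra.
by rewrite powRM// ler_wpM2l ?powR_ge0// lerDr powR_ge0.
Qed.

(* The pathwise inequality behind Doob's maximal inequality; [S] is the running maximum and [y] the next value. *)
Lemma doob_pathwise q S y : 1 <= q -> 0 <= S -> 0 <= y ->
  S `^ (q - 1) * y + (1 - q^-1) * (Num.max S y) `^ q <=
  (Num.max S y) `^ (q - 1) * y + (1 - q^-1) * S `^ q.
Proof.
move=> q1 S0 y0; have [Sy|yS] := leP S y; last by [].
have q0 : 0 < q by lra.
rewrite [y `^ (q - 1) * y]mulrC mulr_powRB1//.
have := powR_tangent q1 y0 S0; rewrite -(ler_pM2l (_ : 0 < q^-1)) ?invr_gt0//.
have -> : q^-1 * (S `^ q + q * S `^ (q - 1) * (y - S)) =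
   q^-1 * S `^ q + S `^ (q - 1) * y - S * S `^ (q - 1) by field; lra.
rewrite mulr_powRB1//; lra.
Qed.

End PowerInequalities.

(** * Smooth norms *)

Section NormFacts.
Context {R : realType} (B : normedModType R) (N : B -> R).
Hypothesis normN : is_norm N.

Lemma is_normD x y : N (x + y) <= N x + N y. Proof. by case: normN. Qed.
Lemma is_normZ a x : N (a *: x) = `|a| * N x. Proof. by case: normN. Qed.
Lemma is_normN x : N (- x) = N x.
Proof. by rewrite -scaleN1r is_normZ normrN1 mul1r. Qed.
Lemma is_norm0 : N 0 = 0.
Proof. by rewrite -(scale0r (0 : B)) is_normZ normr0 mul0r. Qed.
Lemma is_norm_ge0 x : 0 <= N x.
Proof. have := is_normD x (- x); rewrite subrr is_norm0 is_normN; lra. Qed.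
Lemma is_norm_eq0 x : N x = 0 -> x = 0. Proof. by case: normN => _ _; apply. Qed.
Lemma is_norm_gt0 x : x != 0 -> 0 < N x.
Proof.
move=> x0; rewrite lt_neqAle is_norm_ge0 andbT eq_sym.
by apply: contraNneq x0 => /is_norm_eq0 ->.
Qed.
Lemma is_normB_le x y : N x <= N y + N (x - y).
Proof. by have := is_normD y (x - y); rewrite addrC subrK. Qed.

End NormFacts.

Definition two_point_smooth {R : realType} (B : normedModType R) (N : B -> R) (p C : R) :=
  forall x y, N (x + y) `^ p + N (x - y) `^ p <= 2 * N x `^ p + C * N y `^ p.

(** Homogeneity reduces the claim to unit vectors and [t = N y / N x]. For [t <= 1] one has [t]^ r
    <= t [^ p]: this is how smoothness of order [r] gives every order [p <= r]. *)
Lemma smooth_two_point (R : realType) (B : normedModType R) (p r : R) :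
  1 < p -> p <= r -> r <= 2 -> smooth B r ->
  exists N : B -> R, equivalent_norm N /\ exists2 C, 0 <= C & two_point_smooth N p C.
Proof.
move=> p1 pr r2 [N [eqN supN]]; exists N; split => //.
have [normN _] := eqN.
set E := [set _ | _] in supN.
have [C0 C00 HC0] : exists2 C0 : R, 0 <= C0 & forall (t : R) (x y : B), 0 < t -> N x = 1 -> N y = 1 ->
    N (x + t *: y) + N (x - t *: y) <= 2 + C0 * t `^ r.
  exists (Num.max 0 (fine (ereal_sup E))); first by rewrite le_max lexx.
  move=> t x y t0 x1 y1.
  have : E ((N (x + t *: y) + N (x - t *: y) - 2) / t `^ r)%:E by exists t, x, y.
  move=> /(@ereal_sup_ubound _ E) /=; rewrite /= => h.
  have supfin : ereal_sup E \is a fin_num.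
    by rewrite fin_numElt supN andbT (lt_le_trans _ h)// ltNyr.
  move: h; rewrite -(fineK supfin) lee_fin ler_pdivrMr ?powR_gt0// => h.
  rewrite -lerBlDl (le_trans h)// ler_wpM2r ?powR_ge0//.
  by rewrite le_max lexx orbT.
have p12 : 1 <= p <= 2 by lra.
have [K K0 HK] := @two_point_lift _ p 1 p C0 p12 (lexx _) (ltW p1) C00.
have p0 : 0 <= p by lra.
pose K' : R := 2 * 2 `^ p.
have K'0 : 0 <= K' by rewrite mulr_ge0 ?powR_ge0.
exists (K + K'); first exact: addr_ge0.
move=> x y.
have Nge0 := is_norm_ge0 normN.
(* When [N x <= N y] the triangle inequality suffices, with the constant [K']. *)
have [xy|yx] := leP (N x) (N y).
  have H z : N z <= N x + N y -> N z `^ p <= 2 `^ p * N y `^ p.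
    move=> zxy; rewrite -powRM// ge0_ler_powR ?nnegrE ?mulr_ge0//; lra.
  have := H _ (is_normD normN x y); have := H (x - y).
  rewrite -{1}(is_normN normN y) (is_normD normN) => /(_ isT).
  have ? := powR_ge0 (N x) p; have : 0 <= K * N y `^ p by rewrite mulr_ge0 ?powR_ge0.
  rewrite /K'; lra.
have [y0|y0] := eqVneq y 0.
  have yp : N y `^ p = 0 by rewrite y0 (is_norm0 normN) powR0; lra.
  by rewrite yp mulr0 addr0 y0 addr0 subr0; lra.
have Ny := is_norm_gt0 normN y0.
have Nx : 0 < N x by lra.
have Nxn0 := lt0r_neq0 Nx; have Nyn0 := lt0r_neq0 Ny.
pose t := N y / N x; pose x' := (N x)^-1 *: x; pose y' := (N y)^-1 *: y.
have t0 : 0 < t by rewrite divr_gt0.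
have t1 : t <= 1 by rewrite ler_pdivrMr// mul1r ltW.
have x1 : N x' = 1 by rewrite is_normZ// gtr0_norm ?invr_gt0// mulVf.
have y1 : N y' = 1 by rewrite is_normZ// gtr0_norm ?invr_gt0// mulVf.
have tyE : t *: y' = (N x)^-1 *: y.
  by rewrite /y' scalerA; congr (_ *: _); rewrite /t; field; apply/andP.
have Pe : N (x' + t *: y') = N (x + y) / N x.
  by rewrite tyE -scalerDr is_normZ// gtr0_norm ?invr_gt0// mulrC.
have Me : N (x' - t *: y') = N (x - y) / N x.
  by rewrite tyE -scalerBr is_normZ// gtr0_norm ?invr_gt0// mulrC.
have close z : N z = t -> `|N (x' + z) - 1| <= t.
  move=> zt; rewrite ler_norml -{1 2}x1.
  have := is_normD normN x' z; have := is_normB_le normN x' (x' + z).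
  rewrite opprD addrA subrr sub0r (is_normN normN) zt; lra.
have Nty : N (t *: y') = t by rewrite is_normZ// y1 mulr1 gtr0_norm.
have t01 : 0 <= t <= 1 by rewrite t1 ltW.
have := HK (N (x' + t *: y')) (N (x' - t *: y')) t (Nge0 _) (Nge0 _) t01 (close _ Nty).
have NtyN : N (- (t *: y')) = t by rewrite (is_normN normN).
rewrite !powRr1// => /(_ (close _ NtyN)).
have tpr : t `^ r <= t `^ p by apply: ger_powR => //; lra.
have HH : N (x' + t *: y') + N (x' - t *: y') <= 2 + C0 * t `^ p.
  by apply: le_trans (HC0 _ _ _ t0 x1 y1) _; rewrite lerD2l ler_wpM2l.
move=> /(_ HH); rewrite Pe Me /t -(ler_pM2r (powR_gt0 p Nx)) mulrDl -!powRM ?divr_ge0//.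
rewrite !divfK// => h; apply: le_trans h _.
rewrite mulrDl lerD2l -mulrA -powRM ?divr_ge0// divfK//.
by rewrite ler_wpM2r ?powR_ge0// lerDl.
Qed.

Section SupportingFunctional.
Context {R : realType} (B : normedModType R) (N : B -> R) (p C : R).
Hypothesis normN : is_norm N.
Hypothesis p1 : 1 < p.
Hypothesis C0 : 0 <= C.
Hypothesis smoothN : two_point_smooth N p C.

Let quot (x : B) (t : R) (y : B) := (N (x + t *: y) - N x) / t.

(** Convexity: [x + s *: y] is the combination of [x] and [x + t *: y] with weights [1 - s / t] and
    [s / t]. *)
Let quot_mono x y s t : 0 < s -> s <= t -> quot x s y <= quot x t y.
Proof.
move=> s0 st; have t0 : 0 < t by lra.
have sn0 := lt0r_neq0 s0; have tn0 := lt0r_neq0 t0.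
rewrite /quot ler_pdivrMr// mulrAC ler_pdivlMr//.
have E : t *: (x + s *: y) = (t - s) *: x + s *: (x + t *: y).
  by rewrite !scalerDr !scalerA addrA -scalerDl subrK (mulrC s).
have := congr1 N E; rewrite (is_normZ normN) gtr0_norm// => NE.
have := is_normD normN ((t - s) *: x) (s *: (x + t *: y)); rewrite -NE.
rewrite !(is_normZ normN) (ger0_norm (_ : 0 <= t - s)) ?subr_ge0// (gtr0_norm s0).
lra.
Qed.

(** [x + (t / 2) *: (y + z)] is the midpoint of [x + t *: y] and [x + t *: z]; the halved step is
    immaterial for an infimum over all steps. *)
Let quotD x y z t : 0 < t -> quot x (t / 2) (y + z) <= quot x t y + quot x t z.
Proof.
move=> t0; have t20 : 0 < t / 2 by lra.
rewrite /quot -mulrDl ler_pdivrMr// mulrAC ler_pdivlMr//.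
have E : 2 *: (x + (t / 2) *: (y + z)) = (x + t *: y) + (x + t *: z).
  rewrite scalerDr scalerA (_ : 2 * (t / 2) = t); last by field.
  by rewrite scaler_nat mulr2n scalerDr addrACA.
have := is_normD normN (x + t *: y) (x + t *: z); rewrite -E (is_normZ normN).
rewrite gtr0_norm// => h.
have : N (x + (t / 2) *: (y + z)) - N x <= (N (x + t *: y) - N x + (N (x + t *: z) - N x)) / 2.
  by lra.
rewrite -(ler_pM2r t0) => /le_trans; apply; lra.
Qed.

Let quot_le x y t : 0 < t -> quot x t y <= N y.
Proof.
move=> t0; rewrite /quot ler_pdivrMr//.
have := is_normD normN x (t *: y); rewrite (is_normZ normN) gtr0_norm//; lra.
Qed.

Let quot_ge x y t : 0 < t -> - N y <= quot x t y.
Proof.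
move=> t0; rewrite /quot ler_pdivlMr//.
have := is_normB_le normN x (x + t *: y).
rewrite opprD addrA subrr sub0r (is_normN normN) (is_normZ normN) gtr0_norm//; lra.
Qed.

(* The functional is the directional derivative [y |-> lim_(t -> 0+) (N (x + t y) - N x) / t];
   smoothness makes it odd, hence linear. *)
Lemma supporting_functional x : exists phi : B -> R,
  [/\ forall y z, phi (y + z) = phi y + phi z,
      forall a y, phi (a *: y) = a * phi y,
      forall y, phi y <= N y
    & phi x = N x].
Proof.
have [->|x0] := eqVneq x 0.
  exists (fun=> 0); split=> //; rewrite ?(is_norm0 normN)//.
  - by move=> y z; rewrite addr0.
  - by move=> a y; rewrite mulr0.
  - exact: (is_norm_ge0 normN).
have Nx := is_norm_gt0 normN x0.
pose D y := [set quot x t y | t in [set t | 0 < t]].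
(* The quotients increase with [t], so this infimum is the limit at 0. *)
pose phi y := inf (D y).
have D0 y : D y !=set0 by exists (quot x 1 y), 1 => //=.
have phi_le y t : 0 < t -> phi y <= quot x t y.
  move=> t0; apply: ge_inf; last by exists t.
  by exists (- N y) => _ [s s0 <-]; exact: quot_ge.
have phi_ge y c : (forall t, 0 < t -> c <= quot x t y) -> c <= phi y.
  by move=> h; apply: lb_le_inf => // _ [t t0 <-]; exact: h.
have phi_sub y z : phi (y + z) <= phi y + phi z.
  have H s t : 0 < s -> 0 < t -> phi (y + z) <= quot x s y + quot x t z.
    move=> s0 t0; pose m := Num.min s t.
    have m0 : 0 < m by rewrite lt_min s0.
    have m20 : 0 < m / 2 by lra.
    apply: le_trans (phi_le _ _ m20) _; apply: le_trans (quotD _ _ _ m0) _.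
    by rewrite lerD// quot_mono// /m ge_min lexx ?orbT.
  rewrite -lerBlDr; apply: (phi_ge) => s s0.
  rewrite lerBlDr -lerBlDl; apply: (phi_ge) => t t0.
  by rewrite lerBlDl; exact: H.
have phi0 : phi 0 = 0.
  have q0 t : quot x t 0 = 0 by rewrite /quot scaler0 addr0 subrr mul0r.
  apply/eqP; rewrite eq_le; apply/andP; split; first by rewrite -(q0 1) phi_le.
  by apply: (phi_ge) => t _; rewrite q0.
have phi_odd_le y : phi y + phi (- y) <= 0.
  apply/ler_addgt0Pr => e e0; rewrite add0r.
  (* The two-point inequality at [t *: y], with p-th powers bounded below by their tangent at [N x],
     gives [quot x t y + quot x t (- y) <= c * t]^ (p -
     1)[; the exponent is positive, and]t[is picked so that](c + 1) * t [^ (p - 1) = e]. *)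
  pose c := C * N y `^ p / (p * N x `^ (p - 1)).
  have Nxp : 0 < N x `^ (p - 1) by rewrite powR_gt0.
  have c0 : 0 <= c.
    by apply: divr_ge0; apply: mulr_ge0; rewrite ?powR_ge0// (le_trans ler01)// ltW.
  have c1 : 0 < c + 1 by rewrite ltr_wpDl.
  have p10 : 0 < p - 1 by rewrite subr_gt0.
  have pp : 0 < p by rewrite (lt_trans ltr01).
  pose t := (e / (c + 1)) `^ (p - 1)^-1.
  have ec : 0 < e / (c + 1) by rewrite divr_gt0.
  have t0 : 0 < t by rewrite powR_gt0.
  have tp : t `^ (p - 1) = e / (c + 1).
    by rewrite /t -powRrM mulVf ?lt0r_neq0// powRr1// ltW.
  apply: (@le_trans _ _ (quot x t y + quot x t (- y))); first by rewrite lerD// phi_le.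
  apply: (@le_trans _ _ (c * t `^ (p - 1))); last first.
    by rewrite tp mulrA ler_pdivrMr// mulrC ler_wpM2l ?lerDl// ltW.
  rewrite /quot -mulrDl ler_pdivrMr// -mulrA [t `^ _ * t]mulrC mulr_powRB1// ?(ltW t0)//.
  rewrite scalerN.
  have := smoothN x (t *: y).
  have Nxt z := powR_tangent (ltW p1) (is_norm_ge0 normN z) (is_norm_ge0 normN x).
  have := Nxt (x + t *: y); have := Nxt (x - t *: y).
  rewrite (is_normZ normN) gtr0_norm// powRM ?(is_norm_ge0 normN)//; last exact: ltW.
  have pNx : 0 < p * N x `^ (p - 1) by rewrite mulr_gt0.
  move=> h1 h2 h3.
  rewrite /c mulrAC ler_pdivlMr//; clear -h1 h2 h3; lra.
have phi_opp y : phi (- y) = - phi y.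
  have := phi_sub y (- y); rewrite subrr phi0 => h1; have := phi_odd_le y; lra.
have phi_pos a y : 0 < a -> phi (a *: y) = a * phi y.
  have le b z : 0 < b -> phi (b *: z) <= b * phi z.
    move=> b0; have bn0 := lt0r_neq0 b0.
    rewrite mulrC -ler_pdivrMr//; apply: (phi_ge) => t t0.
    have tn0 := lt0r_neq0 t0.
    rewrite ler_pdivrMr//; have tb : 0 < t / b by rewrite divr_gt0.
    apply: le_trans (phi_le _ _ tb) _; rewrite /quot scalerA divfK// le_eqVlt.
    by apply/orP; left; apply/eqP; field; apply/andP.
  move=> a0; have an0 := lt0r_neq0 a0; apply/eqP; rewrite eq_le le//=.
  have a0' : 0 < a^-1 by rewrite invr_gt0.
  have := le _ (a *: y) a0'; rewrite scalerA mulVf// scale1r.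
  by rewrite mulrC ler_pdivlMr// mulrC.
exists phi; split.
- move=> y z; apply/eqP; rewrite eq_le phi_sub/=.
  by have := phi_sub (y + z) (- z); rewrite addrK phi_opp; lra.
- move=> a y; have [a0|a0|->] := ltgtP a 0.
  + have na0 : 0 < - a by rewrite oppr_gt0.
    by have := phi_pos _ y na0; rewrite scaleNr phi_opp mulNr => /oppr_inj.
  + exact: phi_pos.
  + by rewrite scale0r phi0 mul0r.
- by move=> y; apply: le_trans (phi_le _ _ ltr01) (quot_le _ _ ltr01).
- apply/eqP; rewrite eq_le; apply/andP; split.
    by apply: le_trans (phi_le _ _ ltr01) (quot_le _ _ ltr01).
  apply: (phi_ge) => t t0; rewrite /quot.
  have -> : x + t *: x = (1 + t) *: x by rewrite scalerDl scale1r.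
  rewrite (is_normZ normN) gtr0_norm ?addr_gt0// [(1 + t) * _]mulrDl mul1r addrAC subrr add0r.
  by rewrite mulrAC divff ?lt0r_neq0// mul1r.
Qed.

End SupportingFunctional.

Lemma separable_seq (R : realType) (B : normedModType R) : separable B ->
  exists e : nat -> B, forall x (eps : R), 0 < eps -> exists n, `|x - e n| < eps.
Proof.
move=> [D [/countable_injP[f finj] denseD]].
(* Indices outside the range of [f] get the default 0, a harmless extra point. *)
exists (fun n => xget 0 [set d | D d /\ f d = n]) => x eps eps0.
have [||d [xd Dd]] := denseD (ball x eps); first by exists x; exact: ballxx.
  exact: ball_open.
exists (f d); case: xgetP => [d' _ [Dd' fd']|/(_ d)/=]; last by case.
have -> : d' = d by apply: finj; rewrite ?inE.
by move: xd; rewrite -ball_normE.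
Qed.

Definition norming {R : realType} (B : normedModType R) (N : B -> R) (phi : nat -> B -> R) :=
  [/\ forall n y z, phi n (y + z) = phi n y + phi n z,
      forall n a y, phi n (a *: y) = a * phi n y,
      forall n y, phi n y <= N y
    & forall x (c : R), c < N x -> exists n, c < phi n x].

(** Supporting functionals at the points of a dense sequence: if [N (x - e n)] is below
    [(N x - c) / 2], then [phi n x >= N (e n) - N (x - e n) > c]. Smoothness replaces the
    Hahn-Banach theorem here. *)
Lemma norming_exists (R : realType) (B : normedModType R) (N : B -> R) (p C : R) :
  separable B -> equivalent_norm N -> 1 < p -> 0 <= C -> two_point_smooth N p C ->
  exists phi, norming N phi.
Proof.
move=> /separable_seq[e He] [normN [c0 [c1 [c00 c10 c01]]]] p1 C0 smN.
have H n := supporting_functional normN p1 C0 smN (e n).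
exists (fun n => projT1 (cid (H n))); split=> [n|n|n|x c cx];
  try by case: (projT2 (cid (H n))).
have d0 : 0 < (N x - c) / (2 * c1) by rewrite divr_gt0// ?mulr_gt0//; lra.
have [n xn] := He x _ d0; exists n.
have [phiD phiZ phi_le phie] := projT2 (cid (H n)); set phi := projT1 _ in phiD phiZ phi_le phie *.
have /andP[_ h1] := c01 (x - e n).
have := phiD (e n - x) x; rewrite subrK phie => h2.
have := phi_le (e n - x); rewrite -opprB (is_normN normN) => h3.
have h4 := is_normB_le normN x (e n).
have h5 : N (x - e n) < (N x - c) / 2.
  apply: le_lt_trans h1 _; move: xn; rewrite ltr_pdivlMr ?mulr_gt0// => xn.
  by rewrite ltr_pdivlMr// mulrC mulrA mulrC.
rewrite -opprB in h2; lra.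
Qed.

(** * Measurability and averages over one sample *)

Section NonnegMeasurable.
Context {R : realType} d (T : measurableType d).
Implicit Types (F G : T -> \bar R) (m : {measure set T -> \bar R}).
Local Open Scope ereal_scope.

Definition nnmeas F := measurable_fun [set: T] F /\ forall t, 0 <= F t.

Lemma nnmeas_ge0 F t : nnmeas F -> 0 <= F t. Proof. by case. Qed.

Lemma nnmeas_cst (r : R) : (0 <= r)%R -> nnmeas (cst r%:E).
Proof. by move=> r0; split=> [|t]; [exact: measurable_cst|rewrite lee_fin]. Qed.

Lemma nnmeasD F G : nnmeas F -> nnmeas G -> nnmeas (fun t => F t + G t).
Proof.
by move=> [mF F0] [mG G0]; split=> [|t]; [exact: emeasurable_funD|exact: adde_ge0].
Qed.

Lemma nnmeasM F G : nnmeas F -> nnmeas G -> nnmeas (fun t => F t * G t).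
Proof.
by move=> [mF F0] [mG G0]; split=> [|t]; [exact: emeasurable_funM|exact: mule_ge0].
Qed.

Lemma nnmeasZ (r : R) F : (0 <= r)%R -> nnmeas F -> nnmeas (fun t => r%:E * F t).
Proof. by move=> r0 F0; exact: nnmeasM (nnmeas_cst r0) F0. Qed.

Lemma nnmeas_poweR F (s : R) : nnmeas F -> nnmeas (fun t => F t `^ s).
Proof.
move=> [mF F0]; split=> [|t]; last exact: poweR_ge0.
exact: (measurableT_comp (measurable_poweR _)).
Qed.

Lemma nnmeas_sum (I : Type) (s : seq I) (P : pred I) (F : I -> T -> \bar R) :
  (forall i, P i -> nnmeas (F i)) -> nnmeas (fun t => \sum_(i <- s | P i) F i t).
Proof.
move=> h; elim: s => [|i s IH].
  by under eq_fun do rewrite big_nil; exact: nnmeas_cst.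
have [Pi|nPi] := boolP (P i); last first.
  by under eq_fun do rewrite big_cons (negbTE nPi).
by under eq_fun do rewrite big_cons Pi; exact: nnmeasD (h i Pi) IH.
Qed.

Lemma nnmeas_max F G : nnmeas F -> nnmeas G -> nnmeas (fun t => maxe (F t) (G t)).
Proof.
move=> [mF F0] [mG G0]; split=> [|t]; first exact: measurable_maxe.
by rewrite le_max F0.
Qed.

Lemma nnmeas_indic (A : set T) : measurable A -> nnmeas (fun t => (\1_A t)%:E).
Proof.
move=> mA; split=> [|t]; last by rewrite lee_fin.
by apply/measurable_EFinP; exact: measurable_indic.
Qed.

Lemma nnint_le m F G : nnmeas F -> nnmeas G -> (forall t, F t <= G t) ->
  \int[m]_t F t <= \int[m]_t G t.
Proof. by move=> [mF F0] [mG G0] FG; exact: ge0_le_integral. Qed.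

Lemma nnint_ae_le m F G : nnmeas F -> nnmeas G -> {ae m, forall t, F t <= G t} ->
  \int[m]_t F t <= \int[m]_t G t.
Proof.
move=> [mF F0] [mG G0] FG; apply: ae_ge0_le_integral => //.
by apply: filterS FG => t Ft _.
Qed.

Lemma nnintD m F G : nnmeas F -> nnmeas G ->
  \int[m]_t (F t + G t) = \int[m]_t F t + \int[m]_t G t.
Proof. by move=> [mF F0] [mG G0]; exact: ge0_integralD. Qed.

Lemma nnintZ m (r : R) F : nnmeas F -> (0 <= r)%R ->
  \int[m]_t (r%:E * F t) = r%:E * \int[m]_t F t.
Proof. by move=> [mF F0] r0; exact: ge0_integralZl_EFin. Qed.

Lemma nnint_sum m (I : Type) (s : seq I) (P : pred I) (F : I -> T -> \bar R) :
  (forall i, P i -> nnmeas (F i)) ->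
  \int[m]_t (\sum_(i <- s | P i) F i t) = \sum_(i <- s | P i) \int[m]_t F i t.
Proof.
move=> h; elim: s => [|i s IH].
  by under eq_integral do rewrite big_nil; rewrite integral0 big_nil.
under eq_integral do rewrite big_cons; rewrite big_cons; case: ifPn => // Pi.
by rewrite nnintD ?IH//; [exact: h|exact: nnmeas_sum].
Qed.

Lemma nnint_ge0 m F : nnmeas F -> 0 <= \int[m]_t F t.
Proof. by move=> [_ F0]; exact: integral_ge0. Qed.

Lemma nnint_fin m F : nnmeas F -> \int[m]_t F t < +oo ->
  {ae m, forall t, F t < +oo}.
Proof.
move=> [mF F0] Foo; have iF : m.-integrable setT F.
  by apply/integrableP; split=> //; under eq_integral do rewrite gee0_abs//.
have := integrable_ae measurableT iF; apply: filterS => t /(_ I).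
by rewrite fin_numElt => /andP[].
Qed.

(* The set where the claim fails carries a positive difference with zero integral. *)
Lemma ae_le_of_integral m F G : nnmeas F -> nnmeas G ->
  let A := [set t | G t < F t] in
  \int[m]_(t in A) F t <= \int[m]_(t in A) G t -> \int[m]_t G t < +oo ->
  {ae m, forall t, F t <= G t}.
Proof.
move=> [mF F0] [mG G0] A AFG Goo.
have mA : measurable A.
  by rewrite -[A]setTI; exact: emeasurable_fun_lt.
have GA : \int[m]_(t in A) G t < +oo.
  apply: le_lt_trans Goo; apply: ge0_subset_integral => //.
have FA : \int[m]_(t in A) F t < +oo by exact: le_lt_trans AFG GA.
have iG : m.-integrable A G.
  apply/integrableP; split; first exact: measurable_funTS.
  by under eq_integral do rewrite gee0_abs//.
have iF : m.-integrable A F.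
  apply/integrableP; split; first exact: measurable_funTS.
  by under eq_integral do rewrite gee0_abs//.
have B0 t : A t -> 0 <= F t - G t.
  rewrite /A/= => GF; rewrite sube_ge0 ?ltW//.
  by rewrite fin_numElt (lt_le_trans _ (G0 t)) ?ltNyr//= (lt_le_trans GF) ?leey// orbT.
have I0 : \int[m]_(t in A) (F t - G t) = 0.
  apply/eqP; rewrite eq_le integral_ge0// andbT.
  rewrite (integralB mA iF iG) sube_le0//.
have : ae_eq m A (F \- G) (cst 0).
  apply/(ae_eq_integral_abs m mA); first by apply: emeasurable_funB; exact: measurable_funTS.
  rewrite -[RHS]I0; apply: eq_integral => t; rewrite inE => At.
  by rewrite gee0_abs//; exact: B0.
apply: filterS => t /= h; rewrite leNgt; apply/negP => GF.
by have := h GF; move: GF; rewrite -sube_gt0 => /[swap] ->; rewrite ltxx.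
Qed.

End NonnegMeasurable.

(** * Measurability of vector-valued functions *)

Section StronglyMeasurable.
Context {R : realType} (B : normedModType R) (e : nat -> B).
Hypothesis dense_e : forall x (eps : R), 0 < eps -> exists n, `|x - e n| < eps.
Context d (T : measurableType d).
Implicit Types f g : T -> B.

(** For a separable target this amounts to Borel measurability, in a form that refers to real-valued
    functions only. *)
Definition smeas f := forall b, measurable_fun [set: T] (fun t => `|f t - b|).

(** The second hypothesis says that [u] is the pointwise infimum of the [v n]. *)
Lemma measurable_bigcup_lt (u : T -> R) (v : nat -> T -> R) :
  (forall n, measurable_fun [set: T] (v n)) ->
  (forall t c, (u t < c) <-> exists n, v n t < c) -> measurable_fun [set: T] u.
Proof.
move=> mv uv mT; apply: (measurability _ (RGenInftyO.measurableE R)) => //.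
move=> _ [_ [c ->] <-]; rewrite setTI.
have -> : u @^-1` `]-oo, c[ = \bigcup_n (v n @^-1` `]-oo, c[).
  apply/seteqP; split=> t /=.
    by rewrite in_itv/= => /uv[n vn]; exists n => //=; rewrite in_itv.
  by move=> [n _ /=]; rewrite !in_itv/= => h; apply/uv; exists n.
apply: bigcup_measurable => n _; rewrite -[X in measurable X]setTI.
by apply: mv => //; exact: measurable_itv.
Qed.

(** A Lipschitz [psi] is the infimum over [n] of the cones with apex [e n] and slope [L], whose
    values along [f] are measurable. *)
Lemma smeas_lipschitz f (psi : B -> R) (L : R) : 0 <= L ->
  (forall x y, psi x <= psi y + L * `|x - y|) -> smeas f ->
  measurable_fun [set: T] (psi \o f).
Proof.
move=> L0 lip mf.
apply: (@measurable_bigcup_lt _ (fun n t => psi (e n) + L * `|f t - e n|)) => [n|t c].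
  by apply: measurable_funD => //; apply: measurable_funM => //; exact: mf.
split=> [/= h|[n]]; last exact: le_lt_trans (lip _ _).
(* [L + 1] instead of [L] keeps the denominator positive. *)
have d0 : 0 < (c - psi (f t)) / (2 * (L + 1)) by rewrite divr_gt0 ?mulr_gt0//; lra.
have [n fn] := dense_e (f t) d0; exists n.
have := lip (e n) (f t); rewrite distrC => h1.
have h2 : (L + 1) * `|f t - e n| < (c - psi (f t)) / 2.
  rewrite mulrC -ltr_pdivlMr; last lra.
  by apply: lt_le_trans fn _; rewrite -mulrA invfM.
have := normr_ge0 (f t - e n); lra.
Qed.

(** Going from [f t] to [b + g t] through [b + e n] separates [f] from [g]; density of [e] makes the
    infimum over [n] equal to the distance. *)
Lemma smeasB f g : smeas f -> smeas g -> smeas (fun t => f t - g t).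
Proof.
move=> mf mg b.
apply: (@measurable_bigcup_lt _ (fun n t => `|f t - (b + e n)| + `|g t - e n|)) => [n|t c].
  by apply: measurable_funD; [exact: mf|exact: mg].
have E n : f t - g t - b = (f t - (b + e n)) - (g t - e n).
  by rewrite opprB opprD !addrA subrK [RHS]addrAC.
split=> [h|[n]]; last by apply: le_lt_trans; rewrite (E n); exact: ler_normB.
have d0 : 0 < (c - `|f t - g t - b|) / 2 by lra.
have [n gn] := dense_e (g t) d0; exists n.
have : `|f t - (b + e n)| <= `|f t - g t - b| + `|g t - e n|.
  by rewrite -[f t - (b + e n)](subrK (g t - e n)) -(E n); exact: ler_normD.
lra.
Qed.

Lemma smeas_cst b : smeas (cst b).
Proof. by move=> c; rewrite (_ : (fun _ => _) = cst `|b - c|)//; exact: measurable_cst. Qed.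

Lemma smeasN f : smeas f -> smeas (fun t => - f t).
Proof.
by move=> mf b; under eq_fun do rewrite -opprD normrN -[b in _ + b]opprK; exact: mf.
Qed.

Lemma smeasD f g : smeas f -> smeas g -> smeas (fun t => f t + g t).
Proof.
move=> mf mg; under eq_fun do rewrite -[g _]opprK.
exact: smeasB mf (smeasN mg).
Qed.

Lemma smeas_borel f : measurable_wrt measurable (@borel_sets B) f -> smeas f.
Proof.
move=> mf b mT; apply: (measurability _ (RGenInftyO.measurableE R)) => //.
move=> _ [_ [c ->] <-]; rewrite setTI.
have -> : (fun t => `|f t - b|) @^-1` `]-oo, c[ = f @^-1` [set x | `|x - b| < c].
  by apply/seteqP; split=> t /=; rewrite in_itv.
apply: mf; apply: sub_sigma_algebra.
have -> : [set x | `|x - b| < c] = ball b c.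
  by rewrite -ball_normE; apply/seteqP; split=> x /=; rewrite distrC.
exact: ball_open.
Qed.

End StronglyMeasurable.

Lemma smeas_comp (R : realType) (B : normedModType R) d d' (T : measurableType d)
    (T' : measurableType d') (f : T' -> B) (g : T -> T') :
  measurable_fun [set: T] g -> smeas f -> smeas (f \o g).
Proof. by move=> mg mf b; exact: (measurableT_comp (mf b)). Qed.

(** * Sequences of samples and averages over one coordinate *)

Section SequenceSpace.
Context d (S : measurableType d).

Definition cylinders : set_system (nat -> S) :=
  \bigcup_k preimage_set_system setT (fun s : nat -> S => s k) measurable.

Definition seqspace := g_sigma_algebraType cylinders.

Definition upd (s : seqspace) (k : nat) (y : S) : seqspace :=
  fun j => if j == k then y else s j.

Lemma upd_upd s k y z : upd (upd s k y) k z = upd s k z.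
Proof. by apply/funext => j; rewrite /upd; case: eqP. Qed.

Lemma updC s j k y z : j != k -> upd (upd s j y) k z = upd (upd s k z) j y.
Proof.
move=> jk; apply/funext => i; rewrite /upd; case: eqP => // ->.
by rewrite eq_sym (negbTE jk).
Qed.

Lemma measurable_coord k : measurable_fun [set: seqspace] (fun s => s k).
Proof.
move=> _ A mA; rewrite setTI; apply: sub_sigma_algebra; exists k => //.
by exists A => //; rewrite setTI.
Qed.

Lemma measurable_seqP d' (T : measurableType d') (f : T -> seqspace) :
  measurable_fun [set: T] f <-> forall k, measurable_fun [set: T] (fun t => f t k).
Proof.
split=> [mf k|mf]; first exact: (measurableT_comp (measurable_coord k)).
apply: (@measurability _ _ T seqspace setT f cylinders) => //.
move=> _ [_ [k _ [A mA <-]] <-]; rewrite setTI setTI.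
by rewrite -[X in measurable X]setTI; apply: mf.
Qed.

Lemma measurable_upd k : measurable_fun [set: seqspace * S] (fun z => upd z.1 k z.2).
Proof.
apply/measurable_seqP => j; rewrite /upd; case: eqP => _; first exact: measurable_snd.
exact: (measurableT_comp (measurable_coord j) measurable_fst).
Qed.

Lemma measurable_updr s k : measurable_fun [set: S] (upd s k).
Proof.
apply/measurable_seqP => j; rewrite /upd; case: eqP => _; first exact: measurable_id.
exact: measurable_cst.
Qed.

(** Pointwise insensitivity to coordinate [k], for every sample and not only almost surely. *)
Definition indep (U : Type) (k : nat) (F : seqspace -> U) :=
  forall s y, F (upd s k y) = F s.

Context {R : realType} (mu : probability S R).
Local Open Scope ereal_scope.
Implicit Types (F G W : seqspace -> \bar R).

(** Under a product law, the conditional expectation given all coordinates but [k]; on functions of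
    the coordinates up to [k], the conditional expectation given those before [k]. *)
Definition av k F : seqspace -> \bar R := fun s => \int[mu]_y F (upd s k y).

Lemma nnmeas_updr F s k : nnmeas F -> nnmeas (fun y => F (upd s k y)).
Proof.
by move=> [mF F0]; split=> // ; exact: (measurableT_comp mF (measurable_updr s k)).
Qed.

Lemma nnmeas_av k F : nnmeas F -> nnmeas (av k F).
Proof.
move=> [mF F0]; split=> [|s]; last by apply: integral_ge0 => y _.
apply: (@measurable_fun_fubini_tonelli_F _ _ _ _ R mu (fun z => F (upd z.1 k z.2))) => //.
exact: (measurableT_comp mF (measurable_upd k)).
Qed.

Lemma av_le k F G s : nnmeas F -> nnmeas G -> (forall s, F s <= G s) -> av k F s <= av k G s.
Proof. by move=> mF mG FG; apply: nnint_le => //; exact: nnmeas_updr. Qed.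

Lemma avD k F G s : nnmeas F -> nnmeas G ->
  av k (fun s => F s + G s) s = av k F s + av k G s.
Proof. by move=> mF mG; apply: nnintD; exact: nnmeas_updr. Qed.

Lemma avZ k (r : R) F s : nnmeas F -> (0 <= r)%R ->
  av k (fun s => r%:E * F s) s = r%:E * av k F s.
Proof. by move=> mF r0; apply: nnintZ => //; exact: nnmeas_updr. Qed.

Lemma av_indepM k F W s : nnmeas F -> nnmeas W -> indep k W ->
  av k (fun s => W s * F s) s = W s * av k F s.
Proof.
move=> mF mW iW; rewrite /av; under eq_integral do rewrite iW.
have [mF' F0'] := nnmeas_updr s k mF.
by apply: ge0_integralZl => //; exact: nnmeas_ge0.
Qed.

Lemma av_indep k F s : nnmeas F -> indep k F -> av k F s = F s.
Proof.
move=> mF iF; rewrite /av; under eq_integral do rewrite iF.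
transitivity (F s * mu setT); first exact: integral_cst.
by rewrite probability_setT mule1.
Qed.

Lemma indep_av_same k F : indep k (av k F).
Proof. by move=> s y; rewrite /av; under eq_integral do rewrite upd_upd. Qed.

Lemma indep_av j k F : indep k F -> indep k (av j F).
Proof.
move=> iF; have [->|jk] := eqVneq j k; first exact: indep_av_same.
by move=> s y; rewrite /av; under eq_integral do rewrite updC 1?eq_sym// iF.
Qed.

Lemma indep_poweR k F (p : R) : indep k F -> indep k (fun s => F s `^ p).
Proof. by move=> iF s y; rewrite iF. Qed.

(** Redrawing one coordinate from [mu] preserves [Q]: all that the martingale arguments need to know
    about the law. Coordinate 0 is left out because the sequence of samples starts at 1. *)
Definition resampling (Q : probability seqspace R) := forall k F, (1 <= k)%N ->
  nnmeas F -> \int[Q]_s F s = \int[Q]_s av k F s.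

Section Resampling.
Context (Q : probability seqspace R) (resQ : resampling Q).

(** Averaging acts as an orthogonal projection: both sides equal the integral of
    [av k W * av k F]. *)
Lemma av_adjoint k F W : (1 <= k)%N -> nnmeas F -> nnmeas W ->
  \int[Q]_s (W s * av k F s) = \int[Q]_s (av k W s * F s).
Proof.
move=> k1 mF mW; have mA G : nnmeas G -> nnmeas (av k G) := @nnmeas_av k G.
rewrite (resQ k1 (nnmeasM mW (mA _ mF))) [RHS](resQ k1 (nnmeasM (mA _ mW) mF)).
apply: eq_integral => s _.
rewrite (_ : W \* av k F = fun s => av k F s * W s); last first.
  by apply/funext => ?; rewrite muleC.
rewrite (av_indepM s mW (mA _ mF) (@indep_av_same k F)).
by rewrite (av_indepM s mF (mA _ mW) (@indep_av_same k W)) muleC.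
Qed.

End Resampling.
End SequenceSpace.

(** * Scalar inequalities with infinite values *)

Section ExtendedPowerInequalities.
Context {R : realType}.
Implicit Types (x y u v w d : \bar R).
Local Open Scope ereal_scope.

Lemma eyoung_eps (s eps : R) x y : (1 <= s)%R -> (0 < eps)%R -> 0 <= x -> 0 <= y ->
  x `^ (s - 1) * y <= eps%:E * x `^ s + (eps `^ (1 - s))%:E * y `^ s.
Proof.
move=> s1 e0; have sn0 : s != 0%R by rewrite gt_eqF//; lra.
have es0 : (0 < eps `^ (1 - s))%R by rewrite powR_gt0.
have A0 z : 0 <= eps%:E * z `^ s by rewrite mule_ge0 ?poweR_ge0// lee_fin ltW.
have B0 z : 0 <= (eps `^ (1 - s))%:E * z `^ s by rewrite mule_ge0 ?poweR_ge0// lee_fin ltW.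
case: y => [y| |] x0 // y0; last first.
  rewrite (poweRyr sn0) [X in _ + X]gt0_muley ?lte_fin// addey ?leey//.
  by rewrite -ltNye (lt_le_trans _ (A0 _)) ?ltNyr.
case: x x0 => [x| |] // x0; last first.
  rewrite [X in X + _](_ : _ = +oo); last by rewrite (poweRyr sn0) gt0_muley ?lte_fin.
  by rewrite addye ?leey// -ltNye (lt_le_trans _ (B0 _)) ?ltNyr.
rewrite !poweR_EFin -!EFinM -EFinD lee_fin; exact: young_eps.
Qed.

Lemma eyoung (s : R) x y : (1 <= s)%R -> 0 <= x -> 0 <= y ->
  s%:E * (x `^ (s - 1) * y) <= y `^ s + (s - 1)%:E * x `^ s.
Proof.
move=> s1; have sn0 : s != 0%R by rewrite gt_eqF//; lra.
have s10 : (0 <= s - 1)%R by lra.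
have A0 z : 0 <= (s - 1)%:E * z `^ s by rewrite mule_ge0 ?poweR_ge0.
case: y => [y| |] x0 // y0; last first.
  rewrite (poweRyr sn0) addye ?leey//.
  by rewrite -ltNye (lt_le_trans _ (A0 _)) ?ltNyr.
case: x x0 => [x| |] // x0; last first.
  have [->|sn1] := eqVneq s 1%R.
    by rewrite subrr poweRe0 !mul1e mul0e adde0 poweRe1.
  have s10' : (0 < s - 1)%R by rewrite subr_gt0 lt_neqAle eq_sym sn1.
  rewrite [X in _ + X](_ : _ = +oo); last by rewrite (poweRyr sn0) gt0_muley ?lte_fin.
  by rewrite addey ?leey// poweR_EFin.
rewrite !poweR_EFin -!EFinM -EFinD lee_fin.
have := powR_tangent s1 y0 x0.
by rewrite -[(x `^ s)%R](mulr_powRB1 x0 (lt_le_trans ltr01 s1)); lra.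
Qed.

Lemma poweR_mulB1 (s : R) x : (1 <= s)%R -> 0 <= x -> x `^ (s - 1) * x = x `^ s.
Proof.
move=> s1; case: x => [x| |] // x0.
  rewrite !poweR_EFin -EFinM mulrC mulr_powRB1//; lra.
have sn0 : s != 0%R by rewrite gt_eqF//; lra.
rewrite (poweRyr sn0); have [->|sn1] := eqVneq s 1%R.
  by rewrite subrr poweRe0 mul1e.
by rewrite poweRyr ?subr_eq0// mulyy.
Qed.

Lemma edoob_pathwise (q : R) x y : (1 < q)%R -> 0 <= x -> 0 <= y ->
  x `^ (q - 1) * y + (1 - q^-1)%:E * (maxe x y) `^ q <=
  (maxe x y) `^ (q - 1) * y + (1 - q^-1)%:E * x `^ q.
Proof.
move=> q1; have qn0 : q != 0%R by rewrite gt_eqF//; lra.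
have q10 : (0 < 1 - q^-1)%R by rewrite subr_gt0 invf_lt1//; lra.
have q1n : (q - 1 != 0)%R by rewrite gt_eqF//; lra.
have A0 z : 0 <= (1 - q^-1)%:E * z `^ q by rewrite mule_ge0 ?poweR_ge0// lee_fin ltW.
case: y => [y| |] x0 // y0; last first.
  rewrite (_ : maxe x +oo = +oo); last by rewrite maxey.
  rewrite (poweRyr q1n) mulyy addye ?leey//.
  by rewrite -ltNye (lt_le_trans _ (A0 _)) ?ltNyr.
case: x x0 => [x| |] // x0.
rewrite -EFin_max !poweR_EFin -!EFinM -!EFinD lee_fin; exact: doob_pathwise (ltW q1) x0 y0.
Qed.

Lemma poweRD_le (s : R) x y : (0 < s)%R -> 0 <= x -> 0 <= y ->
  (x + y) `^ s <= (2 `^ s)%:E * (x `^ s + y `^ s).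
Proof.
move=> s0; have sn0 : s != 0%R by rewrite gt_eqF.
have p2 : (0 < 2 `^ s :> R)%R by rewrite powR_gt0.
case: x => [x| |] // x0; case: y => [y| |] // y0.
- by rewrite -EFinD !poweR_EFin -EFinD -EFinM lee_fin powRD_le// ltW.
- by rewrite (poweRyr sn0) addey ?poweR_EFin// gt0_muley ?leey.
- by rewrite (poweRyr sn0) addye ?poweR_EFin// gt0_muley ?leey.
- by rewrite (poweRyr sn0) addye// gt0_muley ?leey.
Qed.

(** The absorption fails for an infinite [x], hence the a priori finite moments in the martingale
    inequalities. *)
Lemma absorb_half x y : 0 <= x -> x < +oo -> 0 <= y -> x <= (2^-1)%:E * x + y -> x <= 2%:E * y.
Proof.
case: x => [x| |] // x0 _; case: y => [y| |] // y0; last by rewrite gt0_muley ?leey.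
rewrite -!EFinM -EFinD !lee_fin; lra.
Qed.

(** The conclusion of [two_point_powR], named so that one [K] depending only on [p], [s] and [C]
    serves all the spaces met in the induction. *)
Definition two_point_const (p s C K : R) := forall u v w d : R, (0 <= u)%R -> (0 <= v)%R ->
  (0 <= w)%R -> (0 <= d)%R ->
  (u `^ p^-1 <= w `^ p^-1 + d `^ p^-1)%R ->
  (v `^ p^-1 <= w `^ p^-1 + d `^ p^-1)%R ->
  (w `^ p^-1 <= u `^ p^-1 + d `^ p^-1)%R ->
  (w `^ p^-1 <= v `^ p^-1 + d `^ p^-1)%R ->
  (u + v <= 2 * w + C * d)%R ->
  (u `^ s + v `^ s <= 2 * w `^ s + K * (w `^ (s - 1) * d + d `^ s))%R.

(** The triangle inequality for p-th roots, by [minkowski_of_convex], written as a family of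
    inequalities linear in [u], [w], [d], so that it passes to sums and integrals. *)
Definition convex_bound (p : R) u w d := forall t : R, (0 < t < 1)%R ->
  u <= ((1 - t) `^ (1 - p))%:E * w + (t `^ (1 - p))%:E * d.

Lemma etwo_point (p s C K : R) u v w d : (1 < p)%R -> (1 <= s)%R -> (0 < K)%R ->
  two_point_const p s C K -> 0 <= u -> 0 <= v -> 0 <= w -> 0 <= d ->
  convex_bound p u w d -> convex_bound p v w d ->
  convex_bound p w u d -> convex_bound p w v d ->
  u + v <= 2%:E * w + C%:E * d ->
  u `^ s + v `^ s <= 2%:E * w `^ s + K%:E * (w `^ (s - 1) * d + d `^ s).
Proof.
move=> p1 s1 K0 HK u0 v0 w0 d0 uwd vwd wud wvd uv.
have sn0 : s != 0%R by rewrite gt_eqF//; lra.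
have W0 : 0 <= w `^ (s - 1) * d by rewrite mule_ge0 ?poweR_ge0.
have [d_oo|d_fin] := eqVneq d +oo.
  rewrite [X in K%:E * X](_ : _ = +oo); last first.
    by subst d; rewrite (poweRyr sn0) addey// -ltNye (lt_le_trans _ W0) ?ltNyr.
  rewrite gt0_muley ?lte_fin// addey ?leey//.
  by rewrite -ltNye (lt_le_trans (ltNyr 0))// mule_ge0 ?poweR_ge0// lee_fin.
have [w_oo|w_fin] := eqVneq w +oo.
  rewrite [X in _ <= X + _](_ : _ = +oo); last by rewrite w_oo (poweRyr sn0) gt0_muley ?lte_fin.
  rewrite addye ?leey// -ltNye (lt_le_trans (ltNyr 0))// mule_ge0 ?adde_ge0 ?poweR_ge0//.
  by rewrite lee_fin ltW.
have half01 : (0 < (2^-1 : R) < 1)%R by lra.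
(* Here [w] and [d] are finite; the convexity bound with weight 1/2 then makes [u] and [v] finite,
   and the real inequality applies. *)
have fin z : 0 <= z -> convex_bound p z w d -> z < +oo.
  move=> z0 /(_ _ half01)/le_lt_trans; apply.
  by rewrite lte_add_pinfty// lte_mul_pinfty// ?lee_fin ?powR_ge0// ltey.
have uoo := fin _ u0 uwd; have voo := fin _ v0 vwd.
move: w0 d0 u0 v0 uwd vwd wud wvd uv d_fin w_fin uoo voo {fin W0}.
case: w => [w| |] //; case: d => [d| |] //; case: u => [u| |] //; case: v => [v| |] //.
rewrite !lee_fin => w0 d0 u0 v0 uwd vwd wud wvd uv _ _ _ _.
have M (a b c : R) : (0 <= a)%R -> (0 <= b)%R -> (0 <= c)%R -> convex_bound p a%:E b%:E c%:E ->
    (a `^ p^-1 <= b `^ p^-1 + c `^ p^-1)%R.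
  by move=> a0 b0 c0 h; apply: minkowski_of_convex => // t /h.
by apply: HK => //; exact: M.
Qed.

End ExtendedPowerInequalities.

Definition doobK {R : realType} (q : R) : R :=
  2 * ((1 - q^-1)^-1 * ((1 - q^-1) / 2) `^ (1 - q)).

Section Doob.
Context {R : realType} d (S : measurableType d) (mu : probability S R)
  (Q : probability (seqspace S) R).
Local Open Scope ereal_scope.
Implicit Types (F W : seqspace S -> \bar R) (Fn : nat -> seqspace S -> \bar R).

Fixpoint run_max (F : nat -> seqspace S -> \bar R) (n : nat) : seqspace S -> \bar R :=
  if n is n'.+1 then fun s => maxe (run_max F n' s) (F n s) else F 0%N.

Lemma le_run_max Fn n k s : (k <= n)%N -> Fn k s <= run_max Fn n s.
Proof.
elim: n => [|n IH]; first by rewrite leqn0 => /eqP ->.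
rewrite leq_eqVlt => /predU1P[->|]; first by rewrite /= le_max lexx orbT.
by rewrite ltnS => /IH h /=; rewrite le_max h.
Qed.

Lemma nnmeas_run_max Fn n : (forall k, nnmeas (Fn k)) -> nnmeas (run_max Fn n).
Proof. by move=> h; elim: n => [|n IH] //=; exact: nnmeas_max. Qed.

Lemma indep_run_max Fn n k : (forall j, (j <= n)%N -> indep k (Fn j)) -> indep k (run_max Fn n).
Proof.
elim: n => [|n IH] h s y /=; first exact: h.
rewrite h// IH// => j jn; exact/h/leqW.
Qed.

Lemma run_max_fin (q : R) Fn n : (0 < q)%R -> (forall k, nnmeas (Fn k)) ->
  (forall k, (k <= n)%N -> \int[Q]_s Fn k s `^ q < +oo) ->
  \int[Q]_s run_max Fn n s `^ q < +oo.
Proof.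
move=> q0 mF; elim: n => [|n IH] h; first exact: h.
have mx := nnmeas_run_max n mF.
apply: (@le_lt_trans _ _ (\int[Q]_s (run_max Fn n s `^ q + Fn n.+1 s `^ q))).
  apply: nnint_le => [||s]; [exact/nnmeas_poweR/(nnmeas_run_max n.+1)| |].
    by apply: nnmeasD; exact: nnmeas_poweR.
  rewrite /=; have [_|_] := leP (run_max Fn n s) (Fn n.+1 s).
    - by apply: leeDr; exact: poweR_ge0.
    - by apply: leeDl; exact: poweR_ge0.
rewrite nnintD; try exact: nnmeas_poweR.
apply: lte_add_pinfty.
- by apply: IH => k kn; apply: h; exact: leqW.
- exact: h.
Qed.

(** The submartingale property is expressed by weights insensitive to the next coordinate. With [M]
    the running maximum, the pathwise inequality is telescoped into
    [c * E M_k^q <= E M_k^(q-1) F_k], the weight [M_k^(q-1)] being of that kind. *)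
Theorem doob_maximal (q : R) Fn n : (1 < q)%R -> (forall k, nnmeas (Fn k)) ->
  (forall k j, (k < j <= n)%N -> indep j (Fn k)) ->
  (forall k W, (k < n)%N -> nnmeas W -> indep k.+1 W ->
    \int[Q]_s (W s * Fn k s) <= \int[Q]_s (W s * Fn k.+1 s)) ->
  (forall k, (k <= n)%N -> \int[Q]_s Fn k s `^ q < +oo) ->
  \int[Q]_s run_max Fn n s `^ q <= (doobK q)%:E * \int[Q]_s Fn n s `^ q.
Proof.
move=> q1 mF iF sub Ffin.
have q0 : (0 < q)%R by lra.
pose c : R := (1 - q^-1)%R.
have c0 : (0 < c)%R by rewrite subr_gt0 invf_lt1.
have c1 : (c <= 1)%R by rewrite gerBl invr_ge0 ltW.
have mM k := nnmeas_run_max k mF.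
have mMp k (e : R) := nnmeas_poweR e (mM k).
have mFp k (e : R) := nnmeas_poweR e (mF k).
have Mfin k : (k <= n)%N -> \int[Q]_s run_max Fn k s `^ q < +oo.
  move=> kn; apply: run_max_fin => // j jk; apply: Ffin; exact: leq_trans jk kn.
have main k : (k <= n)%N ->
    c%:E * \int[Q]_s run_max Fn k s `^ q <= \int[Q]_s (run_max Fn k s `^ (q - 1) * Fn k s).
  elim: k => [_|k IH kn].
    rewrite -nnintZ//; last exact: ltW.
    apply: nnint_le => [||s]; [exact/nnmeasZ/mFp/ltW|exact: nnmeasM|].
    rewrite poweR_mulB1 ?(ltW q1) ?(nnmeas_ge0 s (mF 0%N))//.
    by rewrite -[leRHS]mul1e lee_wpmul2r ?poweR_ge0 ?lee_fin.
  pose X := \int[Q]_s (run_max Fn k s `^ (q - 1) * Fn k.+1 s).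
  have IH' : c%:E * \int[Q]_s run_max Fn k s `^ q <= X.
    apply: le_trans (IH (ltnW kn)) _; apply: sub => //.
    by apply: indep_poweR; apply: indep_run_max => j jk; apply: iF; rewrite ltnS jk.
  (* [X] is finite by Young's inequality, so it can be cancelled from both sides of [P]. *)
  have Xfin : X \is a fin_num.
    rewrite ge0_fin_numE; last by apply: nnint_ge0; exact: nnmeasM.
    apply: (@le_lt_trans _ _ (\int[Q]_s (1%:E * run_max Fn k s `^ q + ((1 : R) `^ (1 - q))%:E * Fn k.+1 s `^ q))).
      apply: nnint_le => [||s]; first exact: nnmeasM.
        by apply: nnmeasD; apply: nnmeasZ => //; exact: powR_ge0.
      apply: eyoung_eps; rewrite ?(ltW q1)//; [exact: nnmeas_ge0 (mM k)|exact: nnmeas_ge0 (mF _)].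
    rewrite powR1; under eq_integral do rewrite !mul1e.
    by rewrite nnintD// lte_add_pinfty ?Mfin ?Ffin// ltnW.
  have P : X + c%:E * \int[Q]_s run_max Fn k.+1 s `^ q <=
      \int[Q]_s (run_max Fn k.+1 s `^ (q - 1) * Fn k.+1 s) + X.
    apply: (@le_trans _ _ (\int[Q]_s (run_max Fn k.+1 s `^ (q - 1) * Fn k.+1 s)
        + c%:E * \int[Q]_s run_max Fn k s `^ q)); last exact: leeD2l.
    have c0' := ltW c0.
    rewrite /X -!nnintZ// -!nnintD; try solve [exact: nnmeasM|exact: nnmeasZ].
    apply: nnint_le => [||s]; try by apply: nnmeasD; solve [exact: nnmeasM|exact: nnmeasZ].
    by apply: edoob_pathwise => //; [exact: nnmeas_ge0 (mM k)|exact: nnmeas_ge0 (mF _)].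
  by move: P; rewrite addeC leeD2rE.
have c20 : (0 < c / 2)%R by rewrite divr_gt0.
have := main n (leqnn n); set A := \int[Q]_s _ => h.
have A0 : 0 <= A by exact: nnint_ge0.
set Z := \int[Q]_s Fn n s `^ q.
have Z0 : 0 <= Z by exact: nnint_ge0.
have h2 : c%:E * A <= (c / 2)%:E * A + ((c / 2) `^ (1 - q))%:E * Z.
  apply: le_trans h _; rewrite /A /Z -!nnintZ ?powR_ge0 ?(ltW c20)//.
  rewrite -nnintD; try by apply: nnmeasZ; rewrite ?powR_ge0 ?(ltW c20).
  apply: nnint_le => [||s]; first exact: nnmeasM.
    by apply: nnmeasD; apply: nnmeasZ; rewrite ?powR_ge0 ?(ltW c20).
  apply: eyoung_eps; rewrite ?(ltW q1)//; [exact: nnmeas_ge0 (mM n)|exact: nnmeas_ge0 (mF _)].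
have Aoo : A < +oo by exact: Mfin.
clearbody A Z.
rewrite /doobK -/c EFinM -muleA; apply: absorb_half => //.
  by rewrite mule_ge0// lee_fin mulr_ge0 ?powR_ge0// invr_ge0 ltW.
have cn0 := lt0r_neq0 c0.
have -> : (2^-1)%:E * A + (c^-1 * (c / 2) `^ (1 - q))%:E * Z =
   (c^-1)%:E * ((c / 2)%:E * A + ((c / 2) `^ (1 - q))%:E * Z).
  have cA : 0 <= (c / 2)%:E * A by rewrite mule_ge0// lee_fin ltW.
  have cZ : 0 <= ((c / 2) `^ (1 - q))%:E * Z by rewrite mule_ge0// lee_fin powR_ge0.
  rewrite ge0_muleDr//.
  by rewrite !muleA -!EFinM; congr (_%:E * _ + _); field.
apply: (@le_trans _ _ ((c^-1)%:E * (c%:E * A))).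
  by rewrite muleA -EFinM mulVf// mul1e.
by apply: lee_wpmul2l h2; rewrite lee_fin invr_ge0 ltW.
Qed.

End Doob.

(** * Rosenthal's inequality *)

(** The weight [eps = (2 * K * doobK s)^-1] in Young's inequality makes [K * eps * doobK s] equal to
    1/2, so that half of the left-hand side is absorbed. *)
Definition rosK {R : realType} (s K : R) : R :=
  2 * K * (1 + ((2 * K * doobK s)^-1) `^ (1 - s)).

Section SmoothSpaces.
Context {R : realType} d (S : measurableType d) (mu : probability S R)
  (Q : probability (seqspace S) R).
Local Open Scope ereal_scope.
Implicit Types W : seqspace S -> \bar R.

(* An abstract space of random vectors: [Phi v s] stands for the [p]-th power of the norm of [v] at
   the sample point [s], [ind k v] says that [v] does not depend on the coordinate [k], and [cen k v]
   that its mean over that coordinate is zero. *)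
Record lp_space (p C : R) := LpSpace {
  lp_sort :> zmodType;
  Phi : lp_sort -> seqspace S -> \bar R;
  adm : lp_sort -> Prop;
  ind : nat -> lp_sort -> Prop;
  cen : nat -> lp_sort -> Prop;
  adm0 : adm 0%R;
  admB : forall x y, adm x -> adm y -> adm (x - y)%R;
  ind0 : forall k, ind k 0%R;
  indB : forall k x y, ind k x -> ind k y -> ind k (x - y)%R;
  cen0 : forall k, cen k 0%R;
  cenB : forall k x y, cen k x -> cen k y -> cen k (x - y)%R;
  nnmeas_Phi : forall x, adm x -> nnmeas (Phi x);
  Phi0 : forall s, Phi 0%R s = 0;
  PhiN : forall x s, Phi (- x)%R s = Phi x s;
  Phi_two_point : forall x y s, adm x -> adm y ->
    Phi (x + y)%R s + Phi (x - y)%R s <= 2%:E * Phi x s + C%:E * Phi y s;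
  Phi_convex : forall x y s, adm x -> adm y -> convex_bound p (Phi (x + y)%R s) (Phi x s) (Phi y s);
  indep_Phi : forall k x, ind k x -> indep k (Phi x);
  Phi_jensen : forall k x D W, (1 <= k)%N -> adm x -> adm D -> ind k x -> cen k D ->
    nnmeas W -> indep k W ->
    \int[Q]_s (W s * Phi x s) <= \int[Q]_s (W s * Phi (x + D)%R s) }.

Section LpTheory.
Context (p C : R) (E : lp_space p C).
Implicit Types x y D : E.

Lemma subr_closed_sum (P : E -> Prop) (I : eqType) (r : seq I) (q : pred I) (v : I -> E) :
  P 0%R -> (forall x y, P x -> P y -> P (x - y)%R) ->
  (forall i, i \in r -> q i -> P (v i)) -> P (\sum_(i <- r | q i) v i)%R.
Proof.
move=> P0 PB; elim: r => [|i r IH] h; first by rewrite big_nil.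
have Pr : P (\sum_(j <- r | q j) v j)%R.
  by apply: IH => j jr; apply: h; rewrite inE jr orbT.
rewrite big_cons; case: ifPn => // qi.
rewrite -[X in (_ + X)%R]opprK; apply: (PB); first by apply: h => //; rewrite inE eqxx.
by rewrite -[X in P X]add0r; exact: PB.
Qed.

Lemma admD x y : adm x -> adm y -> adm (x + y)%R.
Proof.
move=> ax ay; rewrite -[y]opprK; apply: admB => //.
by rewrite -[X in adm X]add0r; apply: admB => //; exact: adm0.
Qed.

Definition fin (s : R) x := \int[Q]_t Phi x t `^ s < +oo.

Lemma finD s x y : (0 < s)%R -> adm x -> adm y -> fin s x -> fin s y -> fin s (x + y)%R.
Proof.
move=> s0 ax ay fx fy; rewrite /fin.
pose a : R := ((2^-1) `^ (1 - p))%R.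
have a0 : (0 <= a)%R by exact: powR_ge0.
pose b : R := (2 `^ s * a `^ s)%R.
have b0 : (0 <= b)%R by rewrite mulr_ge0 ?powR_ge0.
have mx := nnmeas_poweR s (nnmeas_Phi ax).
have my := nnmeas_poweR s (nnmeas_Phi ay).
apply: (@le_lt_trans _ _ (\int[Q]_t (b%:E * Phi x t `^ s + b%:E * Phi y t `^ s))).
  apply: nnint_le => [||t]; [exact/nnmeas_poweR/nnmeas_Phi/admD| |].
    by apply: nnmeasD; exact: nnmeasZ.
  have X0 := nnmeas_ge0 t (nnmeas_Phi ax); have Y0 := nnmeas_ge0 t (nnmeas_Phi ay).
  have half : (0 < (2^-1 : R) < 1)%R by lra.
  have := @Phi_convex p C E x y t ax ay 2^-1%R half.
  have -> : (1 - 2^-1 = 2^-1 :> R)%R by lra.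
  rewrite -/a => h.
  have aX : 0 <= a%:E * Phi x t by rewrite mule_ge0.
  have aY : 0 <= a%:E * Phi y t by rewrite mule_ge0.
  apply: (@le_trans _ _ ((a%:E * Phi x t + a%:E * Phi y t) `^ s)).
    apply: gt0_ler_poweR; rewrite ?(ltW s0)// ?in_itv/= ?leey ?andbT ?adde_ge0//.
    exact: nnmeas_ge0 (nnmeas_Phi (admD ax ay)).
  apply: le_trans (poweRD_le s0 aX aY) _.
  rewrite !poweRM ?lee_fin// ge0_muleDr ?mule_ge0 ?poweR_ge0//.
  by rewrite !muleA poweR_EFin -EFinM.
rewrite nnintD; try exact: nnmeasZ.
by rewrite !nnintZ//; apply: lte_add_pinfty; apply: lte_mul_pinfty; rewrite ?lee_fin.
Qed.

Lemma fin0 s : (0 < s)%R -> fin s (0%R : E).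
Proof.
move=> s0; rewrite /fin; under eq_integral do rewrite Phi0 poweR0r ?gt_eqF//.
by rewrite integral0 ltry.
Qed.

Lemma Phi_two_point_powR s K x y t : (1 < p)%R -> (1 <= s)%R -> (0 < K)%R ->
  two_point_const p s C K -> adm x -> adm y ->
  Phi (x + y)%R t `^ s + Phi (x - y)%R t `^ s <=
  2%:E * Phi x t `^ s + K%:E * (Phi x t `^ (s - 1) * Phi y t + Phi y t `^ s).
Proof.
move=> p1 s1 K0 HK ax ay.
have P0 z : adm z -> 0 <= Phi z t by move=> /nnmeas_Phi/nnmeas_ge0.
have cB (z w : E) : adm z -> adm w -> convex_bound p (Phi (z - w)%R t) (Phi z t) (Phi w t).
  move=> az aw; rewrite -[X in convex_bound _ _ _ X](PhiN w); apply: Phi_convex => //.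
  by rewrite -[X in adm X]add0r; apply: admB => //; exact: adm0.
apply: (etwo_point p1 s1 K0 HK) => //; try exact: P0.
- by apply/P0/admD.
- by apply/P0/admB.
- exact: Phi_convex.
- exact: cB.
- by have := cB (x + y)%R y (admD ax ay) ay; rewrite addrK.
- by have := @Phi_convex p C E (x - y)%R y t (admB ax ay) ay; rewrite subrK.
- exact: Phi_two_point.
Qed.

Lemma Phi_jensen_poweR s k x D : (1 <= s)%R -> (1 <= k)%N -> adm x -> adm D -> ind k x -> cen k D ->
  fin s x -> \int[Q]_t Phi x t `^ s <= \int[Q]_t Phi (x + D)%R t `^ s.
Proof.
move=> s1 k1 ax aD ix cD fx.
have mx := nnmeas_Phi ax; have mxD := nnmeas_Phi (admD ax aD).
have mW := nnmeas_poweR (s - 1) mx.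
have := Phi_jensen k1 ax aD ix cD mW (indep_poweR (s - 1) (indep_Phi ix)).
under eq_integral do rewrite poweR_mulB1 ?nnmeas_ge0//.
set A := \int[Q]_t Phi x t `^ s; set U := \int[Q]_t Phi (x + D)%R t `^ s.
set Z := \int[Q]_t (_ * _).
move=> AZ; have A0 : 0 <= A by apply: nnint_ge0; exact: nnmeas_poweR.
have s0 : (0 <= s)%R by lra.
have s10 : (0 <= s - 1)%R by lra.
have : s%:E * Z <= U + (s - 1)%:E * A.
  rewrite /Z /U /A -!nnintZ//; try solve [exact: nnmeasM|exact: nnmeas_poweR].
  rewrite -nnintD; [|exact: nnmeas_poweR|exact/nnmeasZ/nnmeas_poweR].
  apply: nnint_le => [||t]; first exact/nnmeasZ/nnmeasM.
    by apply: nnmeasD; [exact: nnmeas_poweR|exact/nnmeasZ/nnmeas_poweR].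
  by apply: eyoung => //; exact: nnmeas_ge0.
have sAZ : s%:E * A <= s%:E * Z by rewrite lee_wpmul2l.
move=> /(le_trans sAZ); move: A0 fx; rewrite /fin -/A; clearbody A.
case: A {AZ sAZ} => [A| |]// A0 _; clearbody U; case: U => [U| |]//.
  by rewrite -!EFinM -EFinD !lee_fin; lra.
by move=> _; exact: leey.
Qed.

Variables (n : nat) (D : nat -> E).
Hypothesis admD_ : forall k, adm (D k).
Hypothesis cenD : forall k, (1 <= k <= n)%N -> cen k (D k).
Hypothesis indD : forall k j, (1 <= k)%N -> (k < j <= n)%N -> ind j (D k).

Let M k := (\sum_(1 <= j < k.+1) D j)%R.

Let MS k : M k.+1 = (M k + D k.+1)%R.
Proof. by rewrite /M big_nat_recr. Qed.

Let admM k : adm (M k).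
Proof. by apply: subr_closed_sum => //; [exact: adm0|exact: admB]. Qed.

Let indM k j : (k < j <= n)%N -> ind j (M k).
Proof.
move=> kj; apply: subr_closed_sum => [||i]; [exact: ind0|exact: indB|].
rewrite mem_index_iota => /andP[i1 ik] _; apply: indD => //.
by case/andP: kj => kj ->; rewrite andbT (leq_ltn_trans _ kj).
Qed.

Theorem rosenthal s K : (1 < p)%R -> (1 <= s)%R -> (0 < K)%R -> resampling mu Q ->
  two_point_const p s C K -> (forall k, (1 <= k <= n)%N -> fin s (D k)) ->
  \int[Q]_t Phi (\sum_(1 <= k < n.+1) D k)%R t `^ s <= (rosK s K)%:E *
   (\sum_(1 <= k < n.+1) \int[Q]_t Phi (D k) t `^ s +
    \int[Q]_t (\sum_(1 <= k < n.+1) av mu k (Phi (D k)) t) `^ s).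
Proof.
move=> p1 s1 K0 resQ HK finD_.
have s0 : (0 < s)%R by lra.
have mPD k := nnmeas_Phi (admD_ k).
have mPM k := nnmeas_Phi (admM k).
have mA k := nnmeas_av mu k (mPD k).
have finM k : (k <= n)%N -> fin s (M k).
  elim: k => [|k IH] kn; first by rewrite /M big_nil; exact: fin0.
  by rewrite MS; apply: finD => //; [exact/IH/ltnW|exact: finD_].
(* [M k.-1] is the partial sum before step [k], insensitive to coordinate [k], which is why
   [Phi (D k)] may be replaced by its average. *)
pose X k := \int[Q]_t (Phi (M k.-1) t `^ (s - 1) * av mu k (Phi (D k)) t).
pose Z k := \int[Q]_t Phi (D k) t `^ s.
have X0 k : 0 <= X k by apply: nnint_ge0; apply: nnmeasM => //; exact: nnmeas_poweR.
have Z0 k : 0 <= Z k by apply: nnint_ge0; exact: nnmeas_poweR.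
(* The two-point inequality bounds the sum of the moments of [M k + D k.+1] and [M k - D k.+1]; by
   Jensen the second one is at least the moment of [M k], which is then subtracted from both
   sides. *)
have step k : (k < n)%N -> \int[Q]_t Phi (M k.+1) t `^ s <=
    \int[Q]_t Phi (M k) t `^ s + K%:E * (X k.+1 + Z k.+1).
  move=> kn; have k1 : (1 <= k.+1 <= n)%N by [].
  have XE : X k.+1 = \int[Q]_t (Phi (M k) t `^ (s - 1) * Phi (D k.+1) t).
    rewrite /X/= [RHS](resQ k.+1)//; last by apply: nnmeasM => //; exact: nnmeas_poweR.
    apply: eq_integral => t _; rewrite (@av_indepM _ _ _ _ k.+1)//; first exact: nnmeas_poweR.
    by apply/indep_poweR/indep_Phi/indM; rewrite ltnSn.
  have aDk := admD_ k.+1; have aMk := admM k.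
  have aN : adm (- D k.+1)%R by rewrite -[X in adm X]add0r; apply: admB => //; exact: adm0.
  have cN : cen k.+1 (- D k.+1)%R.
    by rewrite -[X in cen _ X]add0r; apply: cenB; [exact: cen0|exact: cenD].
  have iM : ind k.+1 (M k) by apply: indM; rewrite ltnSn.
  have := Phi_jensen_poweR s1 (ltn0Sn k) aMk aN iM cN (finM _ (ltnW kn)).
  have fA := finM _ (ltnW kn); rewrite /fin in fA.
  have mAk := nnmeas_poweR s (mPM k).
  have A0 := nnint_ge0 Q mAk.
  have mU := nnmeas_poweR s (nnmeas_Phi (admD aMk aDk)).
  have mU' := nnmeas_poweR s (nnmeas_Phi (admB aMk aDk)).
  have mP1 := nnmeasM (nnmeas_poweR (s - 1) (mPM k)) (mPD k.+1).
  have mP2 := nnmeas_poweR s (mPD k.+1).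
  have K0' := ltW K0.
  have := @nnint_le _ _ _ Q _ _ (nnmeasD mU mU')
     (nnmeasD (nnmeasZ (ler0n R 2) mAk) (nnmeasZ K0' (nnmeasD mP1 mP2)))
     (fun t => Phi_two_point_powR t p1 s1 K0 HK aMk aDk).
  rewrite nnintD// nnintD; [|exact: nnmeasZ|by apply/nnmeasZ/nnmeasD].
  rewrite nnintZ ?ler0n// nnintZ//; last exact: nnmeasD.
  rewrite (nnintD _ mP1 mP2) -XE -MS -/(Z k.+1).
  move: A0 fA; set A := \int[Q]_t _; set U := \int[Q]_t _; set U' := \int[Q]_t _.
  clearbody A U U'; set Y := K%:E * _ => A0 fA h AU.
  have := le_trans (leeD2l U' AU) h.
  case: A A0 fA {h AU} => [A| |] // A0 _.
  have -> : 2%:E * A%:E + Y = A%:E + Y + A%:E.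
    by rewrite mule_natl mule2n addeAC.
  by rewrite leeD2rE.
have tot k : (k <= n)%N -> \int[Q]_t Phi (M k) t `^ s <=
    K%:E * (\sum_(1 <= j < k.+1) (X j + Z j)).
  elim: k => [_|k IH kn].
    rewrite /M big_nil; under eq_integral do rewrite Phi0 poweR0r ?gt_eqF//.
    by rewrite integral0 big_nil mule0.
  rewrite big_nat_recr//= ge0_muleDr; last 2 first.
  - by apply: sume_ge0 => j _; exact: adde_ge0.
  - exact: adde_ge0.
  by apply: le_trans (step _ kn) _; apply: leeD2r; exact: IH (ltnW kn).
have := tot n (leqnn n); rewrite big_split/=.
set sX := (\sum_(1 <= j < n.+1) X j)%R; set sZ := (\sum_(1 <= j < n.+1) Z j)%R.
have sX0 : 0 <= sX by apply: sume_ge0.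
have sZ0 : 0 <= sZ by apply: sume_ge0.
pose A t := \sum_(1 <= k < n.+1) av mu k (Phi (D k)) t.
have mAt : nnmeas A by apply: nnmeas_sum => k _; exact: mA.
rewrite -/(M n) -/A; set U := \int[Q]_t _; set V := \int[Q]_t (A t `^ s).
have V0 : 0 <= V by apply: nnint_ge0; exact: nnmeas_poweR.
have U0 : 0 <= U by apply: nnint_ge0; exact: nnmeas_poweR.
have Ufin : U < +oo by exact: finM.
pose eps : R := (2 * K * doobK s)^-1%R.
have r1 : (1 <= 1 + eps `^ (1 - s))%R by rewrite lerDl powR_ge0.
have KrK : (2 * K <= rosK s K)%R by rewrite /rosK ler_peMr// mulr_ge0// ltW.
have rosK0 : (0 <= rosK s K)%R by apply: le_trans KrK; rewrite mulr_ge0// ltW.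
move=> Ule.
have sXE : sX = \int[Q]_t (\sum_(1 <= k < n.+1) (Phi (M k.-1) t `^ (s - 1) * av mu k (Phi (D k)) t)).
  by rewrite nnint_sum// => k _; apply: nnmeasM => //; exact: nnmeas_poweR.
have [s_eq1|s_neq1] := eqVneq s 1%R.
  have sXV : sX = V.
    rewrite sXE /V; apply: eq_integral => t _; rewrite s_eq1 subrr.
    under eq_bigr do rewrite poweRe0 mul1e.
    by rewrite poweRe1//; case: mAt.
  rewrite sXV in Ule; apply: le_trans Ule _; rewrite addeC.
  apply: lee_wpmul2r; first exact: adde_ge0.
  by rewrite lee_fin; apply: le_trans KrK; rewrite ler_peMl ?ltW//; lra.
have s_gt1 : (1 < s)%R by rewrite lt_neqAle eq_sym s_neq1.
have dK0 : (0 < doobK s)%R.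
  have c0 : (0 < 1 - s^-1)%R by rewrite subr_gt0 invf_lt1.
  by rewrite /doobK mulr_gt0// mulr_gt0 ?invr_gt0// powR_gt0// divr_gt0.
have eps0 : (0 < eps)%R by rewrite invr_gt0; apply: mulr_gt0 => //; exact: mulr_gt0.
have e1 : (0 <= eps `^ (1 - s))%R by exact: powR_ge0.
pose Sx := run_max (fun k => Phi (M k)) n.
have mSx : nnmeas Sx by exact: nnmeas_run_max.
have doob : \int[Q]_t Sx t `^ s <= (doobK s)%:E * U.
  apply: doob_maximal => //.
  - by move=> k j kj; exact/indep_Phi/indM.
  - move=> k W kn mW iW; rewrite MS; apply: (@Phi_jensen _ _ _ k.+1) => //.
    + by apply: indM; rewrite ltnSn.
    + exact: cenD.
have sXle : sX <= (eps * doobK s)%:E * U + (eps `^ (1 - s))%:E * V.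
  apply: (@le_trans _ _ (\int[Q]_t (eps%:E * Sx t `^ s + (eps `^ (1 - s))%:E * A t `^ s))).
    rewrite sXE; apply: nnint_le => [||t].
    - by apply: nnmeas_sum => k _; apply: nnmeasM => //; exact: nnmeas_poweR.
    - by apply: nnmeasD; apply: nnmeasZ; rewrite ?(ltW eps0)//; exact: nnmeas_poweR.
    (* All the weights are bounded by that of the running maximum, which leaves the sum of the
       averages as a factor. *)
    apply: (@le_trans _ _ (Sx t `^ (s - 1) * A t)); last first.
      by apply: eyoung_eps => //; exact: nnmeas_ge0.
    rewrite /A ge0_sume_distrr; last by move=> k _; exact: nnmeas_ge0.
    rewrite big_nat_cond [leRHS]big_nat_cond; apply: lee_sum => k /andP[/andP[k1 kn] _].
    apply: lee_wpmul2r; first exact: nnmeas_ge0.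
    have kn' : (k.-1 <= n)%N by rewrite (leq_trans (leq_pred k)).
    have s10 : (0 <= s - 1)%R by rewrite subr_ge0.
    apply: gt0_ler_poweR => //; rewrite ?in_itv/= ?leey ?andbT; try exact: nnmeas_ge0.
    exact: (@le_run_max _ _ _ (fun k => Phi (M k))).
  rewrite nnintD; [|exact/nnmeasZ/nnmeas_poweR/mSx/ltW|exact/nnmeasZ/nnmeas_poweR].
  rewrite nnintZ ?(ltW eps0)//; last exact: nnmeas_poweR.
  rewrite nnintZ//; last exact: nnmeas_poweR.
  apply: leeD2r; rewrite EFinM -muleA; apply: lee_wpmul2l doob.
  by rewrite lee_fin ltW.
apply: (@le_trans _ _ (2%:E * (K%:E * ((eps `^ (1 - s))%:E * V + sZ)))); last first.
  rewrite muleA -EFinM /rosK -/eps.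
  have K20 : (0 <= 2 * K)%R by rewrite mulr_ge0 ?ltW.
  rewrite [in leRHS]EFinM -muleA; apply: lee_wpmul2l => //.
  set e1s := (1 + _)%R in r1 *.
  have e1s0 : (0 <= e1s)%R by exact: le_trans ler01 r1.
  apply: (@le_trans _ _ (e1s%:E * V + e1s%:E * sZ)); last by rewrite -ge0_muleDr// addeC.
  apply: leeD; last first.
    by rewrite -[leLHS]mul1e lee_wpmul2r// lee_fin.
  by rewrite lee_wpmul2r// lee_fin lerDr.
have eV0 : 0 <= (eps `^ (1 - s))%:E * V by rewrite mule_ge0.
apply: absorb_half => //; first by rewrite mule_ge0 ?adde_ge0 ?lee_fin ?(ltW K0).
apply: le_trans Ule _.
have -> : (2^-1)%:E * U = K%:E * ((eps * doobK s)%:E * U).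
  rewrite muleA -EFinM; congr (_%:E * _); rewrite /eps.
  by field; apply/andP; split; rewrite gt_eqF.
have eU0 : 0 <= (eps * doobK s)%:E * U by rewrite mule_ge0// lee_fin mulr_ge0 ?ltW.
rewrite -ge0_muleDr ?adde_ge0//; apply: lee_wpmul2l; first by rewrite lee_fin ltW.
by rewrite addeA; exact: leeD2r.
Qed.

End LpTheory.
End SmoothSpaces.

(** * Degenerate sums *)

Section DecreasingLists.

(* Strictly decreasing lists of length [m] with entries in [1, N]: the multi-indices of [Inc_le m N] read backwards. *)
Fixpoint dec (m N : nat) : seq (seq nat) :=
  if m is m'.+1 then flatten [seq [seq k :: l | l <- dec m' k.-1] | k <- index_iota 1 N.+1]
  else [:: [::]].

Lemma dec_sumS (V : nmodType) m N (X : seq nat -> V) :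
  \sum_(l <- dec m.+1 N) X l = \sum_(1 <= k < N.+1) \sum_(l <- dec m k.-1) X (k :: l).
Proof. by rewrite big_flatten big_map; apply: eq_bigr => k _; rewrite big_map. Qed.

Lemma mem_dec m N l :
  (l \in dec m N) = [&& size l == m, path gtn N.+1 l & all (leq 1) l].
Proof.
elim: m N l => [|m IH] N l; first by rewrite inE; case: l.
apply/idP/idP => [/flatten_mapP[k]|].
  rewrite mem_index_iota => /andP[k1 kN] /mapP[l' + ->].
  rewrite IH prednK// => /and3P[/eqP <- pl al] /=.
  by rewrite eqxx k1 /= kN pl.
case: l => [|k l] //= /and3P[sl /andP[kN pl] /andP[k1 al]].
apply/flatten_mapP; exists k; first by rewrite mem_index_iota k1.
by apply: map_f; rewrite IH prednK// pl al -eqSS sl.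
Qed.

Lemma dec_bounds m N l j : l \in dec m N -> j \in l -> (1 <= j <= N)%N.
Proof.
rewrite mem_dec => /and3P[_ pl /allP al] jl; rewrite (al _ jl)/=.
have gt_trans : transitive gtn by move=> a b c /= h1 h2; exact: ltn_trans h2 h1.
by have /allP/(_ _ jl) := order_path_min gt_trans pl.
Qed.

Lemma dec_cons m N k l : (1 <= k <= N)%N -> l \in dec m k.-1 -> k :: l \in dec m.+1 N.
Proof.
move=> /andP[k1 kN]; rewrite !mem_dec prednK//= => /and3P[/eqP -> -> ->].
by rewrite eqxx ltnS kN k1.
Qed.

(** Lets the lists below every [k] be drawn from the same range [dec m N], as a family indexed by
    [k] requires. The default head 0 of the empty list satisfies the constraint since [1 <= k]. *)
Lemma dec_sum_head (V : nmodType) m N k (X : seq nat -> V) : (1 <= k <= N)%N ->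
  \sum_(l <- dec m k.-1) X l = \sum_(l <- dec m N | (head 0%N l < k)%N) X l.
Proof.
case: m => [|m] /andP[k1 kN]; first by rewrite /= !big_cons !big_nil /= k1.
rewrite dec_sumS prednK// [RHS]big_mkcond dec_sumS.
rewrite (big_nat_widen _ _ N.+1) ?leqW// big_mkcond; apply: eq_bigr => j _ /=.
by case: ifP => _ //; rewrite big1.
Qed.

Lemma dec_head_lt m N k l : (1 <= k)%N -> l \in dec m N -> (head 0%N l < k)%N -> l \in dec m k.-1.
Proof.
move=> k1; rewrite !mem_dec prednK// => /and3P[-> pl ->]; rewrite andbT /=.
by case: l pl => [|j l]//= /andP[_ ->]; rewrite andbT.
Qed.

End DecreasingLists.

(** The tangent inequality at the mean, integrated. *)
Lemma jensen_poweR (R : realType) d (T : measurableType d) (P : probability T R) (s : R)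
    (F : T -> \bar R) : 1 <= s -> nnmeas F ->
  ((\int[P]_t F t) `^ s <= \int[P]_t F t `^ s)%E.
Proof.
move=> s1 mF; have mFs := nnmeas_poweR s mF.
have PT : P setT = 1%E by exact: probability_setT.
have s10 : 0 <= s - 1 by lra.
have s0 : 0 <= s by lra.
have sn0 : s != 0 by rewrite gt_eqF//; lra.
have m1 : nnmeas (fun _ : T => 1%E : \bar R) by exact: (@nnmeas_cst R _ T 1 ler01).
set c := (\int[P]_t F t)%E; have c0 : (0 <= c)%E by exact: nnint_ge0.
have I (r : R) : (\int[P]_t r%:E = r%:E)%E.
  by transitivity (r%:E * P setT)%E; [exact: integral_cst|rewrite PT mule1].
have [c_oo|c_fin] := eqVneq c +oo%E.
  suff -> : (\int[P]_t F t `^ s = +oo)%E by exact: leey.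
  apply/eqP; rewrite -leye_eq leNgt; apply/negP => fin.
  have : (c <= \int[P]_t (1 + F t `^ s))%E.
    apply: nnint_le => // [|t]; first exact: nnmeasD.
    have := nnmeas_ge0 t mF; case: (F t) => [x| |]// x0; last by rewrite poweRyr// addey.
    rewrite poweR_EFin -EFinD lee_fin.
    have := bernoulli_powR s1 x0.
    have : 0 <= (s - 1) * x by rewrite mulr_ge0. 
    have [x1|x1] := leP 1 x; have := powR_ge0 x s; last lra.
    by have := le1r_powR x1 s1; lra.
  rewrite nnintD//.
  by rewrite I c_oo leye_eq; apply/negP; rewrite -ltey lte_add_pinfty// ltry.
have cE : c = (fine c)%:E by rewrite fineK// ge0_fin_numE// ltey.
set r := fine c in cE; have r0 : 0 <= r by move: c0; rewrite cE lee_fin.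
have : (\int[P]_t ((s * r `^ (s - 1))%:E * F t) <= \int[P]_t (F t `^ s + ((s - 1) * r `^ s)%:E))%E.
  apply: nnint_le => [||t].
  - by apply: nnmeasZ => //; rewrite mulr_ge0 ?powR_ge0.
  - by apply: nnmeasD => //; apply: nnmeas_cst; rewrite mulr_ge0 ?powR_ge0.
  have := eyoung s1 (_ : 0 <= r%:E)%E (nnmeas_ge0 t mF).
  by rewrite !poweR_EFin EFinM muleA -EFinM; apply; rewrite lee_fin.
have mr : nnmeas (fun _ : T => ((s - 1) * r `^ s)%:E).
  by apply: nnmeas_cst; rewrite mulr_ge0 ?powR_ge0.
rewrite nnintZ ?mulr_ge0 ?powR_ge0// -/c cE nnintD// I.
case: (\int[P]_t _)%E (nnint_ge0 P mFs) => [z| |]// z0; last by move=> _; exact: leey.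
rewrite poweR_EFin -EFinM -EFinD !lee_fin -mulrA [r `^ (s - 1) * r]mulrC.
rewrite mulr_powRB1//; [lra|exact: lt_le_trans s1].
Qed.

Section Decoupling.
Context {R : realType} d (S : measurableType d) (mu : probability S R)
  (Q : probability (seqspace S) R).
Local Open Scope ereal_scope.

Lemma nn_fin_sum (s : R) (I : eqType) (r : seq I) (q : pred I) (F : I -> seqspace S -> \bar R) :
  (0 < s)%R -> (forall i, nnmeas (F i)) -> (forall i, i \in r -> q i -> \int[Q]_t F i t `^ s < +oo) ->
  \int[Q]_t (\sum_(i <- r | q i) F i t) `^ s < +oo.
Proof.
move=> s0 mF; have sn0 : s != 0%R by rewrite gt_eqF.
elim: r => [|i r IH] h.
  by under eq_integral do rewrite big_nil poweR0r//; rewrite integral0 ltry.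
have IHr : \int[Q]_t (\sum_(j <- r | q j) F j t) `^ s < +oo.
  by apply: IH => j jr; apply: h; rewrite inE jr orbT.
have [qi|nqi] := boolP (q i); last by under eq_integral do rewrite big_cons (negbTE nqi).
have mS : nnmeas (fun t => \sum_(j <- r | q j) F j t) by exact: nnmeas_sum.
have p2 : (0 <= 2 `^ s :> R)%R by exact: powR_ge0.
apply: (@le_lt_trans _ _ (\int[Q]_t ((2 `^ s)%:E * (F i t `^ s + (\sum_(j <- r | q j) F j t) `^ s)))).
  apply: nnint_le => [||t].
  - by apply/nnmeas_poweR/nnmeas_sum.
  - by apply: nnmeasZ => //; apply: nnmeasD; exact: nnmeas_poweR.
  - by rewrite big_cons qi; exact: (poweRD_le s0 (nnmeas_ge0 t (mF i)) (nnmeas_ge0 t mS)).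
rewrite nnintZ//; last by apply: nnmeasD; exact: nnmeas_poweR.
rewrite nnintD; try exact: nnmeas_poweR.
apply: lte_mul_pinfty; rewrite ?lee_fin//; apply: lte_add_pinfty => //.
by apply: h => //; rewrite inE eqxx.
Qed.

Hypothesis resQ : resampling mu Q.

Lemma av_fin (s : R) k F : (1 <= s)%R -> (1 <= k)%N -> nnmeas F ->
  \int[Q]_t F t `^ s < +oo -> \int[Q]_t (av mu k F t) `^ s < +oo.
Proof.
move=> s1 k1 mF; apply: le_lt_trans; have mFs := nnmeas_poweR s mF.
rewrite [leRHS](resQ k1 mFs); apply: nnint_le => [||t].
- exact/nnmeas_poweR/nnmeas_av.
- exact: nnmeas_av.
- by apply: jensen_poweR => //; exact: nnmeas_updr.
Qed.

Section DerivedSpace.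
Context (p C : R) (C0 : (0 <= C)%R) (E : lp_space Q p C) (n : nat).

Let V := {ffun 'I_n -> E}.

Definition dPhi (v : V) t := \sum_(i < n) av mu i.+1 (Phi (v i)) t.
Definition dadm (v : V) := forall i, adm (v i).
(** Component [k] is exempt: its dependence on coordinate [k] disappears in the average over that
    coordinate. *)
Definition dind k (v : V) := forall i : 'I_n, i.+1 != k -> ind k (v i).
(** Component [k] has to vanish: it may depend on coordinate [k] by [dind], so a zero mean over that
    coordinate gives no comparison. In the application this holds because only indices larger than
    the entries of a list are put in front of it. *)
Definition dcen k (v : V) :=
  forall i : 'I_n, if i.+1 == k then v i = 0%R else cen k (v i).

Lemma dnnmeas_Phi v : dadm v -> nnmeas (dPhi v).
Proof. by move=> av; apply: nnmeas_sum => i _; exact/nnmeas_av/nnmeas_Phi. Qed.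

Lemma dPhi0 t : dPhi 0%R t = 0.
Proof.
rewrite /dPhi big1// => i _; rewrite /av ffunE.
by under eq_integral do rewrite Phi0; rewrite integral0.
Qed.

Lemma dPhiN v t : dPhi (- v)%R t = dPhi v t.
Proof.
apply: eq_bigr => i _; rewrite /av ffunE.
by under eq_integral do rewrite PhiN.
Qed.

Lemma dPhi_two_point x y t : dadm x -> dadm y ->
  dPhi (x + y)%R t + dPhi (x - y)%R t <= 2%:E * dPhi x t + C%:E * dPhi y t.
Proof.
move=> ax ay; rewrite /dPhi.
rewrite !ge0_sume_distrr; try by move=> i _; apply/nnmeas_ge0/nnmeas_av/nnmeas_Phi.
rewrite -!big_split/=; apply: lee_sum => i _; rewrite !ffunE.
have mx := nnmeas_Phi (ax i); have my := nnmeas_Phi (ay i).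
have mp := nnmeas_Phi (admD (ax i) (ay i)); have mm := nnmeas_Phi (admB (ax i) (ay i)).
have two0 : (0 <= 2 :> R)%R by [].
rewrite -!avZ// -!avD//; try exact: nnmeasZ.
by apply: av_le => [||s]; [exact: nnmeasD|apply: nnmeasD; exact: nnmeasZ|exact: Phi_two_point].
Qed.

Lemma dPhi_convex x y t : dadm x -> dadm y ->
  convex_bound p (dPhi (x + y)%R t) (dPhi x t) (dPhi y t).
Proof.
move=> ax ay u u01; rewrite /dPhi.
have a0 : (0 <= (1 - u) `^ (1 - p))%R by exact: powR_ge0.
have b0 : (0 <= u `^ (1 - p))%R by exact: powR_ge0.
rewrite !ge0_sume_distrr; try by move=> i _; apply/nnmeas_ge0/nnmeas_av/nnmeas_Phi.
rewrite -!big_split/=; apply: lee_sum => i _; rewrite !ffunE.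
have mx := nnmeas_Phi (ax i); have my := nnmeas_Phi (ay i).
have mp := nnmeas_Phi (admD (ax i) (ay i)).
rewrite -!avZ// -!avD//; try exact: nnmeasZ.
by apply: av_le => [||s] //; [apply: nnmeasD; exact: nnmeasZ|exact: Phi_convex].
Qed.

Lemma dindep_Phi k x : dind k x -> indep k (dPhi x).
Proof.
move=> ix s y; apply: eq_bigr => i _.
have [<-|ik] := eqVneq i.+1 k; first exact: indep_av_same.
by apply: indep_av; exact/indep_Phi/ix.
Qed.

(** By adjointness the average over coordinate [i.+1] is moved onto [W], which remains insensitive
    to [k]; this is why the Jensen inequality of an [lp_space] carries an arbitrary weight. *)
Lemma dPhi_jensen k x D W : (1 <= k)%N -> dadm x -> dadm D -> dind k x -> dcen k D ->
  nnmeas W -> indep k W ->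
  \int[Q]_s (W s * dPhi x s) <= \int[Q]_s (W s * dPhi (x + D)%R s).
Proof.
move=> k1 ax aD ix cD mW iW.
have aux v : dadm v -> \int[Q]_s (W s * dPhi v s) =
    \sum_(i < n) \int[Q]_s (av mu i.+1 W s * Phi (v i) s).
  move=> avv; have mv (i : 'I_n) := nnmeas_av mu i.+1 (nnmeas_Phi (avv i)).
  under eq_integral => s _.
    rewrite ge0_sume_distrr; last by move=> i _; exact/nnmeas_ge0/mv.
    over.
  rewrite nnint_sum; last by move=> i _; exact: nnmeasM.
  by apply: eq_bigr => i _; rewrite (av_adjoint resQ)//; exact: nnmeas_Phi.
have axD : dadm (x + D)%R by move=> i; rewrite ffunE; exact: admD.
rewrite !aux//; apply: lee_sum => i _; rewrite ffunE.
have := cD i; case: eqP => [_ ->|/eqP ik cDi]; first by rewrite addr0.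
by apply: (Phi_jensen k1 (ax i) (aD i) (ix i ik) cDi); [exact: nnmeas_av|exact: indep_av].
Qed.

Lemma dindB k x y : dind k x -> dind k y -> dind k (x - y)%R.
Proof. by move=> ix iy i ik; rewrite !ffunE; apply: indB; [exact: ix|exact: iy]. Qed.

Lemma dcenB k x y : dcen k x -> dcen k y -> dcen k (x - y)%R.
Proof.
move=> cx cy i; have := cx i; have := cy i; rewrite !ffunE.
by case: ifP => [_ -> ->|_ h1 h2]; [rewrite subr0|exact: cenB].
Qed.

(* The space of [E]-valued families [v], with [Phi v = \sum_k av k (Phi (v k))]:
   it turns the conditional p-th moments of Rosenthal's inequality into norms of the same kind. *)
Definition derived_space : lp_space Q p C.
Proof.
refine (@LpSpace _ _ _ Q p C V dPhi dadm dind dcen _ _ _ _ _ _ _ _ _ _ _ _ _).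
- by move=> i; rewrite ffunE; exact: adm0.
- by move=> x y ax ay i; rewrite !ffunE; exact: admB.
- by move=> k i _; rewrite ffunE; exact: ind0.
- exact: dindB.
- by move=> k i; rewrite ffunE; case: ifP => // _; exact: cen0.
- exact: dcenB.
- exact: dnnmeas_Phi.
- exact: dPhi0.
- exact: dPhiN.
- exact: dPhi_two_point.
- exact: dPhi_convex.
- exact: dindep_Phi.
- exact: dPhi_jensen.
Defined.

End DerivedSpace.

(* Each variable, starting from the one with the largest index,
   is either kept outside the power [s] or averaged inside it. *)
Fixpoint moment_bound (s : R) (m N : nat) (G : seq nat -> seqspace S -> \bar R) : \bar R :=
  if m is m'.+1 then
    \sum_(1 <= k < N.+1) moment_bound s m' k.-1 (fun l => G (k :: l)) +
    moment_bound s m' N (fun l t => \sum_(1 <= k < N.+1 | (head 0 l < k)%N) av mu k (G (k :: l)) t)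
  else \int[Q]_t G [::] t `^ s.

Lemma moment_bound_ge0 s m N G : (forall l, nnmeas (G l)) -> 0 <= moment_bound s m N G.
Proof.
elim: m N G => [|m IH] N G mG /=; first exact/nnint_ge0/nnmeas_poweR.
apply: adde_ge0; first by apply: sume_ge0 => k _; exact: IH.
by apply: IH => l; apply: nnmeas_sum => k _; exact: nnmeas_av.
Qed.

(** The same [C], hence the same [K], serves in [E] and in [derived_space], so each step of the
    induction, which quantifies over the space, costs one factor [rosK s K]. *)
Theorem degenerate_moment_bound (p C s K : R) (E : lp_space Q p C) m N (f : seq nat -> E) :
  (1 < p)%R -> (0 <= C)%R -> (1 <= s)%R -> (0 < K)%R -> two_point_const p s C K ->
  (forall l, adm (f l)) ->
  (forall l, l \in dec m N -> [/\ forall j, j \in l -> cen j (f l),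
     forall j, (1 <= j <= N)%N -> j \notin l -> ind j (f l) & fin s (f l)]) ->
  \int[Q]_t Phi (\sum_(l <- dec m N) f l)%R t `^ s <=
  ((rosK s K) ^+ m)%:E * moment_bound s m N (fun l => Phi (f l)).
Proof.
move=> p1 C0 s1 K0 HK; have s0 : (0 < s)%R by lra.
elim: m E N f => [|m IH] E N f af hf.
  by rewrite /= big_cons big_nil addr0 expr0 mul1e.
have Kr0 : (0 <= rosK s K)%R by rewrite mulr_ge0 ?addr_ge0 ?powR_ge0// mulr_ge0// ltW.
have Km0 : (0 <= rosK s K ^+ m)%R by exact: exprn_ge0.
have mPf l := nnmeas_Phi (af l).
pose D k := (\sum_(l <- dec m k.-1) f (k :: l))%R.
have aD k : adm (D k) by apply: subr_closed_sum => //; [exact: adm0|exact: admB].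
have finD_ k : (1 <= k <= N)%N -> fin s (D k).
  move=> kN; have : fin s (D k) /\ adm (D k); last by case.
  rewrite /D big_seq_cond; apply: (big_ind (fun v : E => fin s v /\ adm v)) => [|x y [fx ax] [fy ay]|l].
  - by split; [exact: fin0|exact: adm0].
  - by split; [exact: finD|exact: admD].
  - by move=> /andP[/(dec_cons kN)/hf[_ _ ?] _]; split.
have cD k : (1 <= k <= N)%N -> cen k (D k).
  move=> kN; apply: subr_closed_sum => [||l lk _]; [exact: cen0|exact: cenB|].
  by have [c _ _] := hf _ (dec_cons kN lk); apply: c; rewrite inE eqxx.
have iD k j : (1 <= k)%N -> (k < j <= N)%N -> ind j (D k).
  move=> k1 /andP[kj jN]; have kN : (1 <= k <= N)%N by rewrite k1 ltnW// (leq_trans kj).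
  apply: subr_closed_sum => [||l lk _]; [exact: ind0|exact: indB|].
  have [_ i _] := hf _ (dec_cons kN lk); apply: i.
    by rewrite jN (leq_trans _ kj).
  rewrite inE gtn_eqF//=; apply/negP => /(dec_bounds lk)/andP[_ h].
  by have := leq_trans kj (leq_trans h (leq_pred k)); rewrite ltnn.
have := rosenthal aD cD iD p1 s1 K0 resQ HK finD_.
rewrite dec_sumS => /le_trans; apply.
have -> : (rosK s K ^+ m.+1)%:E = (rosK s K)%:E * (rosK s K ^+ m)%:E.
  by rewrite -EFinM -exprS.
rewrite -[leRHS]muleA; apply: lee_wpmul2l; first by rewrite lee_fin.
have mb1 k : 0 <= moment_bound s m k.-1 (fun l => Phi (f (k :: l))) by apply: moment_bound_ge0.
rewrite /= ge0_muleDr; last 2 first.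
- by apply: sume_ge0 => k _.
- by apply: moment_bound_ge0 => l; apply: nnmeas_sum => k _; exact: nnmeas_av.
apply: leeD.
  rewrite ge0_sume_distrr//; rewrite big_nat_cond [leRHS]big_nat_cond.
  apply: lee_sum => k /andP[kN _]; rewrite ltnS in kN.
  apply: (IH E k.-1 (fun l => f (k :: l))) => // l lk.
  have [c i fi] := hf _ (dec_cons kN lk); split=> // [j jl|j /andP[j1 jk] jl].
    by apply: c; rewrite inE jl orbT.
  have k1 : (1 <= k)%N by case/andP: kN.
  have jltk : (j < k)%N by rewrite -(prednK k1) ltnS.
  apply: i; first by rewrite j1 (leq_trans (ltnW jltk))//; case/andP: kN.
  by rewrite inE ltn_eqF.
pose E' := derived_space C0 E N.
(* Component [i] holds the summand of the list [i.+1 :: l] when that list is decreasing, and zero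
   otherwise; the sum of the [f' l] then has the increments [D i.+1] as components. *)
pose f' l : E' := [ffun i : 'I_N => if (head 0%N l < i.+1)%N then f (i.+1 :: l) else 0%R].
have Phi'E l : Phi (f' l) = fun t => \sum_(1 <= k < N.+1 | (head 0 l < k)%N) av mu k (Phi (f (k :: l))) t.
  apply/funext => t; rewrite /= /dPhi big_add1/= big_mkord [RHS]big_mkcond/=.
  apply: eq_bigr => i _; rewrite ffunE; case: ifP => // _.
  by rewrite /av; under eq_integral do rewrite Phi0; rewrite integral0.
have -> : (fun l t => \sum_(1 <= k < N.+1 | (head 0 l < k)%N) av mu k (Phi (f (k :: l))) t) =
    (fun l => Phi (f' l)) by apply/funext => l; rewrite Phi'E.
have DE t : \sum_(1 <= k < N.+1) av mu k (Phi (D k)) t = Phi (\sum_(l <- dec m N) f' l)%R t.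
  rewrite /= /dPhi big_add1/= big_mkord; apply: eq_bigr => i _; congr (av mu _ (Phi _) t).
  rewrite sum_ffunE /D (@dec_sum_head _ m N)//; last by rewrite /= ltn_ord.
  by rewrite big_mkcond/=; apply: eq_bigr => l _; rewrite ffunE.
under eq_integral do rewrite DE.
have af' l : dadm (f' l) by move=> i; rewrite ffunE; case: ifP => // _; exact: adm0.
apply: (IH E' N f' af') => l lN.
have step (i : 'I_N) : (head 0 l < i.+1)%N -> i.+1 :: l \in dec m.+1 N.
  by move=> h; apply: dec_cons; [rewrite /= ltn_ord|exact: (dec_head_lt _ lN)].
split=> [j jl|j jN jl|].
- suff : dcen j (f' l) by [].
  move=> i; rewrite ffunE; case: (boolP (head 0%N l < i.+1)%N) => hl.
    have [c _ _] := hf _ (step _ hl).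
    case: eqP => [ij|_]; last by apply: c; rewrite inE jl orbT.
    have lk := dec_head_lt (ltn0Sn i) lN hl.
    by have := dec_bounds lk jl; rewrite -ij /= ltnn.
  by case: eqP => _ //; exact: cen0.
- suff : dind j (f' l) by [].
  move=> i ij; rewrite ffunE; case: ifP => hl; last exact: ind0.
  have [_ ii _] := hf _ (step _ hl); apply: ii => //.
  by rewrite inE eq_sym negb_or ij.
- rewrite /fin Phi'E; apply: nn_fin_sum => // [k|k]; first exact: nnmeas_av.
  rewrite mem_index_iota ltnS => kN hl; have k1 : (1 <= k)%N by case/andP: kN.
  apply: av_fin => //.
  have lk := dec_head_lt k1 lN hl.
  by have [] := hf _ (dec_cons kN lk).
Qed.

End Decoupling.

(** * Vector-valued functions *)

Section NormingFamily.
Context {R : realType} (B : normedModType R) (e : nat -> B) (N : B -> R) (L : R)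
  (phi : nat -> B -> R).
Hypothesis dense_e : forall x (eps : R), 0 < eps -> exists n, `|x - e n| < eps.
Hypothesis normN : is_norm N.
Hypothesis L0 : 0 <= L.
Hypothesis NL : forall x, N x <= L * `|x|.
Hypothesis normingN : norming N phi.

Lemma norming_funD n x y : phi n (x + y) = phi n x + phi n y.
Proof. by case: normingN. Qed.
Lemma norming_funZ n a x : phi n (a *: x) = a * phi n x.
Proof. by case: normingN. Qed.
Lemma norming_fun_le n x : phi n x <= N x.
Proof. by case: normingN. Qed.
Lemma norming_fun0 n : phi n 0 = 0.
Proof. by rewrite -(scale0r (0 : B)) norming_funZ mul0r. Qed.
Lemma norming_funN n x : phi n (- x) = - phi n x.
Proof. by rewrite -scaleN1r norming_funZ mulN1r. Qed.
Lemma norming_funB n x y : phi n (x - y) = phi n x - phi n y.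
Proof. by rewrite norming_funD norming_funN. Qed.
Lemma norming_fun_norm n x : `|phi n x| <= L * `|x|.
Proof.
rewrite ler_norml (le_trans (norming_fun_le n x) (NL x)) andbT.
by rewrite lerNl -norming_funN (le_trans (norming_fun_le _ _))// -(normrN x).
Qed.

Section Fixed.
Context d (T : measurableType d).

Lemma measurable_norming n (f : T -> B) : smeas f ->
  measurable_fun [set: T] (fun t => phi n (f t)).
Proof.
apply: (smeas_lipschitz dense_e L0) => x y.
by rewrite -lerBlDl -norming_funB (le_trans (ler_norm _))// norming_fun_norm.
Qed.

Lemma measurable_normfun (f : T -> B) : smeas f -> measurable_fun [set: T] (fun t => N (f t)).
Proof.
apply: (smeas_lipschitz dense_e L0) => x y.
by rewrite (le_trans (is_normB_le normN x y))// lerD2l.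
Qed.

Lemma nnmeas_norm_powR (r : R) (f : T -> B) : smeas f -> nnmeas (fun t => (N (f t) `^ r)%:E).
Proof.
move=> mf; split=> [|t]; last by rewrite lee_fin powR_ge0.
apply/measurable_EFinP; apply: (measurableT_comp (measurable_powR r)).
exact: measurable_normfun.
Qed.

(* Jensen's inequality, from the tangent to [u |-> u ^ r] at [phi n c] for [n] nearly norming [c]. *)
Lemma norm_jensen (r : R) (P : probability T R) (c : B) (Z : T -> B) : 1 <= r -> smeas Z ->
  (forall n, P.-integrable setT (fun t => (phi n (Z t))%:E) /\
             (\int[P]_t (phi n (Z t))%:E = 0)%E) ->
  ((N c `^ r)%:E <= \int[P]_t (N (c + Z t) `^ r)%:E)%E.
Proof.
move=> r1 mZ hZ; have r0 : 0 < r by lra.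
have mF := @nnmeas_norm_powR r (fun t => c + Z t) (smeasD dense_e (smeas_cst c) mZ).
have I0 := nnint_ge0 P mF.
rewrite leNgt; apply/negP; set I := (\int[P]_t _)%E => Ic.
have Ifin : (I < +oo)%E by exact: lt_trans Ic (ltry _).
have IE : I = (fine I)%:E by rewrite fineK// ge0_fin_numE.
have f0 : 0 <= fine I by move: I0; rewrite -/I IE lee_fin.
have rn0 := lt0r_neq0 r0.
have [_ _ _ sup_phi] := normingN.
have [|n nc] := sup_phi c ((fine I) `^ r^-1).
  rewrite -[ltRHS](powRr1 (is_norm_ge0 normN c)) -(mulfV rn0) powRrM.
  by apply: gt0_ltr_powR; rewrite ?invr_gt0 ?nnegrE ?powR_ge0//; move: Ic; rewrite IE lte_fin.
set a := phi n c in nc.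
have a0 : 0 <= a by rewrite (le_trans (powR_ge0 _ _) (ltW nc)).
have Ia : fine I < a `^ r.
  rewrite -[ltLHS](powRr1 f0) -(mulVf rn0) powRrM.
  by apply: gt0_ltr_powR; rewrite ?nnegrE ?powR_ge0.
have [iZ Z0] := hZ n.
pose G t := ((a `^ r)%:E + (r * a `^ (r - 1))%:E * (phi n (Z t))%:E)%E.
have Poo : (P setT < +oo)%E by rewrite probability_setT ltry.
have iZ' := integrableZl measurableT (r * a `^ (r - 1)) iZ.
have ic : P.-integrable setT (cst (a `^ r)%:E).
  exact: finite_measure_integrable_cst.
have iG : P.-integrable setT G by exact: integrableD.
have GI : (\int[P]_t G t = (a `^ r)%:E)%E.
  rewrite integralD// integralZl// Z0 mule0 adde0.
  by transitivity ((a `^ r)%:E * P setT)%E; [exact: integral_cst|rewrite probability_setT mule1].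
have iF : P.-integrable setT (fun t => (N (c + Z t) `^ r)%:E).
  apply/integrableP; split; first by case: mF.
  by under eq_integral do rewrite gee0_abs ?lee_fin ?powR_ge0//.
have : (\int[P]_t G t <= I)%E.
  apply: le_integral => // t _; rewrite /G -EFinM -EFinD lee_fin.
  have := powR_tangent r1 (is_norm_ge0 normN (c + Z t)) a0.
  apply: le_trans; rewrite lerD2l; apply: ler_wpM2l; first by rewrite mulr_ge0 ?powR_ge0// ltW.
  by rewrite lerBrDl -norming_funD norming_fun_le.
by rewrite GI IE lee_fin leNgt Ia.
Qed.

End Fixed.

Context d (S : measurableType d) (mu : probability S R) (Q : probability (seqspace S) R).
Hypothesis resQ : resampling mu Q.

(** Zero mean over coordinate [k] with the others frozen, tested on the norming functionals. It is
    required for almost every sample, conditional expectations being determined up to null sets. *)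
Definition centered k (v : seqspace S -> B) := {ae Q, forall s, forall n,
  mu.-integrable setT (fun y => (phi n (v (upd s k y)))%:E) /\
  (\int[mu]_y (phi n (v (upd s k y)))%:E = 0)%E}.

Lemma centered0 k : centered k 0.
Proof.
apply: aeW => s n; under eq_fun do rewrite norming_fun0.
by split; [exact: integrable0|rewrite integral0].
Qed.

Lemma centeredB k v w : centered k v -> centered k w -> centered k (v - w).
Proof.
apply: filterS2 => s hv hw n; have [iv v0] := hv n; have [iw w0] := hw n.
have E : (fun y => (phi n ((v - w) (upd s k y)))%:E) =
   (fun y => (phi n (v (upd s k y)))%:E - (phi n (w (upd s k y)))%:E)%E.
  by apply/funext => y; rewrite norming_funB EFinB.
rewrite E; split; first exact: integrableB.
by rewrite integralB// v0 w0 sube0.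
Qed.

(** Only the right-hand side is resampled: for almost every sample the inequality then holds fibre
    by fibre, by [norm_jensen] with [x s] as the constant. *)
Lemma centered_jensen (r : R) k (x D : seqspace S -> B) (W : seqspace S -> \bar R) :
  1 <= r -> (1 <= k)%N -> smeas x -> smeas D -> indep k x -> centered k D ->
  nnmeas W -> indep k W ->
  (\int[Q]_s (W s * (N (x s) `^ r)%:E) <= \int[Q]_s (W s * (N (x s + D s) `^ r)%:E))%E.
Proof.
move=> r1 k1 mx mD ix cD mW iW.
have mF := nnmeas_norm_powR r mx.
have mG := nnmeas_norm_powR r (smeasD dense_e mx mD).
rewrite [leRHS](resQ k1 (nnmeasM mW mG)); apply: nnint_ae_le; first exact: nnmeasM.
  by apply: nnmeas_av; exact: nnmeasM.
apply: filterS cD => s cs; rewrite av_indepM//.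
apply: lee_wpmul2l; first exact: nnmeas_ge0.
rewrite /av; under eq_integral do rewrite ix.
apply: norm_jensen => //.
exact: (smeas_comp (measurable_updr s k) mD).
Qed.

Variables (p C : R).
Hypothesis p1 : 1 < p.
Hypothesis smN : two_point_smooth N p C.

Definition base_space : lp_space Q p C.
Proof.
refine (@LpSpace R _ S Q p C (seqspace S -> B) (fun v s => (N (v s) `^ p)%:E)
  (fun v => smeas v) (fun k v => indep k v) centered _ _ _ _ _ _ _ _ _ _ _ _ _).
- exact: smeas_cst.
- by move=> x y mx my; exact: (smeasB dense_e mx my).
- by [].
- by move=> k x y ix iy s z; rewrite /= -[LHS]/(x (upd s k z) - y (upd s k z)) ix iy.
- exact: centered0.
- exact: centeredB.
- by move=> x; exact: nnmeas_norm_powR.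
- move=> s; rewrite -[N _]/(N 0) (is_norm0 normN) powR0// gt_eqF//; exact: lt_trans p1.
- by move=> x s; rewrite -[N (_ s)]/(N (- x s)) (is_normN normN).
- by move=> x y s _ _; rewrite -!EFinM -!EFinD lee_fin; exact: smN.
- move=> x y s _ _ t t01; rewrite -!EFinM -EFinD lee_fin.
  apply: le_trans (convex_powRD (ltW p1) t01 (is_norm_ge0 normN _) (is_norm_ge0 normN _)).
  have p0 : 0 <= p by rewrite (le_trans ler01)// ltW.
  apply: (ge0_ler_powR p0); rewrite ?nnegrE; last exact: (is_normD normN).
    exact: (is_norm_ge0 normN).
  by apply: addr_ge0; exact: (is_norm_ge0 normN).
- by move=> k x ix s y; rewrite ix.
- move=> k x D W k1 mx mD ix cD mW iW.
  by apply: (centered_jensen (ltW p1) k1).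
Defined.

End NormingFamily.

(** * The law of the samples *)

Section Cylinders.
Context d (S : measurableType d).

Definition cyl n (A : nat -> set S) : set (seqspace S) :=
  [set s | forall j, (j < n)%N -> A j (s j)].

Lemma measurable_cyl n A : (forall j, measurable (A j)) -> measurable (cyl n A).
Proof.
move=> mA; rewrite (_ : cyl n A = \bigcap_(j in [set j | (j < n)%N]) ((fun s : seqspace S => s j) @^-1` A j)).
  apply: bigcap_measurableType => j _.
  by rewrite -[X in measurable X]setTI; apply: measurable_coord.
by apply/seteqP; split=> s /= h j; exact: h.
Qed.

(** Rectangles are stable under intersection and generate the sigma-algebra. *)
Lemma cyl_measure_unique (R : realType) (m1 m2 : {measure set (seqspace S) -> \bar R}) :
  (m1 setT < +oo)%E ->
  (forall n A, (forall j, measurable (A j)) -> m1 (cyl n.+1 A) = m2 (cyl n.+1 A)) ->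
  forall X, measurable X -> m1 X = m2 X.
Proof.
move=> m1T h.
pose G := [set X : set (seqspace S) | exists n A, (forall j, measurable (A j)) /\ X = cyl n.+1 A].
have cylT n : cyl n (fun=> setT) = setT by apply/seteqP; split.
have GT : G setT by exists 0%N, (fun=> setT); split=> //; rewrite cylT.
have Gm : G `<=` measurable by move=> _ [n [A [mA ->]]]; exact: measurable_cyl.
have GI : setI_closed G.
  move=> _ _ [n [A [mA ->]]] [k [A' [mA' ->]]]; exists (maxn n k).
  exists (fun j => (if (j < n.+1)%N then A j else setT) `&` (if (j < k.+1)%N then A' j else setT)).
  split.
    by move=> j; apply: measurableI; case: ifP.
  apply/seteqP; split=> s /=.
    move=> [h1 h2] j _; split; case: ifP => // jn; [exact: h1|exact: h2].
  move=> hs; split=> j jn.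
    have [] := hs j; first by rewrite (leq_trans jn)// ltnS leq_maxl.
    by rewrite jn.
  have [] := hs j; first by rewrite (leq_trans jn)// ltnS leq_maxr.
  by rewrite jn.
have cylG : @cylinders _ S `<=` <<s G >>.
  move=> _ [k _ [A mA <-]]; apply: sub_sigma_algebra.
  exists k, (fun j => if j == k then A else setT); split.
    by move=> j; case: ifP.
  rewrite setTI; apply/seteqP; split=> s /=.
    by move=> hA j _; case: eqP => // ->.
  by move=> /(_ k (ltnSn k)); rewrite eqxx.
move=> X mX.
apply: (@g_sigma_algebra_measure_unique _ _ _ G Gm (fun=> setT)) => //.
- by rewrite bigcup_const//; exists 0%N.
- by move=> _ [n [A [mA ->]]]; exact: h.
- apply: smallest_sub mX => //; exact: smallest_sigma_algebra.
Qed.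

Definition relabel (sigma : nat -> nat) (s : seqspace S) : seqspace S := fun k => s (sigma k).

Lemma measurable_relabel sigma : measurable_fun [set: seqspace S] (relabel sigma).
Proof. by apply/measurable_seqP => k; exact: measurable_coord. Qed.

HB.instance Definition _ sigma := isMeasurableFun.Build _ _ (seqspace S) (seqspace S)
  (relabel sigma) (measurable_relabel sigma).

Lemma relabel_upd sigma s k y : injective sigma ->
  relabel sigma (upd s (sigma k) y) = upd (relabel sigma s) k y.
Proof.
by move=> inj; apply/funext => j; rewrite /relabel /upd (inj_eq inj).
Qed.

Lemma av_relabel (R : realType) (mu : probability S R) (sigma : nat -> nat) k
    (F : seqspace S -> \bar R) s : injective sigma ->
  av mu (sigma k) (F \o relabel sigma) s = av mu k F (relabel sigma s).
Proof.
by move=> inj; rewrite /av; apply: eq_integral => y _; rewrite /= relabel_upd.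
Qed.

Definition upd_pair k (z : seqspace S * S) : seqspace S := upd z.1 k z.2.

HB.instance Definition _ k := isMeasurableFun.Build _ _ (seqspace S * S)%type (seqspace S)
  (upd_pair k) (measurable_upd k).

End Cylinders.

Section IIDPath.
Context {R : realType} d (T : measurableType d) d' (S : measurableType d').
Context (P : probability T R) (xi : nat -> {RV P >-> S}).

(* The variable [xi 0], on which nothing is assumed, is replaced by a constant. *)
Definition xi_path (t : T) : seqspace S := fun k => if k is 0 then point else xi k t.

Lemma measurable_xi_path : measurable_fun [set: T] xi_path.
Proof.
apply/measurable_seqP => -[|k]; first exact: measurable_cst.
exact: measurable_funPT.
Qed.

HB.instance Definition _ := isMeasurableFun.Build _ _ T (seqspace S) xi_path measurable_xi_path.

Definition path_law : probability (seqspace S) R := distribution P xi_path.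
Definition xi_law : probability S R := distribution P (xi 1%N).

Hypothesis iid_xi : iid xi.
Local Open Scope ereal_scope.

Lemma independent_preimage (sigma : nat -> nat) n (A : nat -> set S) :
  injective sigma -> (forall j, (1 <= j)%N -> (1 <= sigma j)%N) -> (forall j, measurable (A j)) ->
  P [set t | forall j, (1 <= j < n)%N -> A j (xi (sigma j) t)] =
  \prod_(1 <= j < n) xi_law (A j).
Proof.
move=> inj sigma1 mA; have [indep_xi same_xi] := iid_xi.
(* Independence is stated for sets attached to the variables [xi k]: [A' k] is [A j] when
   [k = sigma j], and the whole space when [k] is not a value of [sigma]. *)
pose A' k := \bigcap_(j in [set j | sigma j = k]) A j.
have A'E j : A' (sigma j) = A j.
  by apply/seteqP; split=> x /= => [|Ax i /inj ->]; [exact|].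
have mA' k : measurable (A' k) by apply: bigcap_measurableType.
pose F : {fset nat} := [fset sigma j | j in index_iota 1 n]%fset.
have memF j : (1 <= j < n)%N -> sigma j \in F.
  by move=> jn; apply/imfsetP; exists j => //=; rewrite mem_index_iota.
have := indep_xi F A' _ mA'.
have -> : \bigcap_(i in [set` F]) xi i @^-1` A' i =
    [set t | forall j, (1 <= j < n)%N -> A j (xi (sigma j) t)].
  apply/seteqP; split=> t /=.
    by move=> h j /memF jF; have := h _ jF; rewrite /= A'E.
  move=> h _ /= /imfsetP[j /= + ->]; rewrite mem_index_iota => /h.
  by rewrite A'E.
move=> ->; last first.
  move=> _ /= /imfsetP[j /= + ->]; rewrite mem_index_iota => /andP[j1 _].
  exact: sigma1.
rewrite (perm_big (map sigma (index_iota 1 n)))/=; last first.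
  apply: uniq_perm; first exact: fset_uniq.
    by rewrite map_inj_uniq ?iota_uniq.
  move=> k; apply/imfsetP/mapP => -[j /= jn ->]; by exists j.
rewrite big_map big_nat_cond [RHS]big_nat_cond; apply: eq_bigr => j /andP[/andP[j1 _] _].
rewrite A'E; exact: (same_xi _ _ (sigma1 _ j1) (leqnn 1)).
Qed.

Lemma path_law_cyl (sigma : nat -> nat) n (A : nat -> set S) :
  injective sigma -> sigma 0%N = 0%N -> (forall j, measurable (A j)) ->
  path_law (relabel sigma @^-1` cyl n.+1 A) =
  (\1_(A 0%N) point)%:E * \prod_(1 <= j < n.+1) xi_law (A j).
Proof.
move=> inj s0 mA.
have sigma1 j : (1 <= j)%N -> (1 <= sigma j)%N.
  by case: j => // j _; rewrite lt0n -s0 (inj_eq inj).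
rewrite -(independent_preimage n.+1 inj sigma1 mA) indicE.
have [Ap|Ap] := boolP (point \in A 0%N); last first.
  rewrite mul0e -[RHS](measure0 P); congr (P _); apply/seteqP; split=> t //= h.
  have := h 0%N isT; rewrite /relabel s0/=; move: Ap; rewrite notin_setE; exact.
rewrite mul1e; congr (P _); apply/seteqP; split=> t /=.
  move=> h j /andP[j1 jn]; have := h j jn; rewrite /relabel/= /xi_path.
  by have := sigma1 _ j1; case: (sigma j).
move=> h [_|j jn]; rewrite /relabel /=.
  by rewrite s0 /=; exact: set_mem.
have := h j.+1 jn; rewrite /xi_path.
by have := sigma1 j.+1 isT; case: (sigma j.+1).
Qed.

Let path_law_fin : path_law setT < +oo.
Proof. by rewrite probability_setT ltry. Qed.

Lemma path_law_relabel (sigma : nat -> nat) (F : seqspace S -> \bar R) :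
  injective sigma -> sigma 0%N = 0%N -> nnmeas F ->
  \int[path_law]_s F (relabel sigma s) = \int[path_law]_s F s.
Proof.
move=> inj s0 [mF F0].
rewrite -(@ge0_integral_distribution _ _ _ _ _ path_law (relabel sigma) F)//.
apply: eq_measure_integral => X mX _; apply/esym.
apply: (cyl_measure_unique path_law_fin) => // n A mA.
apply/esym; rewrite [LHS](path_law_cyl n inj s0 mA).
have := @path_law_cyl id n A (@inj_id nat) erefl mA.
by rewrite (_ : relabel id @^-1` cyl n.+1 A = cyl n.+1 A)// => ->.
Qed.

Lemma path_law_resampling : resampling xi_law path_law.
Proof.
move=> k F k1 [mF F0].
pose PP := path_law \x xi_law.
have mpush : measurable_fun setT (F \o upd_pair k).
  by apply: (measurableT_comp mF); exact: measurable_upd.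
transitivity (\int[PP]_z F (upd_pair k z)); last first.
  rewrite (@fubini_tonelli1 _ _ _ _ R path_law xi_law (F \o upd_pair k))//.
  by move=> z; exact: F0.
have PPT : PP setT = 1.
  rewrite -setXTT [LHS]product_measure1E// ![X in X * _]probability_setT mul1e.
  exact: probability_setT.
transitivity (\int[pushforward PP (upd_pair k)]_s F s); last first.
  by rewrite ge0_integral_pushforward.
apply: eq_measure_integral => X mX _.
apply: (cyl_measure_unique path_law_fin) => // n A mA.
have cylid A' : (forall j, measurable (A' j)) -> path_law (cyl n.+1 A') =
    (\1_(A' 0%N) point)%:E * \prod_(1 <= j < n.+1) xi_law (A' j).
  by move=> mA'; rewrite -(@path_law_cyl id).
(* After the update, the constraint on coordinate [k] bears on the new sample, so it is lifted from
   the old sequence. *)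
pose A' j := if j == k then setT else A j.
have mA' j : measurable (A' j) by rewrite /A'; case: ifP.
have A'0 : A' 0%N = A 0%N by rewrite /A' eq_sym gtn_eqF.
transitivity (path_law (cyl n.+1 A') * xi_law (if (k < n.+1)%N then A k else setT)); last first.
  rewrite -product_measure1E; [|exact: measurable_cyl|by case: ifP].
  rewrite -[RHS]/(PP (upd_pair k @^-1` cyl n.+1 A)); congr (PP _); apply/seteqP; split=> -[s y] /=; rewrite /upd_pair /upd/=.
    move=> [h1 h2] j jn; have := h1 j jn; rewrite /A'/=; case: eqP => // jk _.
    by move: h2; rewrite -jk jn.
  move=> h; split=> [j jn|].
    by rewrite /A'; have := h j jn; rewrite /=; case: eqP.
  by case: ifP => // kn; have := h k kn; rewrite /= eqxx.
transitivity ((\1_(A 0%N) point)%:E * \prod_(1 <= j < n.+1) xi_law (A j)); first exact: cylid.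
transitivity ((\1_(A' 0%N) point)%:E * \prod_(1 <= j < n.+1) xi_law (A' j) *
    xi_law (if (k < n.+1)%N then A k else setT)); last by congr (_ * _); exact/esym/cylid.
rewrite A'0 -muleA; congr (_ * _).
case: ifPn => kn.
  rewrite (bigD1_seq k) ?iota_uniq ?mem_index_iota ?k1//=.
  rewrite [in RHS](bigD1_seq k) ?iota_uniq ?mem_index_iota ?k1//=.
  have -> : A' k = setT by rewrite /A' eqxx.
  rewrite [X in _ = X * _ * _](_ : _ = 1); last exact: (probability_setT xi_law).
  rewrite mul1e muleC; congr (_ * _).
  by apply: eq_bigr => j /negbTE jk; rewrite /A' jk.
rewrite [X in _ = _ * X](_ : _ = 1) ?mule1; last exact: (probability_setT xi_law).
rewrite big_nat_cond [RHS]big_nat_cond; apply: eq_bigr => j /andP[/andP[_ jn] _].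
by rewrite /A'; case: eqP => // jk; move: kn; rewrite -jk jn.
Qed.

Lemma integral_path_law F : nnmeas F -> \int[path_law]_s F s = \int[P]_t F (xi_path t).
Proof. by move=> [mF F0]; rewrite -(@ge0_integral_distribution _ _ _ _ _ P xi_path F). Qed.

Lemma ae_relabel (sigma : nat -> nat) (A : set (seqspace S)) :
  injective sigma -> sigma 0%N = 0%N -> {ae path_law, forall s, A s} ->
  {ae path_law, forall s, A (relabel sigma s)}.
Proof.
move=> inj s0 [N [mN N0 AN]]; exists (relabel sigma @^-1` N); split.
- by rewrite -[X in measurable X]setTI; apply: measurable_relabel.
- have mI := @nnmeas_indic R _ _ _ mN.
  have := path_law_relabel inj s0 mI.
  rewrite [X in _ = X -> _](_ : _ = 0); last by rewrite integral_indic// setIT.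
  have mN' : measurable (relabel sigma @^-1` N).
    by rewrite -[X in measurable X]setTI; apply: measurable_relabel.
  have <- : \int[path_law]_s (\1_(relabel sigma @^-1` N) s)%:E =
      path_law (relabel sigma @^-1` N) by rewrite integral_indic// setIT.
  exact.
- by move=> s /= As; apply: AN.
Qed.

End IIDPath.

(** * Bochner integrals *)

Section SimpleFunctions.
Context {R : realType} (B : normedModType R) d (T : measurableType d) (P : probability T R).
Implicit Types (s : T -> B) (A : set T).

Lemma simple_measurable_preimage s (D : set B) : simple_fun s -> measurable (s @^-1` D).
Proof.
move=> [fs ms].
have -> : s @^-1` D = \bigcup_(y in range s `&` D) s @^-1` [set y].
  apply/seteqP; split=> t /=; first by move=> Dst; exists (s t).
  by move=> [y [_ Dy] /= ->].
by apply: fin_bigcup_measurable => //; exact: finite_setIl.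
Qed.

Lemma simple_comp_measurable s (g : B -> R) : simple_fun s ->
  measurable_fun [set: T] (fun t => g (s t)).
Proof.
move=> ss _ D mD; rewrite setTI.
by rewrite -[X in measurable X]/(s @^-1` (g @^-1` D)); exact: simple_measurable_preimage.
Qed.

Lemma simple_comp_integrable s (g : B -> R) A : measurable A -> simple_fun s ->
  P.-integrable A (fun t => (g (s t))%:E).
Proof.
move=> mA ss; have [fs _] := ss.
apply: (@measurable_bounded_integrable _ _ _ P (fun t => g (s t))) => //.
- by rewrite (le_lt_trans (probability_le1 _ mA))// ltry.
- exact: measurable_funTS (simple_comp_measurable g ss).
have fgs : finite_set ((fun y => `|g y|) @` range s) by exact: finite_image.
have /finite_seqP[r rE] := fgs.
(* The sum of the finitely many absolute values taken by [g] dominates each of them. *)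
exists (\sum_(x <- r) x); split; first exact: num_real.
move=> x xM t _; apply: le_trans (ltW xM).
have : `|g (s t)| \in r.
  have : ((fun y => `|g y|) @` range s) `|g (s t)| by exists (s t) => //; exists t.
  by rewrite rE.
have r0 z : z \in r -> 0 <= z.
  move=> zr; have : [set` r] z by [].
  by rewrite -rE => -[y _ <-].
move=> hr; rewrite (perm_big _ (perm_to_rem hr)) big_cons lerDl big_seq.
by apply: sumr_ge0 => z /mem_rem; exact: r0.
Qed.

Lemma simple_integral_functional s (phi : B -> R) A : measurable A -> simple_fun s ->
  (forall x y, phi (x + y) = phi x + phi y) -> (forall a x, phi (a *: x) = a * phi x) ->
  (\int[P]_(t in A) (phi (s t))%:E = (phi (simple_integral P A s))%:E)%E.
Proof.
move=> mA ss phiD phiZ; have [fs ms] := ss.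
have phi0 : phi 0 = 0 by rewrite -(scale0r (0 : B)) phiZ mul0r.
have phi_sum (r : seq B) (F : B -> B) : phi (\sum_(y <- r) F y) = \sum_(y <- r) phi (F y).
  by elim: r => [|y r IH]; rewrite ?big_nil// !big_cons phiD IH.
pose r := fset_set (range s).
have sE t : (phi (s t))%:E = (\sum_(y <- r) ((phi y)%:E * (\1_(s @^-1` [set y]) t)%:E))%E.
  have str : s t \in r by rewrite in_fset_set// inE; exists t.
  rewrite (bigD1_seq (s t)) ?fset_uniq//= big1 ?adde0; last first.
    move=> y yst; rewrite indicE memNset ?mule0//=.
    by apply/eqP; rewrite eq_sym.
  by rewrite indicE mem_set// mule1.
under eq_integral do rewrite sE.
have iI y : P.-integrable A (fun t => (\1_(s @^-1` [set y]) t)%:E).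
  pose g (z : B) : R := (z == y)%:R.
  rewrite (_ : (fun _ => _) = fun t => (g (s t))%:E); first exact: simple_comp_integrable.
  apply/funext => t; rewrite /g indicE; have [sty|/eqP sty] := eqVneq (s t) y.
    by rewrite mem_set.
  by rewrite memNset.
rewrite integral_sum//; last by move=> y; exact: integrableZl.
rewrite /simple_integral fsbig_finite// phi_sum -sumEFin.
apply: eq_bigr => y _; rewrite integralZl// integral_indic// phiZ setIC EFinM.
by rewrite muleC fineK// fin_num_measure//; exact: measurableI.
Qed.

End SimpleFunctions.

Section BochnerZeroMean.
Context {R : realType} (B : completeNormedModType R) (e : nat -> B) (N : B -> R) (c L : R)
  (phi : nat -> B -> R).
Hypothesis dense_e : forall x (eps : R), 0 < eps -> exists n, `|x - e n| < eps.
Hypothesis normN : is_norm N.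
Hypothesis c0 : 0 < c.
Hypothesis L0 : 0 <= L.
Hypothesis cN : forall x, c * `|x| <= N x.
Hypothesis NL : forall x, N x <= L * `|x|.
Hypothesis normingN : norming N phi.
Context d (T : measurableType d) (P : probability T R).
Implicit Types (A : set T) (X : T -> B).
Local Notation phi_norm := (norming_fun_norm NL normingN).

Lemma simple_smeas (s : T -> B) : simple_fun s -> smeas s.
Proof. by move=> ss b; exact: (simple_comp_measurable (fun y => `|y - b|) ss). Qed.

Lemma smeas_norm X : smeas X -> nnmeas (fun t => (`|X t|)%:E).
Proof.
move=> mX; split=> [|t]; last by rewrite lee_fin.
by apply/measurable_EFinP; have := mX 0; under eq_fun do rewrite subr0.
Qed.

Lemma bochner_norm_integrable X : smeas X -> bochner_integrable P X ->
  (\int[P]_t (`|X t|)%:E < +oo)%E.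
Proof.
move=> mX [_ [s [ss /fine_cvgP[fin _]]]].
have [n _ /(_ n (leqnn n)) /= fin_n] := fin.
have msn := simple_smeas (ss n).
apply: (@le_lt_trans _ _ (\int[P]_t ((`|X t - s n t|)%:E + (`|s n t|)%:E))%E).
  apply: nnint_le => [||t]; [exact: smeas_norm| |].
    by apply: nnmeasD; apply: smeas_norm => //; exact: (smeasB dense_e).
  by rewrite -EFinD lee_fin -[X in `|X| <= _](subrK (s n t)) ler_normD.
rewrite nnintD; [|exact/smeas_norm/(smeasB dense_e)|exact: smeas_norm].
apply: lte_add_pinfty; first by move: fin_n; rewrite fin_numE => /andP[_]; rewrite ltey.
by apply: integrable_lty => //; exact: (simple_comp_integrable P (fun y => `|y|) measurableT (ss n)).
Qed.

Lemma norming_fun_integrable X n A : measurable A -> smeas X -> bochner_integrable P X ->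
  P.-integrable A (fun t => (phi n (X t))%:E).
Proof.
move=> mA mX bX; apply: (integrableS measurableT mA (@subsetT _ A)).
apply/integrableP; split.
  by apply/measurable_EFinP; exact: (measurable_norming dense_e L0 NL normingN).
apply: (@le_lt_trans _ _ (\int[P]_t (L%:E * (`|X t|)%:E))%E).
  apply: nnint_le => [||t]; last by rewrite abse_EFin -EFinM lee_fin phi_norm.
    split=> [|t]; last by rewrite lee_fin.
    apply/measurable_EFinP; apply: (measurableT_comp (@normr_measurable R setT)).
    exact: (measurable_norming dense_e L0 NL normingN).
  by apply: nnmeasZ => //; exact: smeas_norm.
rewrite nnintZ//; last exact: smeas_norm.
by apply: lte_mul_pinfty; rewrite ?lee_fin//; exact: bochner_norm_integrable.
Qed.

Lemma functional_simple_approx X n A (s : T -> B) : measurable A -> smeas X ->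
  bochner_integrable P X -> simple_fun s ->
  (`| \int[P]_(t in A) (phi n (X t))%:E - (phi n (simple_integral P A s))%:E |
   <= L%:E * \int[P]_(t in A) (`|X t - s t|)%:E)%E.
Proof.
move=> mA mX bX ss; have [phiD phiZ _ _] := normingN.
have ms := simple_smeas ss; have mXs := smeasB dense_e mX ms.
rewrite -(simple_integral_functional P mA ss (phiD n) (phiZ n)).
have iX := norming_fun_integrable n mA mX bX.
have is_ := simple_comp_integrable P (phi n) mA ss.
rewrite -integralB//.
have E t : ((phi n (X t))%:E - (phi n (s t))%:E = (phi n (X t - s t))%:E)%E.
  by rewrite (norming_funB normingN) EFinB.
under eq_integral do rewrite E.
have mphi : measurable_fun A (fun t => (phi n (X t - s t))%:E).
  apply: measurable_funTS; apply/measurable_EFinP.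
  exact: (measurable_norming dense_e L0 NL normingN).
apply: le_trans (le_abse_integral _ mA mphi) _.
have [mn n0] := smeas_norm mXs.
rewrite -ge0_integralZl_EFin//; last exact: measurable_funTS.
apply: ge0_le_integral => //.
- exact: measurableT_comp.
- by apply: measurable_funeM; exact: measurable_funTS.
- by move=> t _; rewrite abse_EFin -EFinM lee_fin phi_norm.
Qed.

Lemma norm_le_norming b (M : R) : (forall n, phi n b <= M) -> N b <= M.
Proof.
move=> h; rewrite leNgt; apply/negP => Mb.
by have [_ _ _ /(_ _ _ Mb)[n]] := normingN; rewrite ltNge h.
Qed.

Lemma simple_approx_fin X A (s : nat -> T -> B) : simple_approx P A X s ->
  exists2 del : nat -> R, del n @[n --> \oo] --> 0 &
  \forall n \near \oo, (\int[P]_(t in A) (`|X t - s n t|)%:E = (del n)%:E)%E.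
Proof.
move=> [_ /fine_cvgP[fin cvg0]].
exists (fun n => fine (\int[P]_(t in A) (`|X t - s n t|)%:E)%E) => //.
by apply: filterS fin => n fn; rewrite fineK.
Qed.

(** Guarantees that [bochner_integral] is a limit and not the default of [xget]. The integrals of
    the approximations are Cauchy because each norming functional sends them close to the same
    scalar integral; completeness concludes. *)
Lemma bochner_integral_spec X A : measurable A -> smeas X -> bochner_integrable P X ->
  exists s, simple_approx P A X s /\
    simple_integral P A (s n) @[n --> \oo] --> bochner_integral P A X.
Proof.
move=> mA mX bX; have [_ [s [ss sX]]] := bX.
have sA : simple_approx P A X s.
  split=> //; apply: (squeeze_cvge _ (@cvg_cst _ _ _ _ _) sX); apply: nearW => n.
  have [mn n0] := smeas_norm (smeasB dense_e mX (simple_smeas (ss n))).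
  rewrite integral_ge0/=; last by move=> t _; exact: n0.
  by apply: ge0_subset_integral => // t _; exact: n0.
have [del del0 delE] := simple_approx_fin sA.
pose I n := simple_integral P A (s n).
have cI : cvgn I.
  apply: cauchy_cvg; apply/cauchy_ballP => eps eps0.
  have L10 : 0 < L + 1 by rewrite ltr_wpDl.
  (* Makes [2 * L * eta / c] smaller than [eps], including when [L = 0]. *)
  pose eta := c * eps / (2 * (L + 1)).
  have eta0 : 0 < eta by rewrite !mulr_gt0// invr_gt0 mulr_gt0.
  have [n1 _ h1] : \forall n \near \oo, `|del n| < eta.
    by have /cvgrPdist_lt/(_ _ eta0) := del0; apply: filterS => n; rewrite sub0r normrN.
  have [n2 _ h2] := delE.
  pose D := [set n | (maxn n1 n2 <= n)%N].
  have D_oo : \forall n \near \oo, D n by exists (maxn n1 n2).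
  exists (I @` D, I @` D) => /=.
    by split; apply: filterS D_oo => n Dn; exists n.
  move=> [_ _] /= [[n Dn <-] [k Dk <-]].
  have dn q : D q -> (\int[P]_(t in A) (`|X t - s q t|)%:E <= eta%:E)%E.
    rewrite /D/= geq_max => /andP[q1 q2]; rewrite (h2 q q2) lee_fin.
    by rewrite (le_trans (ler_norm _))// ltW// h1.
  have key j q : D q -> `|fine (\int[P]_(t in A) (phi j (X t))%:E)%E - phi j (I q)| <= L * eta.
    move=> Dq; have := functional_simple_approx j mA mX bX (ss q).
    have iX := norming_fun_integrable j mA mX bX.
    rewrite -[X in `|X - _|%E]fineK; last exact: integrable_fin_num.
    rewrite -EFinB abse_EFin => /le_trans.
    move=> /(_ _ (lee_wpmul2l (_ : 0 <= L%:E)%E (dn q Dq))); rewrite lee_fin => /(_ L0).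
    by rewrite -EFinM lee_fin.
  have NI : N (I n - I k) <= 2 * L * eta.
    apply: norm_le_norming => j; rewrite (norming_funB normingN).
    have := key j n Dn; have := key j k Dk; rewrite !ler_norml => /andP[? ?] /andP[? ?]; lra.
  rewrite -ball_normE /=; have := le_trans (cN (I n - I k)) NI.
  rewrite mulrC -ler_pdivlMr// => /le_lt_trans; apply.
  rewrite ltr_pdivrMr// /eta.
  have -> : 2 * L * (c * eps / (2 * (L + 1))) = (L / (L + 1)) * (eps * c).
    by field; rewrite gt_eqF.
  rewrite gtr_pMl ?mulr_gt0// ltr_pdivrMr// mul1r; lra.
pose V := [set v : B | exists s', simple_approx P A X s' /\
  (fun n => simple_integral P A (s' n)) @ \oo --> v].
have /(xgetPex (0 : B))[s' hs'] : exists v, V v by exists (limn I), s.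
by exists s'.
Qed.


(** This exchange reduces vector-valued degeneracy to countably many scalar statements. *)
Lemma functional_bochner X A n : measurable A -> smeas X -> bochner_integrable P X ->
  (\int[P]_(t in A) (phi n (X t))%:E = (phi n (bochner_integral P A X))%:E)%E.
Proof.
move=> mA mX bX; have [s [sA sI]] := bochner_integral_spec mA mX bX.
have [ss _] := sA; have [del del0 [n0 _ delE]] := simple_approx_fin sA.
have iX := norming_fun_integrable n mA mX bX.
have fX := integrable_fin_num mA iX.
have [x xE] : exists x, (\int[P]_(t in A) (phi n (X t))%:E = x%:E)%E.
  by exists (fine (\int[P]_(t in A) (phi n (X t))%:E)%E); rewrite fineK.
rewrite xE; congr (_%:E); set v := bochner_integral P A X in sI *.
apply/eqP; rewrite -subr_eq0 -normr_le0; apply/ler_addgt0Pr => eps eps0; rewrite add0r.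
have L10 : 0 < L + 1 by rewrite ltr_wpDl.
pose eta := eps / (2 * (L + 1)).
have eta0 : 0 < eta by rewrite mulr_gt0// invr_gt0 mulr_gt0.
have [n1 _ h1] : \forall n \near \oo, `|del n| < eta.
  by have /cvgrPdist_lt/(_ _ eta0) := del0; apply: filterS => k; rewrite sub0r normrN.
have [n2 _ h2] : \forall n \near \oo, `|v - simple_integral P A (s n)| < eta.
  by have /cvgrPdist_lt/(_ _ eta0) := sI.
pose k := maxn n0 (maxn n1 n2).
have := functional_simple_approx n mA mX bX (ss k).
rewrite xE delE; last by rewrite /= /k leq_maxl.
rewrite -EFinB abse_EFin -EFinM lee_fin.
have dk : del k <= eta.
  by rewrite (le_trans (ler_norm _))// ltW// h1//= /k maxnCA leq_maxl.
have vk : `|v - simple_integral P A (s k)| <= eta.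
  by rewrite ltW// h2//= /k maxnA leq_maxr.
move=> hk; have -> : x - phi n v = (x - phi n (simple_integral P A (s k))) -
    phi n (v - simple_integral P A (s k)) by rewrite (norming_funB normingN); ring.
apply: le_trans (ler_normB _ _) _.
have h3 := le_trans (phi_norm n (v - simple_integral P A (s k))) (ler_wpM2l L0 vk).
have h4 := le_trans hk (ler_wpM2l L0 dk).
apply: le_trans (lerD h4 h3) _.
have -> : L * eta + L * eta = (L / (L + 1)) * eps.
  by rewrite /eta; field; rewrite gt_eqF.
by rewrite ger_pMl// ler_pdivrMr// mul1r lerDl.
Qed.

End BochnerZeroMean.

(** * Conditional expectations *)

Section Dependence.
Context {R : realType} d (S : measurableType d) (mu : probability S R).
Implicit Types (D : pred nat) (ks : seq nat).

Definition depends_on (D : pred nat) (U : Type) (F : seqspace S -> U) :=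
  forall s s', (forall k, D k -> s k = s' k) -> F s = F s'.

Lemma depends_on_sub D D' U (F : seqspace S -> U) :
  (forall k, D k -> D' k) -> depends_on D F -> depends_on D' F.
Proof. by move=> DD' hF s s' ss'; apply: hF => k /DD'; exact: ss'. Qed.

Lemma depends_on_indep D k U (F : seqspace S -> U) : ~~ D k -> depends_on D F -> indep k F.
Proof.
move=> Dk hF s y; apply: hF => j Dj; rewrite /upd; case: eqP => // jk.
by move: Dk; rewrite -jk Dj.
Qed.

Lemma depends_on_av D k (F : seqspace S -> \bar R) : depends_on D F ->
  depends_on [pred j | D j && (j != k)] (av mu k F).
Proof.
move=> hF s s' ss'; apply: eq_integral => y _; apply: hF => j Dj; rewrite /upd.
by case: eqP => // /eqP jk; apply: ss'; rewrite /= Dj.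
Qed.

Definition avs ks (F : seqspace S -> \bar R) := foldl (fun F k => av mu k F) F ks.

Lemma nnmeas_avs ks F : nnmeas F -> nnmeas (avs ks F).
Proof. by elim: ks F => [|k ks IH] F mF //=; exact/IH/nnmeas_av. Qed.

Lemma depends_on_avs D ks F : depends_on D F ->
  depends_on [pred j | D j && (j \notin ks)] (avs ks F).
Proof.
elim: ks D F => [|k ks IH] D F hF /=.
  by apply: depends_on_sub hF => j /= ->.
apply: depends_on_sub (IH _ _ (@depends_on_av D k F hF)) => j /=.
by rewrite inE negb_or -andbA.
Qed.

Lemma avs_le ks F G s : nnmeas F -> nnmeas G -> (forall s, (F s <= G s)%E) ->
  (avs ks F s <= avs ks G s)%E.
Proof.
elim: ks F G => [|k ks IH] F G mF mG FG //=.
by apply: IH => [||t]; [exact: nnmeas_av|exact: nnmeas_av|exact: av_le].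
Qed.

Lemma avs_sum ks (I : Type) (r : seq I) (q : pred I) (F : I -> seqspace S -> \bar R) s :
  (forall i, nnmeas (F i)) ->
  (avs ks (fun t => \sum_(i <- r | q i) F i t) s = \sum_(i <- r | q i) avs ks (F i) s)%E.
Proof.
elim: ks F => [|k ks IH] F mF //=; rewrite -IH; last by move=> i; exact: nnmeas_av.
congr (avs ks _ s); apply/funext => t; rewrite /av nnint_sum// => i _.
exact: nnmeas_updr.
Qed.

Lemma avs_relabel (sigma : nat -> nat) ks F s : injective sigma ->
  avs (map sigma ks) (F \o relabel sigma) s = avs ks F (relabel sigma s).
Proof.
move=> inj; elim: ks F => [|k ks IH] F //=; rewrite -IH; congr (avs _ _ s).
by apply/funext => t /=; rewrite av_relabel.
Qed.

Context (Q : probability (seqspace S) R) (resQ : resampling mu Q).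

(** The weight is its own average over each coordinate in [ks]. *)
Lemma avs_adjoint ks F W : all (leq 1) ks -> nnmeas F -> nnmeas W ->
  (forall k, k \in ks -> indep k W) ->
  (\int[Q]_s (W s * avs ks F s) = \int[Q]_s (W s * F s))%E.
Proof.
move=> + + mW; elim: ks F => [|k ks IH] F //= /andP[k1 hks] mF iW.
rewrite IH//; [|exact: nnmeas_av|by move=> j jks; apply: iW; rewrite inE jks orbT].
rewrite (av_adjoint resQ k1 mF mW); apply: eq_integral => s _.
by rewrite av_indep//; apply: iW; rewrite inE eqxx.
Qed.

Lemma avs_cst ks D F s : all (leq 1) ks -> nnmeas F -> depends_on D F -> {subset D <= ks} ->
  avs ks F s = (\int[Q]_t F t)%E.
Proof.
move=> ks1 mF hF Dks.
have const t : avs ks F t = avs ks F s.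
  by apply: (depends_on_avs (ks := ks) hF) => k /= /andP[/Dks ->].
have := @avs_adjoint ks F (cst 1%E) ks1 mF (nnmeas_cst _ ler01) (fun _ _ _ _ => erefl).
under eq_integral do rewrite mul1e const.
under [in RHS]eq_integral do rewrite mul1e.
move=> <-; transitivity (avs ks F s * Q setT)%E; last exact/esym/integral_cst.
by rewrite probability_setT mule1.
Qed.

End Dependence.

Section Conditioning.
Context {R : realType} d (T : measurableType d) d' (S : measurableType d').
Context (P : probability T R) (xi : nat -> {RV P >-> S}) (m : nat).
Implicit Types J : {set 'I_m}.

Definition slots J : pred nat := fun k => [exists j in J, k == j.+1].

Lemma sigma_xi_measurable J A : sigma_xi xi J A -> measurable A.
Proof.
apply: smallest_sub; first exact: sigma_algebra_measurable.
move=> _ [j _ [B mB <-]]; rewrite setTI -[X in measurable X]setTI.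
exact: measurable_funPT.
Qed.

Lemma sigma_xi_path J (A : set (seqspace S)) : measurable A -> depends_on (slots J) A ->
  sigma_xi xi J (xi_path xi @^-1` A).
Proof.
move=> mA hA.
pose T' := g_sigma_algebraType
  (\bigcup_(j in [set` J]) preimage_set_system setT (xi (j : nat).+1) measurable).
(* Replacing the coordinates outside [J] by a constant gives a map measurable for the small
   sigma-algebra, and [A] does not see the difference. *)
pose r (t : T') : seqspace S := fun k => if slots J k then xi_path xi t k else point.
have mr : measurable_fun [set: T'] r.
  apply/measurable_seqP => k; rewrite /r; have [|_] := boolP (slots J k); last exact: measurable_cst.
  move=> /existsP[j /andP[jJ /eqP ->]] _ B mB; rewrite setTI; apply: sub_sigma_algebra.
  by exists j => //; exists B => //; rewrite setTI.
have -> : xi_path xi @^-1` A = r @^-1` A.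
  apply/seteqP; split=> t /=; rewrite (hA _ (r t))// => k Jk; by rewrite /r Jk.
by have := mr measurableT _ mA; rewrite setTI.
Qed.

(** The sets of this form are a sigma-algebra containing the generators. *)
Lemma sigma_xi_preimage J A : sigma_xi xi J A ->
  exists A', [/\ measurable A', depends_on (slots J) A' & A = xi_path xi @^-1` A'].
Proof.
apply: (@smallest_sub _ _ _
  [set A | exists A', [/\ measurable A', depends_on (slots J) A' & A = xi_path xi @^-1` A']]).
  split=> [|B [A' [mA' hA' ->]]|F hF].
  - by exists set0; split.
  - exists (~` A'); split; first exact: measurableC.
      by move=> s s' /hA' As; rewrite /setC/= As.
    by rewrite setTD.
  - have {}hF n := cid (hF n); exists (\bigcup_n projT1 (hF n)); split.
    + by apply: bigcup_measurable => n _; case: (projT2 (hF n)).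
    + move=> s s' ss'; apply/propext; split=> -[n _ h]; exists n => //;
        case: (projT2 (hF n)) => _ /(_ s s' ss') E _; by rewrite ?E -?E in h *.
    + rewrite preimage_bigcup; apply: eq_bigcupr => n _.
      by case: (projT2 (hF n)).
move=> _ [j /= jJ [B mB <-]]; exists ((fun s : seqspace S => s j.+1) @^-1` B); split.
- by rewrite -[X in measurable X]setTI; apply: measurable_coord.
- move=> s s' ss' /=; rewrite /preimage/= ss'//; apply/existsP; exists j.
  by rewrite jJ eqxx.
- by rewrite setTI.
Qed.

Local Open Scope ereal_scope.

Lemma is_cond_expectation_nnmeas J X Y : is_cond_expectation P (sigma_xi xi J) X Y -> nnmeas Y.
Proof.
move=> [mY Y0 _]; split=> // _ A mA; rewrite setTI.
by apply: (@sigma_xi_measurable J); exact: mY.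
Qed.

(** Both versions are measurable for the small sigma-algebra, so the set where [Y2 < Y1] is one of
    the events on which their integrals agree. *)
Lemma cond_expectation_ae_le J X Y1 Y2 : \int[P]_t X t < +oo ->
  is_cond_expectation P (sigma_xi xi J) X Y1 -> is_cond_expectation P (sigma_xi xi J) X Y2 ->
  {ae P, forall t, Y1 t <= Y2 t}.
Proof.
move=> Xoo c1 c2; have m1 := is_cond_expectation_nnmeas c1; have m2 := is_cond_expectation_nnmeas c2.
have [s1 _ I1] := c1; have [s2 _ I2] := c2.
have [g0 gC _] := smallest_sigma_algebra setT
  (\bigcup_(j in [set` J]) preimage_set_system setT (xi (j : nat).+1) measurable).
have sT : sigma_xi xi J setT by have := gC _ g0; rewrite setD0.
apply: ae_le_of_integral => //; last by rewrite I2.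
rewrite I1 ?I2//.
all: pose T' := g_sigma_algebraType
  (\bigcup_(j in [set` J]) preimage_set_system setT (xi (j : nat).+1) measurable).
all: have m1' : measurable_fun [set: T'] Y1 by move=> _ A mA; rewrite setTI; exact: s1.
all: have m2' : measurable_fun [set: T'] Y2 by move=> _ A mA; rewrite setTI; exact: s2.
all: by have := emeasurable_fun_lt (@measurableT _ T') m2' m1'; rewrite setTI.
Qed.

Hypothesis iid_xi : iid xi.
Let mu := xi_law xi.
Let Q := path_law xi.

Lemma integral_path_preimage A' (G : seqspace S -> \bar R) : measurable A' -> nnmeas G ->
  \int[P]_(t in xi_path xi @^-1` A') G (xi_path xi t) = \int[Q]_s ((\1_A' s)%:E * G s).
Proof.
move=> mA' mG; have mI := nnmeas_indic (R := R) mA'.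
rewrite integral_path_law//; last exact: nnmeasM.
rewrite integral_mkcond; apply: eq_integral => t _.
rewrite patchE indicE; have -> : (t \in xi_path xi @^-1` A') = (xi_path xi t \in A') by [].
by case: ifP => _; rewrite ?mul1e ?mul0e.
Qed.

(** By independence, integrating out the samples outside [J] gives an explicit version; hence
    [cond_expectation] is a genuine version here and not the default of [xget]. *)
Lemma avs_cond_expectation J ks (F : seqspace S -> \bar R) D :
  all (leq 1) ks -> nnmeas F -> depends_on D F ->
  (forall k, D k -> k \notin ks -> slots J k) -> (forall k, k \in ks -> ~~ slots J k) ->
  is_cond_expectation P (sigma_xi xi J) (F \o xi_path xi) (avs mu ks F \o xi_path xi).
Proof.
move=> ks1 mF hF DJ ksJ; have mY := nnmeas_avs mu ks mF.
have hY : depends_on (slots J) (avs mu ks F).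
  by apply: depends_on_sub (@depends_on_avs _ _ _ mu D ks F hF) => k /= /andP[Dk]; exact: DJ.
split=> [A mA|t|A].
- apply: (@sigma_xi_path J (avs mu ks F @^-1` A)); last first.
    by move=> s s' ss'; rewrite /preimage /= (hY s s').
  by rewrite -[X in measurable X]setTI; apply: mY.1.
- exact: (nnmeas_ge0 (xi_path xi t) mY).
- move=> /sigma_xi_preimage[A' [mA' hA' ->]].
  rewrite !integral_path_preimage//; apply: avs_adjoint => //; first exact: path_law_resampling.
    exact: nnmeas_indic.
  move=> k kks s y; rewrite !indicE; congr (_%:R%:E); congr nat_of_bool.
  apply: (depends_on_indep (ksJ k kks)) => s1 s2 /hA' E.
  by apply/idP/idP; rewrite !inE E.
Qed.

Lemma cond_expectationP J X Y : is_cond_expectation P (sigma_xi xi J) X Y ->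
  is_cond_expectation P (sigma_xi xi J) X (cond_expectation P (sigma_xi xi J) X).
Proof.
move=> cY; apply: (@xgetPex _ (cst 0) [set Z | is_cond_expectation P (sigma_xi xi J) X Z]).
by exists Y.
Qed.

Lemma cond_expectation_avs J ks F D :
  all (leq 1) ks -> nnmeas F -> depends_on D F ->
  (forall k, D k -> k \notin ks -> slots J k) -> (forall k, k \in ks -> ~~ slots J k) ->
  \int[Q]_s F s < +oo ->
  {ae P, forall t, avs mu ks F (xi_path xi t) <=
    cond_expectation P (sigma_xi xi J) (F \o xi_path xi) t}.
Proof.
move=> ks1 mF hF DJ ksJ Foo; have c1 := avs_cond_expectation ks1 mF hF DJ ksJ.
apply: (cond_expectation_ae_le _ c1 (cond_expectationP c1)).
by move: Foo; rewrite /Q integral_path_law.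
Qed.

Lemma nnmeas_cond_expectation J ks F D :
  all (leq 1) ks -> nnmeas F -> depends_on D F ->
  (forall k, D k -> k \notin ks -> slots J k) -> (forall k, k \in ks -> ~~ slots J k) ->
  nnmeas (cond_expectation P (sigma_xi xi J) (F \o xi_path xi)).
Proof.
move=> ks1 mF hF DJ ksJ; have c1 := avs_cond_expectation ks1 mF hF DJ ksJ.
exact: is_cond_expectation_nnmeas (cond_expectationP c1).
Qed.

End Conditioning.

Section ZeroMean.
Context {R : realType} (B : completeNormedModType R) (e : nat -> B) (N : B -> R) (c L : R)
  (phi : nat -> B -> R).
Hypothesis dense_e : forall x (eps : R), 0 < eps -> exists n, `|x - e n| < eps.
Hypothesis c0 : 0 < c.
Hypothesis L0 : 0 <= L.
Hypothesis cN : forall x, c * `|x| <= N x.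
Hypothesis NL : forall x, N x <= L * `|x|.
Hypothesis normingN : norming N phi.
Context d (T : measurableType d) d' (S : measurableType d').
Context (P : probability T R) (xi : nat -> {RV P >-> S}) (m : nat).
Hypothesis iid_xi : iid xi.
Let mu := xi_law xi.
Let Q := path_law xi.
Let resQ : resampling mu Q := path_law_resampling iid_xi.

Definition on_slots (h : m.-tuple S -> B) (s : seqspace S) : B := h [tuple s j.+1 | j < m].

Lemma funepos_compE U V (f : V -> \bar R) (g : U -> V) t : (f^\+ (g t) = (f \o g)^\+ t)%E.
Proof. by rewrite !funeposE. Qed.

Lemma funeneg_compE U V (f : V -> \bar R) (g : U -> V) t : (f^\- (g t) = (f \o g)^\- t)%E.
Proof. by rewrite !funenegE. Qed.

Lemma smeas_on_slots h : measurable_wrt measurable (@borel_sets B) h -> smeas (on_slots h).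
Proof.
move=> /smeas_borel mh.
apply: (smeas_comp (g := fun s : seqspace S => [tuple s j.+1 | j < m])) mh.
apply/measurable_fun_tnthP => i; rewrite (_ : _ \o _ = fun s : seqspace S => s i.+1).
  exact: measurable_coord.
by apply/funext => s; rewrite /= tnth_mktuple.
Qed.

Lemma depends_on_slots h : depends_on (slots [set: 'I_m]%SET) (on_slots h).
Proof.
move=> s s' ss'; rewrite /on_slots; congr h; apply: eq_mktuple => j.
by apply: ss'; apply/existsP; exists j; rewrite inE eqxx.
Qed.

Local Open Scope ereal_scope.

(** The average over slot [j] ignores that slot, so the set where the claim fails is an admissible
    test event. *)
Lemma ae_av_le (j : 'I_m) (F1 F2 : seqspace S -> \bar R) : nnmeas F1 -> nnmeas F2 ->
  depends_on (slots [set: 'I_m]%SET) F1 -> depends_on (slots [set: 'I_m]%SET) F2 ->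
  (forall A, measurable A -> depends_on (slots (~: [set j])%SET) A ->
    \int[Q]_s ((\1_A s)%:E * F1 s) = \int[Q]_s ((\1_A s)%:E * F2 s)) ->
  \int[Q]_s F2 s < +oo ->
  {ae Q, forall s, av mu j.+1 F1 s <= av mu j.+1 F2 s}.
Proof.
move=> m1 m2 h1 h2 h12 oo2; have a1 := nnmeas_av mu j.+1 m1; have a2 := nnmeas_av mu j.+1 m2.
apply: ae_le_of_integral => //; last by rewrite -resQ.
set A := [set s | _].
have mA : measurable A by rewrite -[A]setTI; apply: emeasurable_fun_lt => //; [exact: a2.1|exact: a1.1].
have hA : depends_on (slots (~: [set j])%SET) A.
  have sub k : slots [set: 'I_m]%SET k && (k != j.+1) -> slots (~: [set j])%SET k.
    move=> /andP[/existsP[i /andP[_ /eqP ->]] ij]; apply/existsP; exists i.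
    by rewrite !inE eqxx andbT; apply: contraNN ij => /eqP ->.
  move=> s s' ss'; rewrite /A /mkset.
  rewrite (@depends_on_av _ _ _ mu _ j.+1 _ h1 s s') => [|k kj]; last exact/ss'/sub.
  by rewrite (@depends_on_av _ _ _ mu _ j.+1 _ h2 s s') => [|k kj] //; exact/ss'/sub.
have jA : ~~ slots (~: [set j])%SET j.+1.
  by apply/existsP => -[i]; rewrite !inE eqSS => /andP[/eqP + /eqP ji]; apply; exact/val_inj.
have mI := nnmeas_indic (R := R) mA.
have key F : nnmeas F -> \int[Q]_(s in A) av mu j.+1 F s = \int[Q]_s ((\1_A s)%:E * F s).
  move=> mF; rewrite -(@avs_adjoint _ _ _ mu Q resQ [:: j.+1] F (fun s => (\1_A s)%:E))//=.
    rewrite integral_mkcond; apply: eq_integral => s _.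
    by rewrite patchE indicE; case: ifP => _; rewrite ?mul1e ?mul0e.
  move=> k; rewrite inE => /eqP -> s y; rewrite !indicE; congr (_%:R%:E); congr nat_of_bool.
  by have E := depends_on_indep jA hA s y; apply/idP/idP; rewrite !inE E.
by rewrite !key// h12.
Qed.

(** Degeneracy makes the integral of [phi n] of the kernel vanish over every event that ignores slot
    [j]. Positive and negative parts are averaged separately, as nonnegative functions, and their
    averages agree almost everywhere. *)
Lemma centered_on_slots h (j : 'I_m) : measurable_wrt measurable (@borel_sets B) h ->
  degenerated xi h -> centered phi mu Q j.+1 (on_slots h).
Proof.
move=> mh dh; have [bX b0 _ EA] := dh j.
have mH := smeas_on_slots mh.
have mX : smeas (fun t => h (xi_first xi m t)).
  exact: (smeas_comp (@measurable_xi_path _ _ _ _ _ _ xi) mH).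
suff key n : {ae Q, forall s, mu.-integrable setT (fun y => (phi n (on_slots h (upd s j.+1 y)))%:E) /\
    \int[mu]_y (phi n (on_slots h (upd s j.+1 y)))%:E = 0}.
  by apply: filterS (ae_foralln key) => s hs n; exact: hs.
have zero A : sigma_xi xi (~: [set j])%SET A -> \int[P]_(t in A) (phi n (h (xi_first xi m t)))%:E = 0.
  move=> sA; have mA := sigma_xi_measurable sA.
  rewrite (functional_bochner dense_e c0 L0 cN NL normingN)// -EA//.
  have := functional_bochner dense_e c0 L0 cN NL normingN n mA (@smeas_cst _ _ _ T 0%R) b0.
  move=> <-.
  by under eq_integral do rewrite (norming_fun0 normingN); rewrite integral0.
have iX := norming_fun_integrable dense_e L0 NL normingN n measurableT mX bX.
pose F s := (phi n (on_slots h s))%:E.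
have mF : measurable_fun setT F.
  by apply/measurable_EFinP; exact: (measurable_norming dense_e L0 NL normingN).
have hF : depends_on (slots [set: 'I_m]%SET) F by move=> s s' ss'; rewrite /F (depends_on_slots h ss').
have mFp : nnmeas F^\+ by split=> //; exact: measurable_funepos.
have mFn : nnmeas F^\- by split=> //; exact: measurable_funeneg.
have hFp : depends_on (slots [set: 'I_m]%SET) F^\+.
  by move=> s s' ss'; rewrite !funeposE (hF s s').
have hFn : depends_on (slots [set: 'I_m]%SET) F^\-.
  by move=> s s' ss'; rewrite !funenegE (hF s s').
have Poo : \int[Q]_s F^\+ s < +oo.
  rewrite integral_path_law//; under eq_integral do rewrite funepos_compE.
  exact: (integrable_lty measurableT (integrable_funepos measurableT iX)).
have Noo : \int[Q]_s F^\- s < +oo.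
  rewrite integral_path_law//; under eq_integral do rewrite funeneg_compE.
  exact: (integrable_lty measurableT (integrable_funeneg measurableT iX)).
have eqA A : measurable A -> depends_on (slots (~: [set j])%SET) A ->
    \int[Q]_s ((\1_A s)%:E * F^\+ s) = \int[Q]_s ((\1_A s)%:E * F^\- s).
  move=> mA hA; rewrite -!integral_path_preimage//.
  have sA : sigma_xi xi _ _ := sigma_xi_path mA hA; have mA' := sigma_xi_measurable sA.
  have := zero _ sA; rewrite integralE.
  under [LHS in _ -> LHS = _]eq_integral do rewrite funepos_compE.
  under [RHS in _ -> _ = RHS]eq_integral do rewrite funeneg_compE.
  have iA := integrableS measurableT mA' (@subsetT _ _) iX.
  have pf := integrable_fin_num mA' (integrable_funepos mA' iA).
  have nf := integrable_fin_num mA' (integrable_funeneg mA' iA).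
  by move=> /eqP; rewrite sube_eq ?fin_num_adde_defr// add0e => /eqP.
have le1 := @ae_av_le j F^\+ F^\- mFp mFn hFp hFn eqA Noo.
have le2 := @ae_av_le j F^\- F^\+ mFn mFp hFn hFp (fun A mA hA => esym (eqA A mA hA)) Poo.
(* Finite averages make the difference of the two parts meaningful. *)
have fin : {ae Q, forall s, av mu j.+1 F^\+ s < +oo}.
  by apply: nnint_fin; [exact: nnmeas_av|rewrite -resQ].
apply: filterS3 le1 le2 fin => s l1 l2 f.
have E : av mu j.+1 F^\+ s = av mu j.+1 F^\- s by apply/eqP; rewrite eq_le l1.
have mFs : measurable_fun setT (fun y => F (upd s j.+1 y)).
  exact: (measurableT_comp mF (measurable_updr s j.+1)).
split.
  apply/integrableP; split=> //.
  rewrite [X in X < _](_ : _ = av mu j.+1 F^\+ s + av mu j.+1 F^\- s).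
    by rewrite -E; exact: lte_add_pinfty.
  rewrite -nnintD; try exact: nnmeas_updr.
  apply: eq_integral => y _.
  by rewrite -[LHS]/((abse \o (F \o upd s j.+1)) y) fune_abse -funepos_compE -funeneg_compE.
rewrite integralE.
have -> : \int[mu]_y (F \o upd s j.+1)^\+ y = av mu j.+1 F^\+ s.
  by apply: eq_integral => y _; rewrite -funepos_compE.
have -> : \int[mu]_y (F \o upd s j.+1)^\- y = av mu j.+1 F^\- s.
  by apply: eq_integral => y _; rewrite -funeneg_compE.
rewrite E subee//; rewrite E in f; rewrite ge0_fin_numE//.
exact: (nnmeas_ge0 s (nnmeas_av mu j.+1 mFn)).
Qed.

End ZeroMean.

(** * Multi-indices and patterns *)

Section MultiIndices.
Local Open Scope nat_scope.
Implicit Types (m N : nat) (l u : seq nat).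

Definition mi m l : multi_index m := [ffun j : 'I_m => nth 0 (rev l) j].

Lemma dec_size m N l : l \in dec m N -> size l = m.
Proof. by rewrite mem_dec => /and3P[/eqP]. Qed.

Lemma mem_dec_rev m N l :
  (l \in dec m N) = [&& size l == m, sorted ltn (rev l) & all (fun k => 1 <= k <= N) l].
Proof.
rewrite mem_dec (@path_sortedE _ gtn); last by move=> a b c /= h1 h2; exact: ltn_trans h2 h1.
have -> : all (fun k => 1 <= k <= N) l = all (leq 1) l && all (gtn N.+1) l.
  by rewrite -all_predI; apply: eq_all => k.
rewrite rev_sorted (_ : sorted (fun y x => x < y) l = sorted gtn l)//.
congr (_ && _); rewrite -andbA andbC; by rewrite -andbA.
Qed.

Lemma mi_inj m l l' : size l = m -> size l' = m -> mi m l = mi m l' -> l = l'.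
Proof.
move=> sl sl' E; rewrite -[l]revK -[l']revK; congr rev.
apply: (@eq_from_nth _ 0); rewrite !size_rev ?sl ?sl'// => j jm.
by have /ffunP/(_ (Ordinal jm)) := E; rewrite !ffunE.
Qed.

Lemma dec_uniq m N : uniq (dec m N).
Proof.
elim: m N => [|m IH] N //=; rewrite -/(dec m).
have : uniq (index_iota 1 N.+1) by exact: iota_uniq.
elim: (index_iota 1 N.+1) => [|k r IHr]//= /andP[kr ur].
rewrite cat_uniq IHr// andbT map_inj_uniq ?IH//; last by move=> a b [].
apply/hasPn => _ /flatten_mapP[k' k'r /mapP[l _ ->]].
by apply/mapP => -[l' _ [kk' _]]; move: kr; rewrite -kk' k'r.
Qed.

Lemma mi_Inc_le m N l : l \in dec m N -> Inc_le N (mi m l).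
Proof.
rewrite mem_dec_rev => /and3P[/eqP sl srt /allP bnd].
have nb (j : 'I_m) : 1 <= nth 0 (rev l) j <= N.
  by apply: bnd; rewrite -mem_rev mem_nth// size_rev sl.
split; last by move=> j; rewrite ffunE; case/andP: (nb j).
split=> [j|j k jk]; rewrite !ffunE; first by case/andP: (nb j).
by rewrite (sorted_ltn_nth ltn_trans)// ?inE ?size_rev ?sl.
Qed.

Lemma Inc_le_mi m N (i : multi_index m) : Inc_le N i -> exists2 l, l \in dec m N & mi m l = i.
Proof.
move=> [[i1 inc] iN]; pose r := [seq i j | j <- enum 'I_m].
have sr : size r = m by rewrite size_map size_enum_ord.
have nr (j : 'I_m) : nth 0 r j = i j.
  by rewrite (nth_map j) ?size_enum_ord// nth_ord_enum.
exists (rev r); last by apply/ffunP => j; rewrite ffunE revK nr.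
rewrite mem_dec_rev size_rev sr eqxx revK all_rev /=; apply/andP; split; last first.
  by apply/allP => _ /mapP[j _ ->]; rewrite i1 iN.
apply/(sortedP 0) => k; rewrite sr => km.
by have := inc (Ordinal (ltnW km)) (Ordinal km) (ltnSn k); rewrite -!nr.
Qed.

Lemma Inc_le_dec m N : @Inc_le m N = [set` map (mi m) (dec m N)].
Proof.
apply/seteqP; split=> i /=; first by move=> /Inc_le_mi[l lN <-]; exact: map_f.
by move=> /mapP[l lN ->]; exact: mi_Inc_le.
Qed.

Lemma fsbig_Inc_le (V : Type) (idx : V) (op : Monoid.com_law idx) m N (F : multi_index m -> V) :
  \big[op/idx]_(i \in @Inc_le m N) F i = \big[op/idx]_(l <- dec m N) F (mi m l).
Proof.
rewrite Inc_le_dec -fsbig_seq ?big_map// map_inj_in_uniq ?dec_uniq//.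
by move=> l l' /dec_size sl /dec_size sl'; exact: mi_inj.
Qed.

(* The slots [1, ..., m] go to the entries of [l] in increasing order, the others past [N] to keep the map injective. *)
Definition place m N l k := if k is j.+1 then (if j < m then nth 0 (rev l) j else N + k) else 0.

Lemma place_inj m N l : l \in dec m N -> injective (place m N l).
Proof.
rewrite mem_dec_rev => /and3P[/eqP sl srt /allP bnd].
have nb j : j < m -> 1 <= nth 0 (rev l) j <= N.
  by move=> jm; apply: bnd; rewrite -mem_rev mem_nth// size_rev sl.
have ul : uniq (rev l) by apply: sorted_uniq srt; [exact: ltn_trans|exact: ltnn].
move=> [|j] [|k]//=.
- by case: ifP => [/nb|_]; lia.
- by case: ifP => [/nb|_]; lia.
- case: ifP => [jm|_]; case: ifP => [km|_].
  + by move=> /eqP; rewrite nth_uniq ?size_rev ?sl// => /eqP ->.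
  + by have := nb _ jm; lia.
  + by have := nb _ km; lia.
  + lia.
Qed.

Lemma map_place m N l : size l = m -> map (place m N l) (rev (iota 1 m)) = l.
Proof.
move=> sl; rewrite map_rev -[RHS]revK; congr rev.
apply: (@eq_from_nth _ 0); rewrite size_map size_iota ?size_rev// => j jm.
by rewrite (nth_map 0) ?size_iota// nth_iota//= jm.
Qed.

(* A pattern [u] prescribes the nonzero entries and leaves free the entries where it is zero. *)
Fixpoint pats m N : seq (seq nat) :=
  if m is m'.+1 then [seq k :: u | k <- iota 0 N.+1, u <- pats m' N] else [:: [::]].

Lemma patsS m N : pats m.+1 N = [seq k :: u | k <- iota 0 N.+1, u <- pats m N].
Proof. by []. Qed.

Definition matches l u := all (fun x => (x.2 == 0) || (x.1 == x.2)) (zip l u).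

Definition unfixed l u := [seq x.1 | x <- zip l u & x.2 == 0].

Lemma mem_pats m N u : (u \in pats m N) = (size u == m) && all (fun k => k <= N) u.
Proof.
elim: m u => [|m IH] u; first by rewrite inE; case: u.
rewrite patsS; apply/allpairsP/idP => [[[k u'] [+ + ->]]|].
  by rewrite -[(k, u').1]/k -[(k, u').2]/u' mem_iota add0n ltnS IH /= eqSS => -> /andP[-> ->].
case: u => [|k u]//=; rewrite eqSS => /and3P[su kN uN]; exists (k, u) => /=; split=> //.
  by rewrite -[_ :: _]/(iota 0 N.+1) mem_iota add0n ltnS.
by rewrite IH su.
Qed.

Lemma pats_uniq m N : uniq (pats m N).
Proof.
elim: m => [|m IH]//; rewrite patsS.
apply: allpairs_uniq => //; first exact: (iota_uniq 0 N.+1).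
by move=> [k u] [k' u'] _ _ /= [-> ->].
Qed.

Lemma dec_sub_pats m N l : l \in dec m N -> l \in pats m N.
Proof.
rewrite mem_dec_rev mem_pats => /and3P[-> _ /allP h] /=.
by apply/allP => k /h /andP[].
Qed.

Lemma matchesP m l u : size l = m -> size u = m ->
  reflect (forall j, j < m -> nth 0 (rev u) j != 0 -> nth 0 (rev l) j = nth 0 (rev u) j) (matches l u).
Proof.
move=> sl su; rewrite /matches -all_rev rev_zip ?sl//.
apply: (iffP (all_nthP (0, 0))) => h j; last first.
  rewrite size_zip !size_rev sl su minnn => jm.
  rewrite nth_zip ?size_rev ?sl//=; have [//|/= uj] := eqVneq; apply/eqP; exact: h.
move=> jm uj; have := h j; rewrite size_zip !size_rev sl su minnn => /(_ jm).
by rewrite nth_zip ?size_rev ?sl//= (negbTE uj) => /eqP.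
Qed.

Lemma mem_unfixed m u k : size u = m ->
  reflect (exists2 j, j < m & k = j.+1 /\ nth 0 (rev u) j = 0) (k \in unfixed (rev (iota 1 m)) u).
Proof.
move=> su; have sz : size (zip (iota 1 m) (rev u)) = m.
  by rewrite size_zip size_iota size_rev su minnn.
have E : rev (zip (rev (iota 1 m)) u) = zip (iota 1 m) (rev u).
  by rewrite rev_zip ?revK// size_rev size_iota.
rewrite /unfixed -[zip _ u]revK E; apply: (iffP mapP) => [[[a b]]|[j jm [-> uj]]].
  rewrite mem_filter mem_rev => /andP[/= /eqP -> /(nthP (0, 0))[j]]; rewrite sz => jm.
  rewrite nth_zip ?size_iota ?size_rev// nth_iota// => -[<- uj] ->.
  by exists j => //; rewrite add1n.
exists (j.+1, 0) => //; rewrite mem_filter eqxx /= mem_rev; apply/(nthP (0, 0)); exists j.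
  by rewrite sz.
by rewrite nth_zip ?size_iota ?size_rev// nth_iota// add1n uj.
Qed.

Lemma map_unfixed (sigma : nat -> nat) l u : unfixed (map sigma l) u = map sigma (unfixed l u).
Proof.
rewrite /unfixed; elim: l u => [|a l IH] [|b u]//=.
by case: ifP => _ //=; rewrite IH.
Qed.

End MultiIndices.

(** * Sums grouped by patterns *)

Section Patterns.
Context {R : realType} d (S : measurableType d) (mu : probability S R)
  (Q : probability (seqspace S) R).
Local Open Scope ereal_scope.
Implicit Types (G : seq nat -> seqspace S -> \bar R).

Definition pat_sum m N u G t := \sum_(l <- dec m N | matches l u) avs mu (unfixed l u) (G l) t.

Lemma nnmeas_pat_sum m N u G : (forall l, nnmeas (G l)) -> nnmeas (pat_sum m N u G).
Proof. by move=> mG; apply: nnmeas_sum => l _; exact: nnmeas_avs. Qed.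

Lemma pat_sum_fixed m N k u G t : (1 <= k <= N)%N ->
  pat_sum m.+1 N (k :: u) G t = pat_sum m k.-1 u (fun l => G (k :: l)) t.
Proof.
move=> /andP[k1 kN]; rewrite /pat_sum big_mkcond dec_sumS.
rewrite (bigD1_seq k) ?iota_uniq ?mem_index_iota ?k1//= [X in _ + X]big1 ?adde0; last first.
  move=> j jk; rewrite big1// => l _; rewrite /matches/= (gtn_eqF k1) /=.
  by rewrite (negbTE jk).
rewrite [RHS]big_mkcond; apply: eq_bigr => l _.
by rewrite /matches/= eqxx orbT/= /unfixed/= (gtn_eqF k1).
Qed.

Lemma pat_sum_free m N u G t : (forall l, nnmeas (G l)) ->
  pat_sum m N u (fun l t => \sum_(1 <= k < N.+1 | (head 0 l < k)%N) av mu k (G (k :: l)) t) t =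
  pat_sum m.+1 N (0%N :: u) G t.
Proof.
move=> mG; rewrite /pat_sum [RHS]big_mkcond dec_sumS.
under eq_bigr => l _.
  rewrite avs_sum; last by move=> k; exact: nnmeas_av.
  over.
rewrite (exchange_big_dep xpredT)//= big_nat_cond [RHS]big_nat_cond.
apply: eq_bigr => k /andP[kN _]; rewrite (dec_sum_head _ _ kN) big_mkcond [RHS]big_mkcond.
by apply: eq_bigr => l _; rewrite -[matches (k :: l) _]/(matches l u); case: (matches l u); case: ifP.
Qed.

(** Choosing one of the two terms at each level of [moment_bound] spells a pattern: a nonzero entry
    for an index kept outside the power, zero for an averaged one. Patterns with entries beyond [n]
    only add nonnegative terms. *)
Lemma moment_bound_pats (s : R) m n N G : (0 < s)%R -> (n <= N)%N -> (forall l, nnmeas (G l)) ->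
  moment_bound mu Q s m n G <= \sum_(u <- pats m N) \int[Q]_t pat_sum m n u G t `^ s.
Proof.
move=> s0; elim: m n G => [|m IH] n G nN mG.
  rewrite big_seq1; apply: nnint_le => [||t]; first exact/nnmeas_poweR.
    by apply: nnmeas_poweR; exact: nnmeas_pat_sum.
  by rewrite /pat_sum/= big_mkcond big_seq1.
have I0 m' n' u' G' : (forall l, nnmeas (G' l)) -> 0 <= \int[Q]_t pat_sum m' n' u' G' t `^ s.
  by move=> mG'; apply: nnint_ge0; apply: nnmeas_poweR; exact: nnmeas_pat_sum.
rewrite patsS big_allpairs_dep/= big_cons addeC; apply: leeD.
  apply: (le_trans (IH n _ nN _)) => [l|].
    by apply: nnmeas_sum => k _; exact: nnmeas_av.
  apply: lee_sum => u _; rewrite le_eqVlt; apply/orP; left; apply/eqP.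
  by apply: eq_integral => t _; rewrite pat_sum_free.
have -> : iota 1 N = index_iota 1 N.+1 by rewrite /index_iota subSS subn0.
rewrite [leRHS](@big_cat_nat _ _ _ n.+1)//=.
rewrite -[leLHS]adde0; apply: leeD; last first.
  by apply: sume_ge0 => k _; apply: sume_ge0 => u _; exact: I0.
rewrite big_nat_cond [leRHS]big_nat_cond; apply: lee_sum => k /andP[/andP[k1 kn] _].
apply: (le_trans (IH k.-1 _ _ _)) => [|l|]; [by lia|exact: mG|].
apply: lee_sum => u _; rewrite le_eqVlt; apply/orP; left; apply/eqP.
by apply: eq_integral => t _; rewrite pat_sum_fixed ?k1.
Qed.

End Patterns.

Section RelabelPatterns.
Context {R : realType} d (T : measurableType d) d' (S : measurableType d').
Context (P : probability T R) (xi : nat -> {RV P >-> S}).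
Hypothesis iid_xi : iid xi.
Let mu := xi_law xi.
Let Q := path_law xi.
Local Open Scope ereal_scope.

Definition first_unfixed m u := unfixed (rev (iota 1 m)) u.

(* All the samples of the multi-indices that agree with [u] can be moved to the first [m] slots at once. *)
Lemma pat_sum_relabel (s : R) m N u (F : seq nat -> seqspace S -> \bar R) :
  size u = m -> (0 < s)%R -> (forall l, nnmeas (F l)) ->
  (forall l, depends_on (slots [set: 'I_m]%SET) (F l)) ->
  \int[Q]_t pat_sum mu m N u (fun l => F l \o relabel (place m N l)) t `^ s =
  \int[Q]_t (\sum_(l <- dec m N | matches l u) avs mu (first_unfixed m u) (F l) t) `^ s.
Proof.
move=> su s0 mF hF; rewrite /pat_sum.
have [/hasP[l0 l0N l0u]|/hasPn none] := boolP (has (matches^~ u) (dec m N)); last first.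
  apply: eq_integral => t _; congr (_ `^ s).
  by rewrite big_seq_cond [RHS]big_seq_cond [LHS]big1 ?[RHS]big1// => l /andP[/none /negbTE ->].
(* One relabelling, read off a matching list [l0], serves all [l]: matching lists agree at the fixed
   entries, and the free ones are averaged out. *)
rewrite -[RHS](path_law_relabel iid_xi (place_inj l0N))//; last first.
  by apply: nnmeas_poweR; apply: nnmeas_sum => l _; exact: nnmeas_avs.
apply: eq_integral => t _; congr (_ `^ s).
rewrite big_seq_cond [RHS]big_seq_cond; apply: eq_bigr => l /andP[lN lu].
have sl := dec_size lN; have sl0 := dec_size l0N.
rewrite -[in LHS](map_place N sl) (map_unfixed (place m N _)) /first_unfixed.
rewrite -/(map _ _) map_place// avs_relabel; last exact: place_inj.
apply: (@depends_on_avs _ _ _ mu _ _ _ (hF l)) => k /= /andP[/existsP[j /andP[_ /eqP ->]] jf].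
rewrite /relabel/= ltn_ord.
have uj : nth 0%N (rev u) j != 0%N.
  by apply: contraNneq jf => uj; apply/(mem_unfixed _ su); exists (val j) => //; exact: ltn_ord.
by rewrite (matchesP sl su lu)// (matchesP sl0 su l0u).
Qed.

End RelabelPatterns.

Lemma ae_all_seq (R : realType) d (T : measurableType d) (P : probability T R) (I : eqType)
    (r : seq I) (A : I -> set T) :
  (forall i, {ae P, forall t, A i t}) -> {ae P, forall t, forall i, i \in r -> A i t}.
Proof.
move=> h; elim: r => [|i r IH]; first by apply: aeW.
apply: filterS2 (h i) IH => t Ai Ar j; rewrite inE => /predU1P[->//|]; exact: Ar.
Qed.

Lemma big_uniq_pred1 (V : Type) (idx : V) (op : Monoid.law idx) (I : eqType) (r : seq I) i
    (F : I -> V) : uniq r -> i \in r -> \big[op/idx]_(j <- r | j == i) F j = F i.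
Proof. by move=> ur ir; rewrite -big_filter filter_pred1_uniq// big_seq1. Qed.

Section Supports.
Context (m : nat).
Implicit Types (J : {set 'I_m}) (i : multi_index m) (u l : seq nat).

(** The set [J] of a pattern: the indices kept outside the power. The nonzero entries themselves
    encode [i_J]. *)
Definition supp u : {set 'I_m} := [set j : 'I_m | nth 0%N (rev u) j != 0%N]%SET.

Lemma sum_basis_index J (v : 'I_m -> nat) k :
  (\sum_(j in J) basis_index j *+ v j) k = if k \in J then v k else 0%N.
Proof.
rewrite sum_ffunE (eq_bigr (fun j => (if j == k then v k else 0%N) : nat)); last first.
  move=> j _; rewrite ffunMnE ffunE [k == j]eq_sym.
  by case: eqP => [->|_]; rewrite ?natn ?mul0rn.
have [kJ|kJ] := boolP (k \in J).
  rewrite (bigD1 k)//= eqxx big1 ?addr0// => j /andP[_ /negbTE ->] //.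
by rewrite big1// => j jJ; case: eqP jJ kJ => // -> ->.
Qed.

Lemma indices_onP J i : indices_on J i <-> forall j, j \notin J -> i j = 0%N.
Proof.
split=> [[v ->] j jJ|h]; first by rewrite sum_basis_index (negbTE jJ).
exists i; apply/ffunP => k; rewrite sum_basis_index.
by case: ifPn => // /h.
Qed.

Lemma matches_mi l u : size l = m -> size u = m -> matches l u ->
  mi m l = mi m u + [ffun j => if j \in supp u then 0%N else mi m l j].
Proof.
move=> sl su /(matchesP sl su) lu; apply/ffunP => j; rewrite !ffunE inE.
by case: eqVneq => [->|uj]; rewrite ?add0r// addr0 lu.
Qed.

(** The lists that match [u] are the multi-indices with [J = supp u] and [i_J = mi m u]; the
    remaining entries form the index on the complement of [J]. *)
Lemma fsbig_matches (V : Type) (idx : V) (op : Monoid.com_law idx) N u (F : multi_index m -> V) :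
  size u = m ->
  \big[op/idx]_(i \in [set i | indices_on (~: supp u)%SET i /\ Inc_le N (mi m u + i)])
    F (mi m u + i) = \big[op/idx]_(l <- dec m N | matches l u) F (mi m l).
Proof.
move=> su; pose g l : multi_index m := [ffun j => if j \in supp u then 0%N else mi m l j].
have gE l : l \in [seq l <- dec m N | matches l u] -> mi m l = mi m u + g l.
  by rewrite mem_filter => /andP[lu /dec_size sl]; exact: matches_mi.
have -> : [set i | indices_on (~: supp u)%SET i /\ Inc_le N (mi m u + i)] =
    [set` map g [seq l <- dec m N | matches l u]].
  apply/seteqP; split=> i /=.
    move=> [/indices_onP iu /Inc_le_mi[l lN lE]].
    have iu0 j : j \in supp u -> i j = 0%N by move=> ju; apply: iu; rewrite inE ju.
    apply/mapP; exists l; last first.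
      apply/ffunP => j; rewrite ffunE lE; case: ifPn => [/iu0//|].
      by rewrite inE negbK !ffunE => /eqP ->; rewrite add0r.
    rewrite mem_filter lN andbT; apply/(matchesP (dec_size lN) su) => j jm uj.
    have := iu0 (Ordinal jm); rewrite inE => /(_ uj) ij.
    by have /ffunP/(_ (Ordinal jm)) := lE; rewrite !ffunE ij addr0.
  move=> /mapP[l lf ->]; split; last first.
    by rewrite -gE//; apply: mi_Inc_le; move: lf; rewrite mem_filter => /andP[].
  by apply/indices_onP => j; rewrite inE negbK ffunE => ->.
rewrite -fsbig_seq; last first.
  rewrite map_inj_in_uniq ?filter_uniq ?dec_uniq// => l l' lf lf' E.
  apply: (@mi_inj m); last by rewrite gE// [RHS]gE// E.
    by move: lf; rewrite mem_filter => /andP[_ /dec_size].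
  by move: lf'; rewrite mem_filter => /andP[_ /dec_size].
rewrite big_map -[RHS]big_filter big_seq_cond [RHS]big_seq_cond.
by apply: eq_bigr => l /andP[lf _]; rewrite (gE l lf).
Qed.

Lemma first_unfixed_gt0 u : size u = m -> all (leq 1) (first_unfixed m u).
Proof. by move=> su; apply/allP => k /(mem_unfixed _ su)[j _ [->]]. Qed.

Lemma slots_supp u k : size u = m ->
  slots [set: 'I_m]%SET k -> k \notin first_unfixed m u -> slots (supp u) k.
Proof.
move=> su /existsP[j /andP[_ /eqP ->]] jf; apply/existsP; exists j; rewrite eqxx andbT inE.
by apply: contraNneq jf => uj; apply/(mem_unfixed _ su); exists (val j) => //; exact: ltn_ord.
Qed.

Lemma first_unfixed_slots u k : size u = m -> k \in first_unfixed m u -> ~~ slots (supp u) k.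
Proof.
move=> su /(mem_unfixed _ su)[j jm [-> uj]]; apply/existsP => -[i /andP[+ /eqP[ji]]].
by rewrite inE -ji uj.
Qed.

Lemma supp_setT u : size u = m -> supp u = [set: 'I_m]%SET ->
  first_unfixed m u = [::] /\ forall l, size l = m -> matches l u = (l == u).
Proof.
move=> su suT; have nz j : (j < m)%N -> nth 0%N (rev u) j != 0%N.
  move=> jm; have : Ordinal jm \in supp u by rewrite suT inE.
  by rewrite inE.
split.
  case E : (first_unfixed m u) => [//|k ks]; have : k \in first_unfixed m u by rewrite E inE eqxx.
  by move=> /(mem_unfixed _ su)[j /nz + [_ uj]]; rewrite uj.
move=> l sl; apply/idP/eqP => [/(matchesP sl su) h|->].
  apply: (@mi_inj m) => //; apply/ffunP => j; rewrite !ffunE h// nz//.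
by apply/(matchesP su su).
Qed.

Lemma supp_set0 u : size u = m -> supp u = finset.set0 -> u = nseq m 0%N.
Proof.
move=> su su0; apply: (@mi_inj m); rewrite ?size_nseq//; apply/ffunP => j; rewrite !ffunE.
have : j \notin supp u by rewrite su0 inE.
rewrite inE negbK => /eqP ->; rewrite nth_rev ?size_nseq// nth_nseq.
by case: ifP.
Qed.

Lemma matches_nseq0 n l : matches l (nseq n 0%N).
Proof. by elim: n l => [|n IH] [|a l]//=; exact: IH. Qed.

End Supports.

Definition mixed_term {R : realType} d (T : measurableType d) d' (S : measurableType d')
    (P : probability T R) (xi : nat -> {RV P >-> S}) (m N : nat) (s : R)
    (X : multi_index m -> T -> \bar R) : \bar R :=
  (\sum_(J : {set 'I_m} | (J != finset.set0) && (J != [set: 'I_m]%SET))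
    \esum_(iJ in indices_on J) \int[P]_t
      (\sum_(iJc \in [set iJc | indices_on (~: J)%SET iJc /\ @Inc_le m N (iJ + iJc)%R])
         cond_expectation P (sigma_xi xi J) (X (iJ + iJc)%R) t) `^ s)%E.

Lemma eq_mixed_term {R : realType} d (T : measurableType d) d' (S : measurableType d')
    (P : probability T R) (xi : nat -> {RV P >-> S}) (m N : nat) (s : R)
    (X Y : multi_index m -> T -> \bar R) :
  (forall i, Inc_le N i -> X i = Y i) -> mixed_term xi N s X = mixed_term xi N s Y.
Proof.
move=> XY; apply: eq_bigr => J _.
apply: eq_esum => iJ _; apply: eq_integral => t _; congr (_ `^ _)%E.
by apply: eq_fsbigr => iJc; rewrite inE => -[_ iN]; rewrite XY.
Qed.

Lemma mixed_term_ge0 {R : realType} d (T : measurableType d) d' (S : measurableType d')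
    (P : probability T R) (xi : nat -> {RV P >-> S}) (m N : nat) (s : R)
    (X : multi_index m -> T -> \bar R) : (0 <= mixed_term xi N s X)%E.
Proof.
apply: sume_ge0 => J _; apply: esum_ge0 => iJ _; apply: integral_ge0 => t _.
exact: poweR_ge0.
Qed.

Section PatternTotals.
Context {R : realType} d (T : measurableType d) d' (S : measurableType d').
Context (P : probability T R) (xi : nat -> {RV P >-> S}).
Hypothesis iid_xi : iid xi.
Let mu := xi_law xi.
Let Q := path_law xi.
Let resQ : resampling mu Q := path_law_resampling iid_xi.
Local Open Scope ereal_scope.
Context (m N : nat) (s : R) (F : multi_index m -> seqspace S -> \bar R).
Hypothesis m1 : (1 <= m)%N.
Hypothesis s0 : (0 < s)%R.
Hypothesis mF : forall i, nnmeas (F i).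
Hypothesis hF : forall i, depends_on (slots [set: 'I_m]%SET) (F i).
Hypothesis fF : forall i, \int[Q]_t F i t < +oo.

Definition slot_sum u t :=
  \sum_(l <- dec m N | matches l u) avs mu (first_unfixed m u) (F (mi m l)) t.

Lemma nnmeas_slot_sum u : nnmeas (slot_sum u).
Proof. by apply: nnmeas_sum => l _; exact: nnmeas_avs. Qed.

Lemma slot_sum_cond u : size u = m ->
  \int[Q]_t slot_sum u t `^ s <=
  \int[P]_t (\sum_(iJc \in [set iJc | indices_on (~: supp m u)%SET iJc /\
                                      Inc_le N (mi m u + iJc)%R])
     cond_expectation P (sigma_xi xi (supp m u)) (F (mi m u + iJc)%R \o xi_path xi) t) `^ s.
Proof.
move=> su; rewrite integral_path_law; last exact/nnmeas_poweR/nnmeas_slot_sum.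
under [leRHS]eq_integral => t _.
  rewrite (@fsbig_matches m _ _ _ N u (fun i => cond_expectation P _ (F i \o xi_path xi) t) su).
  over.
have ks1 := first_unfixed_gt0 su.
have DJ k := @slots_supp m u k su.
have ksJ k := @first_unfixed_slots m u k su.
have mc i : nnmeas (cond_expectation P (sigma_xi xi (supp m u)) (F i \o xi_path xi)).
  exact: (nnmeas_cond_expectation iid_xi ks1 (mF i) (@hF i) DJ ksJ).
apply: nnint_ae_le.
- have [ms ms0] := nnmeas_poweR s (nnmeas_slot_sum u); split=> // .
  exact: (measurableT_comp ms (@measurable_xi_path _ _ _ _ _ _ xi)).
- by apply: nnmeas_poweR; apply: nnmeas_sum.
have h l := cond_expectation_avs iid_xi ks1 (mF (mi m l)) (@hF (mi m l)) DJ ksJ (fF (mi m l)).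
apply: filterS (ae_all_seq (dec m N) h) => t ht.
apply: gt0_ler_poweR; rewrite ?(ltW s0) ?in_itv/= ?leey ?andbT//.
- exact: (nnmeas_ge0 _ (nnmeas_slot_sum u)).
- by apply: sume_ge0 => l _; exact: nnmeas_ge0.
- by rewrite /slot_sum big_seq_cond [leRHS]big_seq_cond; apply: lee_sum => l /andP[lN _]; exact: ht.
Qed.

Lemma slot_sum_full :
  \sum_(u <- pats m N | supp m u == [set: 'I_m]%SET) \int[Q]_t slot_sum u t `^ s <=
  \sum_(l <- dec m N) \int[Q]_t F (mi m l) t `^ s.
Proof.
pose Y l := \int[Q]_t F (mi m l) t `^ s.
have Y0 l : 0 <= Y l by apply: nnint_ge0; exact: nnmeas_poweR.
have -> : \sum_(l <- dec m N) Y l = \sum_(u <- pats m N | u \in dec m N) Y u.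
  rewrite -[RHS]big_filter; apply: perm_big; apply: uniq_perm.
  - exact: dec_uniq.
  - exact/filter_uniq/pats_uniq.
  move=> l; rewrite mem_filter; have [lN|//] := boolP (l \in dec m N).
  exact/esym/dec_sub_pats.
rewrite big_mkcond [leRHS]big_mkcond big_seq_cond [leRHS]big_seq_cond.
apply: lee_sum => u; rewrite mem_pats => /andP[/andP[/eqP su _] _].
case: eqP => [suT|_]; last by case: ifP.
have [un0 mE] := supp_setT su suT.
have E t : slot_sum u t = \sum_(l <- dec m N | l == u) F (mi m l) t.
  rewrite /slot_sum un0 big_seq_cond [RHS]big_seq_cond; apply: eq_bigl => l.
  by have [/dec_size sl|//] := boolP (l \in dec m N); rewrite mE.
under eq_integral do rewrite E.
case: ifPn => [uN|uN].
  rewrite /Y le_eqVlt; apply/orP; left; apply/eqP; apply: eq_integral => t _.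
  by rewrite (big_uniq_pred1 _ _ (dec_uniq m N) uN).
rewrite integral0_eq// => t _; rewrite big_seq_cond big1 ?poweR0r ?gt_eqF// => l /andP[lN /eqP lu].
by move: uN; rewrite -lu lN.
Qed.

(** The only pattern concerned is the zero one; all slots are averaged, so the sum is a constant. *)
Lemma slot_sum_empty :
  \sum_(u <- pats m N | supp m u == finset.set0) \int[Q]_t slot_sum u t `^ s <=
  (\sum_(l <- dec m N) \int[Q]_t F (mi m l) t) `^ s.
Proof.
pose u0 := nseq m 0%N.
have su0 : size u0 = m by rewrite size_nseq.
have suppu0 : supp m u0 = finset.set0.
  by apply/setP => j; rewrite !inE nth_rev ?su0// nth_nseq; case: ifP.
have u0P : u0 \in pats m N by rewrite mem_pats su0 eqxx/=; apply/allP => k; rewrite mem_nseq => /andP[_ /eqP ->].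
rewrite big_seq_cond (eq_bigl (fun u => (u \in pats m N) && (u == u0))); last first.
  move=> u; rewrite mem_pats; case: eqP => //= su.
  case: (all _ _) => //=; apply/eqP/eqP => [|->//]; exact: supp_set0.
rewrite -big_seq_cond (big_uniq_pred1 _ _ (pats_uniq m N) u0P).
have E t : slot_sum u0 t = \sum_(l <- dec m N) \int[Q]_t F (mi m l) t.
  rewrite /slot_sum (eq_bigl xpredT); last by move=> l; exact: matches_nseq0.
  apply: eq_bigr => l _; apply: (avs_cst resQ _ (first_unfixed_gt0 su0) (mF _) (@hF _)) => k.
  move=> kT; apply/negPn/negP => /(slots_supp su0 kT).
  by rewrite suppu0 => /existsP[j]; rewrite inE.
under eq_integral do rewrite E.
by rewrite -[leRHS]mule1 -(@probability_setT _ _ _ Q) -integral_cst.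
Qed.

(** Patterns are sorted by support: the full set gives the first sum, the empty set the last one,
    and a proper nonempty [J] a part of the sum over [i_J]. The two extreme supports differ because
    [1 <= m]. *)
Lemma pattern_totals :
  \sum_(u <- pats m N) \int[Q]_t slot_sum u t `^ s <=
  \sum_(l <- dec m N) \int[Q]_t F (mi m l) t `^ s +
  mixed_term xi N s (fun i => F i \o xi_path xi) +
  (\sum_(l <- dec m N) \int[Q]_t F (mi m l) t) `^ s.
Proof.
rewrite (partition_big (supp m) xpredT)//= (bigD1 [set: 'I_m]%SET)//= (bigD1 finset.set0)/=; last first.
  apply/eqP => /setP/(_ (Ordinal m1)); by rewrite !inE.
rewrite [X in _ + X]addeC addeA; apply: leeD; last exact: slot_sum_empty.
apply: leeD; first exact: slot_sum_full.
rewrite (eq_bigl _ _ (fun J => andbC _ _)); apply: lee_sum => J _.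
pose r := [seq u <- pats m N | supp m u == J].
have rP u : u \in r -> size u = m /\ supp m u = J.
  by rewrite mem_filter mem_pats => /andP[/eqP -> /andP[/eqP]].
(* The patterns with support [J] give finitely many distinct [i_J], whose terms bound the sum over
   all of them from below. *)
apply: esum_ge; exists [set` map (mi m) r].
  split; first exact: finite_seq.
  move=> i /= /mapP[u ur ->]; have [_ uJ] := rP _ ur.
  by apply/indices_onP => j; rewrite -uJ inE negbK ffunE => /eqP.
rewrite -fsbig_seq; last first.
  rewrite map_inj_in_uniq ?filter_uniq ?pats_uniq// => u u' /rP[su _] /rP[su' _].
  exact: mi_inj.
rewrite big_map -big_filter big_seq_cond [leRHS]big_seq_cond.
apply: lee_sum => u /andP[/rP[su uJ] _].
by rewrite -uJ; exact: slot_sum_cond.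
Qed.

End PatternTotals.

(** * Proof of the theorem *)

Lemma fin_sum (R : realType) d (S : measurableType d) (Q : probability (seqspace S) R) (p C s : R)
    (E : lp_space Q p C) (I : eqType) (r : seq I) (v : I -> E) : 0 < s ->
  (forall i, adm (v i)) -> (forall i, fin s (v i)) -> fin s (\sum_(i <- r) v i).
Proof.
move=> s0 av fv; have [] // : adm (\sum_(i <- r) v i) /\ fin s (\sum_(i <- r) v i).
elim/big_ind: _ => [|x y [ax fx] [ay fy]|//]; first by split; [exact: adm0|exact: fin0].
by split; [exact: admD|exact: finD].
Qed.

Lemma nnmeas_bigmax (R : realType) d (T : measurableType d) (I : Type) (r : seq I) (F : I -> T -> R) :
  (forall i, nnmeas (fun t => (F i t)%:E)) -> nnmeas (fun t => (\big[Num.max/0]_(i <- r) F i t)%:E).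
Proof.
move=> mF; elim: r => [|i r IH].
  by under eq_fun do rewrite big_nil; exact: (nnmeas_cst _ (lexx _)).
by under eq_fun do rewrite big_cons EFin_max; exact: nnmeas_max.
Qed.

Lemma bigmax_le_ereal (R : realType) (I : eqType) (r : seq I) (F : I -> R) (x : \bar R) :
  (0 <= x -> (forall i, i \in r -> (F i)%:E <= x) -> (\big[Num.max/0%R]_(i <- r) F i)%:E <= x)%E.
Proof.
move=> x0 Fx; rewrite big_seq; elim/big_ind: _ => // y z yx zx.
by rewrite EFin_max ge_max yx.
Qed.

Section Kernels.
Context {R : realType} (B : completeNormedModType R) (e : nat -> B) (nu : B -> R) (c : R)
  (phi : nat -> B -> R).
Hypothesis dense_e : forall x (eps : R), 0 < eps -> exists n, `|x - e n| < eps.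
Hypothesis norm_nu : is_norm nu.
Hypothesis c0 : 0 < c.
Hypothesis c_nu : forall x, c * `|x| <= nu x.
Hypothesis nu_le : forall x, nu x <= 1 * `|x|.
Hypothesis norming_nu : norming nu phi.
Variables (p q C : R).
Hypothesis p1 : 1 < p.
Hypothesis pq : p <= q.
Hypothesis C0 : 0 <= C.
Hypothesis smooth_nu : two_point_smooth nu p C.
Context d (T : measurableType d) d' (S : measurableType d').
Context (P : probability T R) (xi : nat -> {RV P >-> S}).
Hypothesis iid_xi : iid xi.
Let mu := xi_law xi.
Let Q := path_law xi.
Let resQ : resampling mu Q := path_law_resampling iid_xi.
Context (m N : nat) (h : multi_index m -> m.-tuple S -> B).
Hypothesis mh : forall i, Inc i -> measurable_wrt measurable (@borel_sets B) (h i).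
Hypothesis dh : forall i, Inc i -> degenerated xi (h i).
Hypothesis fh : forall i, Inc_le N i ->
  (\int[P]_t (`|h i (xi_first xi m t)| `^ q)%:E < +oo)%E.
Let L0 : (0 : R) <= 1 := ler01.
Let E := base_space dense_e norm_nu L0 nu_le norming_nu resQ p1 smooth_nu.

(** The relabelling reads the kernel at the samples indexed by [l]; the value is 0 outside [dec m N]
    because kernels are assumed measurable and degenerate on increasing indices only. *)
Definition summand l : seqspace S -> B :=
  if l \in dec m N then on_slots (h (mi m l)) \o relabel (place m N l) else 0.

Lemma summand_smeas l : smeas (summand l).
Proof.
rewrite /summand; case: ifPn => [lN|_]; last exact: smeas_cst.
apply: smeas_comp; first exact: measurable_relabel.
by apply: smeas_on_slots; apply: mh; case: (mi_Inc_le lN).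
Qed.

Lemma on_slots_place l s : on_slots (h (mi m l)) (relabel (place m N l) s) =
  h (mi m l) [tuple s (mi m l j) | j < m].
Proof. by congr (h _); apply: eq_mktuple => j; rewrite /relabel/= ltn_ord ffunE. Qed.

Lemma summand_indep l j : l \in dec m N -> j \notin l -> indep j (summand l).
Proof.
move=> lN jl s y; rewrite /summand lN /= !on_slots_place; congr (h _); apply: eq_mktuple => i.
rewrite /upd ffunE; case: eqP => // ij; move: jl.
by rewrite -ij -[in X in X -> _]mem_rev mem_nth// size_rev (dec_size lN).
Qed.

(** An entry of [l] is the image of a slot under [place], and the relabelling preserves null
    sets. *)
Lemma summand_centered l j : l \in dec m N -> j \in l -> centered phi mu Q j (summand l).
Proof.
move=> lN jl; rewrite /summand lN.
have [i iE] : exists i : 'I_m, j = place m N l i.+1.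
  move: jl; rewrite -mem_rev => /(nthP 0%N)[i]; rewrite size_rev (dec_size lN) => im <-.
  by exists (Ordinal im); rewrite /= im.
have [Il _] := mi_Inc_le lN.
have := centered_on_slots dense_e c0 L0 c_nu nu_le norming_nu iid_xi i (mh Il) (dh Il).
move=> /(ae_relabel iid_xi (place_inj lN) erefl); apply: filterS => s hs n.
have [hi h0] := hs n; rewrite iE.
have E' y : (on_slots (h (mi m l)) \o relabel (place m N l)) (upd s (place m N l i.+1) y) =
    on_slots (h (mi m l)) (upd (relabel (place m N l) s) i.+1 y).
  by rewrite -[LHS]/(on_slots _ (relabel _ (upd _ _ _))) relabel_upd//; exact: place_inj.
by split; [under eq_fun do rewrite E'|under eq_integral do rewrite E'].
Qed.

Let q0 : 0 < q. Proof. exact: lt_le_trans (lt_trans ltr01 p1) pq. Qed.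
Let p0 : 0 < p. Proof. exact: lt_trans ltr01 p1. Qed.
Let s1 : 1 <= q / p. Proof. by rewrite ler_pdivlMr// mul1r. Qed.

Lemma powR_powR_div (x : R) : (x `^ p) `^ (q / p) = x `^ q.
Proof. by rewrite -powRrM mulrC divfK// gt_eqF. Qed.

Lemma nnmeas_norm_slots i (r : R) : Inc i -> nnmeas (fun s => (`|on_slots (h i) s| `^ r)%:E).
Proof.
move=> Ii; rewrite (_ : (fun _ => _) = fun s => (`|on_slots (h i) s|%:E `^ r)%E).
  apply: nnmeas_poweR; apply: smeas_norm; apply: smeas_on_slots; exact: mh.
by apply/funext => s; rewrite poweR_EFin.
Qed.

Lemma norm_slots_fin l : l \in dec m N ->
  (\int[Q]_s (`|on_slots (h (mi m l)) s| `^ q)%:E < +oo)%E.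
Proof.
move=> lN; have [Il _] := mi_Inc_le lN; rewrite integral_path_law; last exact: nnmeas_norm_slots.
exact: fh (mi_Inc_le lN).
Qed.

Lemma nu_le_powR (r : R) x : 0 <= r -> nu x `^ r <= `|x| `^ r.
Proof.
move=> r0; rewrite ge0_ler_powR ?nnegrE ?(is_norm_ge0 norm_nu)//.
by rewrite -[leRHS]mul1r.
Qed.

Lemma PhiE (v : E) t : Phi v t = (nu ((v : seqspace S -> B) t) `^ p)%:E.
Proof. by []. Qed.

Lemma summand_fin l : fin (q / p) (summand l : E).
Proof.
rewrite /summand; case: ifPn => [lN|_]; last by apply: fin0; rewrite divr_gt0.
have [Il _] := mi_Inc_le lN.
apply: le_lt_trans (norm_slots_fin lN); rewrite /fin -[leRHS](path_law_relabel iid_xi (place_inj lN))//; last first.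
  exact: nnmeas_norm_slots.
have ms : smeas (on_slots (h (mi m l)) \o relabel (place m N l)).
  by have := summand_smeas l; rewrite /summand lN.
apply: nnint_le => [||t].
- apply: nnmeas_poweR; exact: (nnmeas_norm_powR dense_e norm_nu L0 nu_le p ms).
- have [mF F0] := nnmeas_norm_slots q Il; split=> //.
  exact: (measurableT_comp mF (measurable_relabel (place m N l))).
by rewrite PhiE poweR_EFin powR_powR_div lee_fin nu_le_powR// ltW.
Qed.

Definition partial_sum n : seqspace S -> B := \sum_(l <- dec m n) summand l.

Lemma partial_sumS k : (1 <= m)%N -> partial_sum k.+1 =
  partial_sum k + \sum_(l <- dec m.-1 k) summand (k.+1 :: l).
Proof.
rewrite /partial_sum; case: m => // m' _.
by rewrite !dec_sumS big_nat_recr.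
Qed.

Lemma dec_mono n l : (n <= N)%N -> l \in dec m n -> l \in dec m N.
Proof.
move=> nN; rewrite !mem_dec_rev => /and3P[-> -> /allP h'] /=.
by apply/allP => k /h' /andP[-> kn]; exact: leq_trans kn nN.
Qed.

Lemma dec_step k l : (1 <= m)%N -> (k < N)%N -> l \in dec m.-1 k -> (k.+1 :: l) \in dec m N.
Proof. by move=> m1 kN lk; rewrite -(prednK m1); apply: dec_cons. Qed.

Lemma sum_smeas (r : seq (seq nat)) (g : seq nat -> seq nat) :
  smeas (\sum_(l <- r) summand (g l) : seqspace S -> B).
Proof.
by apply: (@subr_closed_sum _ _ _ Q p C E (fun v => adm v)) => [|x y|l _ _];
  [exact: adm0|exact: admB|exact: summand_smeas].
Qed.

Lemma partial_sum_indep k j : (k < j <= N)%N -> indep j (partial_sum k).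
Proof.
move=> /andP[kj jN]; apply: (@subr_closed_sum _ _ _ Q p C E (fun v => ind j v)) => [|x y|l lk _].
- exact: ind0.
- exact: indB.
apply: summand_indep; first by apply: dec_mono lk; exact: ltnW (leq_trans kj jN).
by apply/negP => /(dec_bounds lk)/andP[_]; rewrite leqNgt kj.
Qed.

Definition nu_sum n s := (nu (partial_sum n s))%:E.

Lemma nnmeas_nu_sum n : nnmeas (nu_sum n).
Proof.
split=> [|s]; last by rewrite lee_fin is_norm_ge0.
apply/measurable_EFinP; apply: (measurable_normfun dense_e norm_nu L0 nu_le).
exact: (sum_smeas _ id).
Qed.

Local Open Scope ereal_scope.

Lemma Phi_partial_sum n t : Phi (partial_sum n : E) t `^ (q / p) = nu_sum n t `^ q.
Proof. by rewrite PhiE !poweR_EFin powR_powR_div. Qed.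

Lemma nu_sum_fin n : \int[Q]_t nu_sum n t `^ q < +oo.
Proof.
under eq_integral do rewrite -Phi_partial_sum.
apply: (@fin_sum _ _ _ Q p C (q / p) E) => [|l|l]; first exact: divr_gt0.
  exact: summand_smeas.
exact: summand_fin.
Qed.

(** The maximum over [n] is treated once, outside the induction, for the norm itself: the exponent 1
    in [centered_jensen] makes [nu_sum] a submartingale. *)
Lemma nu_sum_doob : (1 <= m)%N ->
  \int[Q]_s run_max nu_sum N s `^ q <= (doobK q)%:E * \int[Q]_s nu_sum N s `^ q.
Proof.
move=> m1; apply: (@doob_maximal _ _ S Q).
- exact: lt_le_trans p1 pq.
- exact: nnmeas_nu_sum.
- by move=> k j kj s y; rewrite /nu_sum (partial_sum_indep kj).
- move=> k W kN mW iW; rewrite /nu_sum partial_sumS//.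
  set D := (\sum_(l <- _) _)%R.
  have cD : centered phi mu Q k.+1 D.
    apply: (@subr_closed_sum _ _ _ Q p C E (fun v => cen k.+1 v)) => [|x y|l lk _].
    - exact: cen0.
    - exact: cenB.
    - apply: summand_centered; last by rewrite inE eqxx.
      exact: dec_step.
  have ik : indep k.+1 (partial_sum k) by apply: partial_sum_indep; rewrite ltnSn.
  have := centered_jensen dense_e norm_nu L0 nu_le norming_nu resQ (lexx 1%R) (ltn0Sn k)
    (sum_smeas (dec m k) id) (sum_smeas _ _) ik cD mW iW.
  under eq_integral do rewrite powRr1 ?is_norm_ge0//.
  by under [X in _ <= X -> _]eq_integral do rewrite powRr1 ?is_norm_ge0//.
- by move=> k _; exact: nu_sum_fin.
Qed.

(** The guard restricts to the indices where the kernel is known to be measurable with a finite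
    moment. *)
Definition slot_power (i : multi_index m) (s : seqspace S) : \bar R :=
  if `[< Inc_le N i >] then (`|on_slots (h i) s| `^ p)%:E else 0.

Lemma nnmeas_slot_power i : nnmeas (slot_power i).
Proof.
rewrite /slot_power; case: asboolP => [[Ii _]|_]; first exact: nnmeas_norm_slots.
exact: (nnmeas_cst _ (lexx _)).
Qed.

Lemma slot_power_depends i : depends_on (slots [set: 'I_m]%SET) (slot_power i).
Proof.
move=> s s' ss'; rewrite /slot_power; case: asboolP => // _.
by rewrite (depends_on_slots (h i) ss').
Qed.

Lemma slot_powerE i s : Inc_le N i -> slot_power i s = (`|on_slots (h i) s| `^ p)%:E.
Proof. by move=> iN; rewrite /slot_power asboolT. Qed.

Lemma slot_power_poweR i s : Inc_le N i ->
  slot_power i s `^ (q / p) = (`|on_slots (h i) s| `^ q)%:E.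
Proof. by move=> iN; rewrite slot_powerE// poweR_EFin powR_powR_div. Qed.

Lemma slot_power_fin i : \int[Q]_t slot_power i t < +oo.
Proof.
have [iN|niN] := pselect (Inc_le N i); last first.
  by rewrite /slot_power asboolF// integral0 ltry.
have m1 := nnmeas_slot_power i.
have : (\int[Q]_t slot_power i t) `^ (q / p) < +oo.
  apply: le_lt_trans (jensen_poweR Q s1 m1) _.
  under eq_integral do rewrite slot_power_poweR//.
  have [l lN <-] := Inc_le_mi iN; exact: norm_slots_fin.
move: (nnint_ge0 Q m1); case: (\int[Q]_t slot_power i t) => [r _ _|_|//]; first exact: ltry.
by rewrite poweRyr ?ltxx// gt_eqF// divr_gt0.
Qed.

Lemma nu_sum_bound (K : R) : (1 <= m)%N -> (0 < K)%R -> two_point_const p (q / p) C K ->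
  \int[Q]_s nu_sum N s `^ q <= (rosK (q / p) K ^+ m)%:E *
    \sum_(u <- pats m N) \int[Q]_t slot_sum xi N slot_power u t `^ (q / p).
Proof.
move=> m1 K0 HK; have s0 : (0 < q / p)%R by rewrite divr_gt0.
under eq_integral do rewrite -Phi_partial_sum.
have := @degenerate_moment_bound _ _ S mu Q resQ p C (q / p) K E m N summand p1 C0 s1 K0 HK
  summand_smeas.
move=> /(_ _)/le_trans; apply.
  move=> l lN; split=> [j jl|j _ jl|]; last exact: summand_fin.
    exact: summand_centered.
  exact: summand_indep.
apply: lee_wpmul2l.
  rewrite lee_fin exprn_ge0// /rosK.
  by rewrite !mulr_ge0 ?(ltW K0)// addr_ge0// powR_ge0.
have mPhi l : nnmeas (Phi (summand l : E)) := @nnmeas_Phi _ _ _ _ _ _ E (summand l) (summand_smeas l).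
have := moment_bound_pats mu Q m s0 (leqnn N) mPhi; move=> /le_trans; apply.
rewrite big_seq_cond [leRHS]big_seq_cond.
apply: lee_sum => u; rewrite mem_pats => /andP[/andP[/eqP su _] _].
have := pat_sum_relabel iid_xi N su s0 (fun l => nnmeas_slot_power (mi m l))
  (fun l => @slot_power_depends (mi m l)).
move=> <-.
have mF l : nnmeas (slot_power (mi m l) \o relabel (place m N l)).
  have [mF F0] := nnmeas_slot_power (mi m l); split=> [|t]; last exact: F0.
  exact: (measurableT_comp mF (measurable_relabel (place m N l))).
apply: nnint_le => [||t]; try by apply: nnmeas_poweR; exact: nnmeas_pat_sum.
apply: gt0_ler_poweR; rewrite ?(ltW s0) ?in_itv/= ?leey ?andbT//;
  try by apply: nnmeas_ge0; exact: nnmeas_pat_sum.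
apply: lee_sum => l _; apply: avs_le => [||s]; [exact: mPhi|exact: mF|].
rewrite /summand; case: ifPn => [lN|_]; last first.
  by apply: le_trans (nnmeas_ge0 s (mF l)); rewrite -(Phi0 E s).
rewrite [leRHS]/= slot_powerE; last exact: mi_Inc_le.
by rewrite lee_fin nu_le_powR// ltW.
Qed.

Lemma partial_sum_path n t : (n <= N)%N ->
  (\sum_(i \in @Inc_le m n) h i (xi_at xi i t))%R = partial_sum n (xi_path xi t).
Proof.
move=> nN; rewrite fsbig_Inc_le /partial_sum fct_sumE big_seq [RHS]big_seq.
apply: eq_bigr => l ln; have lN := dec_mono nN ln.
rewrite /summand lN /= on_slots_place; congr (h _); apply: eq_mktuple => j.
have [[i1 _] _] := mi_Inc_le lN.
by rewrite /xi_path; case: (mi m l j) (i1 j).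
Qed.

Lemma max_partial_sum :
  'E_P[fun t => (\big[Num.max/0]_(m <= n < N.+1)
          `| \sum_(i \in @Inc_le m n) h i (xi_at xi i t) | `^ q)%R]
  <= (c^-1 `^ q)%:E * \int[Q]_s run_max (nu_sum) N s `^ q.
Proof.
pose G s := (\big[Num.max/0%R]_(m <= n < N.+1) (`| partial_sum n s | `^ q)%R)%:E.
have mG : nnmeas G.
  apply: nnmeas_bigmax => n.
  apply: (nnmeas_poweR (F := fun s => (`|partial_sum n s|)%:E) q); apply: smeas_norm.
  exact: (sum_smeas (dec m n) id).
have mrun := nnmeas_run_max N nnmeas_nu_sum.
have cq0 : (0 <= c^-1 `^ q :> R)%R by exact: powR_ge0.
rewrite unlock -nnintZ//; last exact: nnmeas_poweR.
rewrite [leLHS](_ : _ = \int[Q]_s G s); last first.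
  rewrite (integral_path_law xi mG); apply: eq_integral => t _; congr (_%:E).
  by rewrite big_nat [RHS]big_nat; apply: eq_bigr => n /andP[_ nN]; rewrite partial_sum_path.
apply: nnint_le => // [|s]; first by apply: nnmeasZ => //; exact: nnmeas_poweR.
apply: bigmax_le_ereal => [|n]; first by rewrite mule_ge0 ?poweR_ge0.
rewrite mem_index_iota => /andP[_ nN].
apply: (@le_trans _ _ ((c^-1 `^ q)%:E * nu_sum n s `^ q)).
  rewrite /nu_sum poweR_EFin -EFinM lee_fin -powRM ?invr_ge0 ?(ltW c0) ?(is_norm_ge0 norm_nu)//.
  apply: ge0_ler_powR; rewrite ?(ltW q0)// ?nnegrE//.
    by rewrite mulr_ge0 ?invr_ge0 ?(ltW c0) ?(is_norm_ge0 norm_nu).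
  by rewrite mulrC ler_pdivlMr// mulrC.
apply: lee_wpmul2l => //; apply: gt0_ler_poweR; rewrite ?(ltW q0) ?in_itv/= ?leey ?andbT//.
- by rewrite lee_fin (is_norm_ge0 norm_nu).
- exact: nnmeas_ge0 mrun.
- exact: le_run_max.
Qed.

Lemma pattern_totals_expectation : (1 <= m)%N ->
  \sum_(u <- pats m N) \int[Q]_t slot_sum xi N slot_power u t `^ (q / p) <=
  \sum_(i \in @Inc_le m N) 'E_P[fun t => (`|h i (xi_first xi m t)| `^ q)%R] +
  mixed_term xi N (q / p) (fun i t => (`|h i (xi_first xi m t)| `^ p)%:E) +
  (\sum_(i \in @Inc_le m N) 'E_P[fun t => (`|h i (xi_first xi m t)| `^ p)%R]) `^ (q / p)%R.
Proof.
move=> m1; have s0 : (0 < q / p)%R by rewrite divr_gt0.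
have := pattern_totals iid_xi N m1 s0 nnmeas_slot_power slot_power_depends slot_power_fin.
move=> /le_trans; apply.
have E1 (r : R) l : l \in dec m N ->
    \int[Q]_t (`|on_slots (h (mi m l)) t| `^ r)%:E = 'E_P[fun t => (`|h (mi m l) (xi_first xi m t)| `^ r)%R].
  move=> lN; have [Il _] := mi_Inc_le lN; rewrite unlock.
  exact: (integral_path_law xi (nnmeas_norm_slots r Il)).
have -> : \sum_(l <- dec m N) \int[path_law xi]_t slot_power (mi m l) t `^ (q / p) =
    \sum_(i \in @Inc_le m N) 'E_P[fun t => (`|h i (xi_first xi m t)| `^ q)%R].
  rewrite fsbig_Inc_le big_seq [RHS]big_seq; apply: eq_bigr => l lN; rewrite -(E1 q l lN).
  by apply: eq_integral => t _; exact: (slot_power_poweR t (mi_Inc_le lN)).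
have -> : \sum_(l <- dec m N) \int[path_law xi]_t slot_power (mi m l) t =
    \sum_(i \in @Inc_le m N) 'E_P[fun t => (`|h i (xi_first xi m t)| `^ p)%R].
  rewrite fsbig_Inc_le big_seq [RHS]big_seq; apply: eq_bigr => l lN; rewrite -(E1 p l lN).
  by apply: eq_integral => t _; exact: (slot_powerE t (mi_Inc_le lN)).
rewrite (@eq_mixed_term _ _ _ _ _ _ _ _ _ _ _ (fun i t => (`|h i (xi_first xi m t)| `^ p)%:E))//.
by move=> i iN; apply/funext => t; exact: (slot_powerE (xi_path xi t) iN).
Qed.

End Kernels.

(** Dividing by the upper equivalence constant makes [nu] at most the norm of [B], so that its
    moments are bounded with constant 1; the two-point inequality is homogeneous and keeps its
    [C]. *)
Lemma normalized_smooth_norm (R : realType) (B : normedModType R) (p r : R) :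
  1 < p -> p <= r -> r <= 2 -> smooth B r ->
  exists (nu : B -> R) (c C : R), [/\ is_norm nu, 0 < c,
    (forall x, c * `|x| <= nu x) /\ (forall x, nu x <= 1 * `|x|), 0 <= C & two_point_smooth nu p C].
Proof.
move=> p1 pr r2 smB; have [nu [[norm_nu [a [b [a0 b0 nuab]]]] [C C0 smC]]] := smooth_two_point p1 pr r2 smB.
have b0' : 0 <= b^-1 by rewrite invr_ge0 ltW.
have nu0 := is_norm_ge0 norm_nu.
exists (fun x => b^-1 * nu x), (b^-1 * a), C; split => //.
- split=> [x y|u x|x].
  + by rewrite -mulrDr ler_wpM2l// is_normD.
  + by rewrite (is_normZ norm_nu) mulrCA.
  + by move=> /eqP; rewrite mulf_eq0 invr_eq0 gt_eqF//= => /eqP; exact: is_norm_eq0.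
- by rewrite mulr_gt0 ?invr_gt0.
- split=> x; have /andP[h1 h2] := nuab x; first by rewrite -mulrA ler_wpM2l.
  by rewrite mul1r mulrC ler_pdivrMr// mulrC.
- move=> x y; rewrite !powRM// mulrCA [C * _]mulrCA -!mulrDr.
  by apply: ler_wpM2l; [exact: powR_ge0|exact: smC].
Qed.

Section Constants.
Context {R : realType}.

Lemma doobK_gt0 (q : R) : 1 < q -> 0 < doobK q.
Proof.
move=> q1; have h : 0 < 1 - q^-1 by rewrite subr_gt0 invf_lt1// (lt_trans ltr01).
by rewrite /doobK !mulr_gt0 ?invr_gt0 ?powR_gt0 ?divr_gt0.
Qed.

Lemma rosK_gt0 (s K : R) : 0 < K -> 0 < rosK s K.
Proof. by move=> K0; rewrite /rosK !mulr_gt0// ltr_wpDr ?powR_ge0. Qed.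

(** [K + 1] rather than [K], for positivity. *)
Lemma two_point_const_exists (p s C : R) : 1 < p <= 2 -> 1 <= s -> 0 <= C ->
  exists2 K, 0 < K & two_point_const p s C K.
Proof.
move=> p12 s1 C0; have [K K0 HK] := two_point_powR p12 s1 C0.
exists (K + 1); first by rewrite ltr_wpDl.
move=> u v w d u0 v0 w0 d0 h1 h2 h3 h4 h5.
apply: le_trans (HK u v w d u0 v0 w0 d0 h1 h2 h3 h4 h5) _.
by rewrite lerD2l ler_wpM2r ?lerDl// addr_ge0 ?mulr_ge0 ?powR_ge0.
Qed.

End Constants.

Lemma sume_infty (R : realType) (I : eqType) (r : seq I) (F : I -> \bar R) i :
  (forall j, 0 <= F j)%E -> i \in r -> F i = +oo%E -> (\sum_(j <- r) F j = +oo)%E.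
Proof.
move=> F0 ir Fi; rewrite (perm_big _ (perm_to_rem ir)) big_cons Fi; apply: addye.
by apply/negbT/gt_eqF; rewrite (lt_le_trans (ltNyr 0))// sume_ge0.
Qed.

Theorem corollary1p8 (R : realType) (B : completeNormedModType R)
    (m : nat) (p q : R) :
  separable B -> (1 <= m)%N -> 1 < p -> p <= q ->
  exists K : R, 0 < K /\
  forall r : R, 1 < r <= 2 -> smooth B r -> p <= r ->
  forall (d : measure_display) (T : measurableType d) (P : probability T R)
    (d' : measure_display) (S : measurableType d')
    (xi : nat -> {RV P >-> S}) (h : multi_index m -> m.-tuple S -> B),
  iid xi ->
  (forall i, Inc i -> measurable_wrt measurable (@borel_sets B) (h i)) ->
  (forall i, Inc i -> degenerated xi (h i)) ->
  forall N : nat, (m <= N)%N ->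
  ('E_P[fun t => (\big[Num.max/0]_(m <= n < N.+1)
          `| \sum_(i \in @Inc_le m n) h i (xi_at xi i t) | `^ q)%R]
   <= K%:E * (\sum_(i \in @Inc_le m N) 'E_P[fun t => (`|h i (xi_first xi m t)| `^ q)%R])
    + K%:E * (\sum_(J : {set 'I_m} | (J != finset.set0) && (J != [set: 'I_m]%SET))
        \esum_(iJ in indices_on J)
          \int[P]_t
            ((\sum_(iJc \in [set iJc | indices_on (~: J)%SET iJc /\
                                       @Inc_le m N (iJ + iJc)%R])
                cond_expectation P (sigma_xi xi J)
                  (fun t' => (`|h (iJ + iJc)%R (xi_first xi m t')| `^ p)%R%:E) t)
             `^ (q / p)%R))
    + K%:E * ((\sum_(i \in @Inc_le m N)
                'E_P[fun t => (`|h i (xi_first xi m t)| `^ p)%R]) `^ (q / p)%R))%E.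
Proof.
move=> sepB m1 p1 pq.
have p0 : 0 < p by exact: lt_trans p1.
have q1 : 1 < q by exact: lt_le_trans pq.
have s1 : 1 <= q / p by rewrite ler_pdivlMr// mul1r.
(* The constant may not depend on [r]: it is built from one admissible [r0], and if there is none
   the claim is vacuous. *)
have [[r0 [r12 pr smB]]|none] := pselect (exists r, [/\ 1 < r <= 2, p <= r & smooth B r]); last first.
  by exists 1; split=> // r r12 smB pr; exfalso; apply: none; exists r.
have /andP[_ r2] := r12.
have [nu [c [C [norm_nu c0 [c_nu nu_le] C0 sm_nu]]]] := normalized_smooth_norm p1 pr r2 smB.
have [e dense_e] := separable_seq sepB.
have eqv : equivalent_norm nu.
  by split=> //; exists c, 1; split=> // x; rewrite c_nu nu_le.
have [phi norming_nu] := norming_exists sepB eqv p1 C0 sm_nu.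
have p12 : 1 < p <= 2 by rewrite p1 (le_trans pr).
have [K0 K00 HK] := two_point_const_exists p12 s1 C0.
(* The factors come from the equivalence of norms, Doob's inequality and the [m] levels of
   Rosenthal's inequality. *)
pose K := c^-1 `^ q * (doobK q * rosK (q / p) K0 ^+ m).
have Kgt0 : 0 < K.
  apply: mulr_gt0; first by rewrite powR_gt0 ?invr_gt0.
  by apply: mulr_gt0; [exact: doobK_gt0|apply: exprn_gt0; exact: rosK_gt0].
exists K; split=> // r _ _ _ d T P d' S xi h iid_xi mh dh N mN.
pose EQ i : \bar R := 'E_P[fun t => (`|h i (xi_first xi m t)| `^ q)%R]%E.
pose EP i : \bar R := 'E_P[fun t => (`|h i (xi_first xi m t)| `^ p)%R]%E.
pose mid := mixed_term xi N (q / p) (fun i t => (`|h i (xi_first xi m t)| `^ p)%:E).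
have EQ0 i : (0 <= EQ i)%E.
  by rewrite /EQ unlock; apply: integral_ge0 => t _; rewrite lee_fin powR_ge0.
have A0 : (0 <= \sum_(i \in @Inc_le m N) EQ i)%E by rewrite fsbig_Inc_le sume_ge0.
have mid0 : (0 <= mid)%E by exact: mixed_term_ge0.
have C0' : (0 <= (\sum_(i \in @Inc_le m N) EP i) `^ (q / p))%E by exact: poweR_ge0.
have K0' : (0 <= K%:E)%E by rewrite lee_fin ltW.
suff : ('E_P[fun t => (\big[Num.max/0]_(m <= n < N.+1)
          `| \sum_(i \in @Inc_le m n) h i (xi_at xi i t) | `^ q)%R] <=
    K%:E * ((\sum_(i \in @Inc_le m N) EQ i) + mid + (\sum_(i \in @Inc_le m N) EP i) `^ (q / p)))%E.
  move=> /le_trans; apply; rewrite ge0_muleDr ?adde_ge0// ge0_muleDr//.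
(* If some moment of order [q] is infinite, so is the right-hand side; otherwise all the absorptions
   are legitimate. *)
have [fin|/existsNP[i /not_implyP[iN inf]]] :=
    pselect (forall i, Inc_le N i -> (\int[P]_t (`|h i (xi_first xi m t)| `^ q)%:E < +oo)%E); last first.
  have EQoo : EQ i = +oo%E.
    by apply/eqP; rewrite eq_le leey /= leNgt; apply/negP; rewrite /EQ unlock.
  have -> : (\sum_(i \in @Inc_le m N) EQ i = +oo)%E.
    have [l lN li] := Inc_le_mi iN.
    by rewrite fsbig_Inc_le; apply: (@sume_infty _ _ _ (fun l => EQ (mi m l)) l) => //; rewrite li.
  by rewrite !addye ?gt_eqF ?(lt_le_trans (ltNyr 0))// ?gt0_muley ?lte_fin// leey.
apply: le_trans (max_partial_sum dense_e norm_nu c0 c_nu nu_le norming_nu p1 pq sm_nu iid_xi N mh) _.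
have cq0 : (0 <= (c^-1 `^ q)%:E)%E by rewrite lee_fin powR_ge0.
have dq0 : (0 <= (doobK q)%:E)%E by rewrite lee_fin ltW ?doobK_gt0.
rewrite EFinM EFinM -!muleA; apply: lee_wpmul2l => //.
apply: le_trans (nu_sum_doob dense_e norm_nu c0 c_nu nu_le norming_nu p1 pq sm_nu iid_xi mh dh fin m1) _.
apply: lee_wpmul2l => //.
apply: le_trans (nu_sum_bound dense_e norm_nu c0 c_nu nu_le norming_nu p1 pq C0 sm_nu iid_xi mh dh fin
  m1 K00 HK) _.
apply: lee_wpmul2l; first by rewrite lee_fin exprn_ge0// ltW// rosK_gt0.
exact: (pattern_totals_expectation p1 pq iid_xi mh fin m1).
Qed.
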